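(* Let $[X_{\mathbf{cl}}(s;t,x,v),V_{\mathbf{cl}}(s;t,x,v)]$ be the specular backward trajectory. There exists $C=C(\Omega)>0$ such that for all $(s;t,x,v)\in\mathbb R\times\mathbb R\times\bar\Omega\times\mathbb R^3$ with $s\le t$, $(x,v)\notin\gamma_0$ and $s\ne t^\ell$ for $\ell=1,2,\dots,\ell_*$, $$|\partial_xX_{\mathbf{cl}}(s;t,x,v)|\lesssim e^{C|v|(t-s)}\frac{|v|}{\sqrt{\alpha(x,v)}},\qquad|\partial_vX_{\mathbf{cl}}(s;t,x,v)|\lesssim e^{C|v|(t-s)}\frac1{|v|},$$ $$|\partial_xV_{\mathbf{cl}}(s;t,x,v)|\lesssim e^{C|v|(t-s)}\frac{|v|^3}{\alpha(x,v)},\qquad|\partial_vV_{\mathbf{cl}}(s;t,x,v)|\lesssim e^{C|v|(t-s)}\frac{|v|}{\sqrt{\alpha(x,v)}}.$$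
   Context: Domain: $\Omega\subset\mathbb R^3$ is a bounded open set for which there is a smooth $\xi:\mathbb R^3\to\mathbb R$ with $\Omega=\{\xi<0\}$, $\partial\Omega=\{\xi=0\}$, $\nabla\xi(x)\ne0$ when $|\xi(x)|\ll1$, and $\sum_{i,j}\partial_{ij}\xi(x)\zeta_i\zeta_j\ge C_\xi|\zeta|^2$ for all $x\in\bar\Omega$, $\zeta\in\mathbb R^3$ ($C_\xi>0$). $n(x)=\nabla\xi(x)/|\nabla\xi(x)|$ is the outward normal. $\gamma_0=\{(x,v)\in\partial\Omega\times\mathbb R^3:n(x)\cdot v=0\}$. $\alpha(x,v)=|v\cdot\nabla\xi(x)|^2-2\{v\cdot\nabla^2\xi(x)\cdot v\}\xi(x)$. The right-hand sides are understood for $v\neq0$ (so $\alpha(x,v)>0$). Backward exit time: $t_{\mathbf b}(x,v)=\inf\{\tau>0:x-\tau v\notin\Omega\}$, $x_{\mathbf b}(x,v)=x-t_{\mathbf b}(x,v)v$. Specular cycles: $(t^0,x^0,v^0)=(t,x,v)$ and, for $\ell\ge0$, $t^{\ell+1}=t^\ell-t_{\mathbf b}(x^\ell,v^\ell)$, $x^{\ell+1}=x_{\mathbf b}(x^\ell,v^\ell)$, $v^{\ell+1}=v^\ell-2n(x^{\ell+1})(v^\ell\cdot n(x^{\ell+1}))$. Specular backward trajectory: $X_{\mathbf{cl}}(s;t,x,v)=\sum_\ell\mathbf 1_{[t^{\ell+1},t^\ell)}(s)\{x^\ell-(t^\ell-s)v^\ell\}$, $V_{\mathbf{cl}}(s;t,x,v)=\sum_\ell\mathbf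 1_{[t^{\ell+1},t^\ell)}(s)v^\ell$. The index $\ell_*=\ell_*(s;t,x,v)$ is determined by $t^{\ell_*+1}\le s<t^{\ell_*}$. $\partial_x,\partial_v$ denote the Jacobian matrices in $x$ and $v$. The implicit constants in $\lesssim$ depend only on $\Omega$.
   Formalization: The condition s ≠ t^ℓ is required for ℓ = 1,…,ℓ_*+1 rather than ℓ = 1,…,ℓ_*: with t^{ℓ_*+1} ≤ s < t^{ℓ_*} the stated condition is vacuous, and at s = t^{ℓ_*+1} the velocity V_cl jumps, so the derivatives do not exist. *)

(* Defs.v *)
From HB Require Import structures.
From mathcomp Require Import all_boot all_order all_algebra.
From mathcomp Require Import all_classical all_reals all_analysis.

Set Implicit Arguments.
Unset Strict Implicit.
Unset Printing Implicit Defensive.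

Import Order.TTheory GRing.Theory Num.Theory.
Import numFieldNormedType.Exports.

Local Open Scope classical_set_scope.
Local Open Scope ring_scope.

Section Euclidean.
Variable R : realType.

(* MathComp-Analysis puts the sup norm on matrices: it gives the topology and
   the notion of differentiability, but |.| below is always this Euclidean
   (for matrices: Frobenius) norm. *)
Definition enorm m n (A : 'M[R]_(m, n)) : R :=
  Num.sqrt (\sum_i \sum_j A i j ^+ 2).

Definition dot n (u w : 'rV[R]_n) : R := \sum_i u 0 i * w 0 i.

Definition bilin n (u : 'rV[R]_n) (A : 'M[R]_n) (w : 'rV[R]_n) : R :=
  \sum_i \sum_j A i j * u 0 i * w 0 j.

End Euclidean.

Section Calculus.
Variable R : realType.

Definition partial n (i : 'I_n) (f : 'rV[R]_n -> R) : 'rV[R]_n -> R :=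
  fun x => 'D_(delta_mx 0 i) f x.

Definition iter_partial n (s : seq 'I_n) (f : 'rV[R]_n -> R) : 'rV[R]_n -> R :=
  foldr (@partial n) f s.

(* C^oo: every iterated partial derivative exists and is continuous. *)
Definition smooth n (f : 'rV[R]_n -> R) : Prop :=
  forall s : seq 'I_n, continuous (iter_partial s f) /\
    forall (i : 'I_n) (x : 'rV[R]_n),
      derivable (iter_partial s f) x (delta_mx 0 i).

Definition grad n (f : 'rV[R]_n -> R) (x : 'rV[R]_n) : 'rV[R]_n :=
  \row_i partial i f x.

Definition hess n (f : 'rV[R]_n -> R) (x : 'rV[R]_n) : 'M[R]_n :=
  \matrix_(i, j) partial i (partial j f) x.

(* Derivative relative to a set A containing x: the increments of the argument
   are restricted to A (needed at boundary points, as the billiard flow only makes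
   sense for positions in the closed domain). It is the ordinary derivative when x is interior to A.
   As for [jacobian], matrices act on row vectors, so this is the transpose of
   the usual Jacobian matrix (with the same Frobenius norm). *)
Definition differentiable_in n m (A : set 'rV[R]_n) (f : 'rV[R]_n -> 'rV[R]_m)
    (x : 'rV[R]_n) : Prop :=
  differentiable f (within A (nbhs x)).

Definition jacobian_in n m (A : set 'rV[R]_n) (f : 'rV[R]_n -> 'rV[R]_m)
    (x : 'rV[R]_n) : 'M[R]_(n, m) :=
  lin1_mx ('d f (within A (nbhs x))).

End Calculus.

Section Billiard.
Variable R : realType.
Notation V := 'rV[R]_3.
Implicit Types (Omega : set V) (xi : V -> R) (s t : R) (x v : V) (l : nat).

Definition boundary (A : set V) : set V := closure A `\` interior A.

Record strictly_convex_domain Omega xi : Prop := StrictlyConvexDomain {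
  scd_open : open Omega;
  scd_bounded : bounded_set Omega;
  scd_smooth : smooth xi;
  scd_interior : Omega = [set x | xi x < 0];
  scd_boundary : boundary Omega = [set x | xi x = 0];
  scd_grad : exists2 delta : R, 0 < delta &
    forall x, `|xi x| < delta -> grad xi x != 0;
  scd_convex : exists2 C : R, 0 < C &
    forall x (zeta : V), closure Omega x ->
      C * enorm zeta ^+ 2 <= bilin zeta (hess xi x) zeta
}.

Definition normal xi x : V := (enorm (grad xi x))^-1 *: grad xi x.

Definition gamma0 Omega xi : set (V * V) :=
  [set xv | boundary Omega xv.1 /\ dot (normal xi xv.1) xv.2 = 0].

Definition alpha xi x v : R :=
  dot v (grad xi x) ^+ 2 - 2 * bilin v (hess xi x) v * xi x.

Definition tb Omega x v : R :=
  inf [set tau | 0 < tau /\ ~ Omega (x - tau *: v)].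

Definition xb Omega x v : V := x - tb Omega x v *: v.

Definition reflect_vel xi x v : V :=
  v - (2 * dot v (normal xi x)) *: normal xi x.

Fixpoint specular_cycle Omega xi t x v l : R * V * V :=
  if l is l'.+1 then
    let: (t', x', v') := specular_cycle Omega xi t x v l' in
    (t' - tb Omega x' v', xb Omega x' v', reflect_vel xi (xb Omega x' v') v')
  else (t, x, v).

Definition cycle_t Omega xi t x v l : R := (specular_cycle Omega xi t x v l).1.1.
Definition cycle_x Omega xi t x v l : V := (specular_cycle Omega xi t x v l).1.2.
Definition cycle_v Omega xi t x v l : V := (specular_cycle Omega xi t x v l).2.

Definition cycle_indic Omega xi s t x v l : R :=
  \1_(`[cycle_t Omega xi t x v l.+1, cycle_t Omega xi t x v l[) s.

(* The intervals are pairwise disjoint, so at most one term of the series below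
   is nonzero; at s = t none is, and both series vanish. *)
Definition Xcl Omega xi s t x v : V :=
  lim (series (fun l => cycle_indic Omega xi s t x v l *:
    (cycle_x Omega xi t x v l
      - (cycle_t Omega xi t x v l - s) *: cycle_v Omega xi t x v l)) @ \oo).

Definition Vcl Omega xi s t x v : V :=
  lim (series (fun l => cycle_indic Omega xi s t x v l *:
    cycle_v Omega xi t x v l) @ \oo).

(* l is the index l_*(s; t, x, v); there is none when s = t. *)
Definition is_lstar Omega xi s t x v l : Prop :=
  cycle_t Omega xi t x v l.+1 <= s < cycle_t Omega xi t x v l.

End Billiard.

(* Main.v *)
Require Import Defs.
From HB Require Import structures.
From mathcomp Require Import all_boot all_order all_algebra.
From mathcomp Require Import all_classical all_reals all_analysis.
From mathcomp Require Import ring lra.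
Import Order.TTheory GRing.Theory Num.Theory.
Import numFieldNormedType.Exports.
Local Open Scope classical_set_scope.
Local Open Scope ring_scope.
Set Implicit Arguments.
Unset Strict Implicit.
Unset Printing Implicit Defensive.

(* Along a trajectory, write G = grad xi and let (dp, dv, dt) be the derivatives of the position,
   velocity and time of a bounce with respect to a parameter. At unit speed and at a bounce with
   normal velocity a = v . G, consider the energy
     |dp - dt v| + |variation of v ^ G| + |variation of v . G| + a |dt|,
   the two variations being taken along (dp - dt v, dv) and (dp, dv). Reflections preserve v ^ G
   and change the sign of v . G, and the flight to the next bounce is of duration tau = O(a).
   Taylor expansions of xi and of its variation along the chord, which both vanish at the two
   endpoints, show that the flight multiplies the energy by at most 1 + C tau and divides a by
   at most 1 + C tau. Products of these factors over the bounces are at most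
   exp(C |v| (t - s)), whatever the number of bounces. Convexity, in the form a >= c tau,
   makes the estimates uniform as a -> 0, and a Gronwall argument for alpha on the first flight
   gives a >= c sqrt(alpha) / |v| at the first bounce, where the energy is at most
   C (|dx| / a + |dv|). Finally |dv| <= C energy / a, whence the powers of alpha. *)

(** * Estimates along lines *)

(** Multiplying the Jacobians of the single bounces cannot work: the number of bounces up to time
    [s] is unbounded as the normal velocity tends to 0, so even a constant factor per bounce is too
    much and each bounce must cost [1 + O(tau)]. The raw variations do not behave in this way,
    because [dt] is only bounded by energy / [a], and it enters [dp] through [dt v] and [dv] through
    the shift of the velocity jump at the bounce. Freezing the time removes it from the position;
    the product [v ^ G] and the normal velocity [v . G] remove it from the velocity. What remains of
    order [dt] cancels because the jump [2 a] of the normal velocity equals, to leading order, [tau]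
    times the second derivative of [xi] along [v]. Initial data are taken as an arbitrary family
    differentiable along a filter. This treats at once the derivatives in [x] and in [v], and the
    points of the interior and of the boundary, where increments have to stay in the closed
    domain. *)

Lemma ler_eq (R : numDomainType) (x y : R) : x = y -> x <= y.
Proof. by move=> ->. Qed.

Lemma half_lt (R : realType) (x : R) : 0 < x -> x / 2 < x.
Proof. by move=> x0; rewrite ltr_pdivrMr // ltr_pMr // ltr1n. Qed.

Lemma gt0_common (R : realType) (x y : R) : 0 < x -> 0 < y -> exists m, [/\ 0 < m, m < x & m < y].
Proof.
move=> x0 y0; have m0 : 0 < Num.min x y by rewrite lt_min x0.
exists (Num.min x y / 2); split; first exact: divr_gt0.
  by rewrite (lt_le_trans (half_lt m0)) // ge_min lexx.
by rewrite (lt_le_trans (half_lt m0)) // ge_min lexx orbT.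
Qed.

Section OneVariable.
Variable R : realType.
Implicit Types (f g : R -> R) (a b c t s : R).

Lemma mvt_le f (f1 : R -> R) a b c : a <= b ->
  (forall s, is_derive s 1 f (f1 s)) -> (forall s, a <= s <= b -> `|f1 s| <= c) ->
  `|f b - f a| <= c * (b - a).
Proof.
move=> ab df bd.
have [|s sab ->] := MVT_segment ab (fun x _ => df x).
  apply: derivable_within_continuous => x _; exact: ex_derive.
rewrite normrM (ger0_norm (_ : 0 <= b - a)) ?subr_ge0 //.
by rewrite ler_wpM2r ?subr_ge0 // bd // -in_itv.
Qed.

Lemma taylor2_le f (f1 f2 : R -> R) t c : 0 <= t ->
  (forall s, is_derive s 1 f (f1 s)) -> (forall s, is_derive s 1 f1 (f2 s)) ->
  (forall s, 0 <= s <= t -> `|f2 s| <= c) ->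
  `|f t - f 0 - t * f1 0| <= c * t ^+ 2.
Proof.
move=> t0 df ddf bd.
pose g s := f s - s * f1 0.
have dg s : is_derive s 1 g (f1 s - f1 0).
  have := df s => dfs; rewrite /g; apply: is_derive_eq.
  by rewrite scaler0 add0r [_%:A]mulr1.
have c0 : 0 <= c by rewrite (le_trans _ (bd 0 _)) ?lexx.
have := @mvt_le g _ 0 t (c * t) t0 dg; rewrite /g mul0r !subr0.
have -> : f t - t * f1 0 - f 0 = f t - f 0 - t * f1 0 by ring.
rewrite expr2 mulrA; apply=> s /andP[s0 st].
rewrite (le_trans (mvt_le s0 ddf (c := c) _)) //.
  by move=> u /andP[u0 us]; rewrite bd // u0 (le_trans us).
by rewrite subr0 ler_wpM2l.
Qed.

(** The function [g s = s (f1 s + f1 0) - 2 (f s - f 0)] vanishes at 0 together with its derivative,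
    and its second derivative is [s * f3 s]. The cubic error matters: for a function vanishing at
    both ends of a chord, the two end slopes are opposite up to the square of the duration. *)
Lemma trapezoid_le f (f1 f2 f3 : R -> R) t c : 0 <= t ->
  (forall s, is_derive s 1 f (f1 s)) -> (forall s, is_derive s 1 f1 (f2 s)) ->
  (forall s, is_derive s 1 f2 (f3 s)) ->
  (forall s, 0 <= s <= t -> `|f3 s| <= c) ->
  `|t * (f1 t + f1 0) - 2 * (f t - f 0)| <= c * t ^+ 3.
Proof.
move=> t0 df d2f d3f bd.
have c0 : 0 <= c by rewrite (le_trans _ (bd 0 _)) ?lexx.
pose g s := s * (f1 s + f1 0) - 2 * (f s - f 0).
pose g1 s := s * f2 s + f1 0 - f1 s.
have dg s : is_derive s 1 g (g1 s).
  have := df s; have := d2f s => ? ?; rewrite /g; apply: is_derive_eq.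
  rewrite /GRing.scale /= /g1; ring.
have dg1 s : is_derive s 1 g1 (s * f3 s).
  have := d2f s; have := d3f s => ? ?; rewrite /g1; apply: is_derive_eq.
  rewrite /GRing.scale /=; ring.
have -> : t * (f1 t + f1 0) - 2 * (f t - f 0) = g t - g 0 - t * g1 0.
  rewrite /g /g1; ring.
have -> : c * t ^+ 3 = c * t * t ^+ 2 by ring.
apply: (taylor2_le t0 dg dg1) => s /andP[s0 st]; rewrite normrM (ger0_norm s0) mulrC.
by rewrite ler_pM // ?bd // s0.
Qed.

Lemma derive_ge0_le f (f1 : R -> R) t : 0 <= t ->
  (forall s, is_derive s 1 f (f1 s)) -> (forall s, 0 <= s <= t -> 0 <= f1 s) -> f 0 <= f t.
Proof.
move=> t0 df f10; have [|s sab] := MVT_segment t0 (fun x _ => df x).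
  by apply: derivable_within_continuous => x _; exact: ex_derive.
by move=> e; rewrite -subr_ge0 e subr0 mulr_ge0 // f10 //; rewrite -in_itv.
Qed.

(** Tangents are taken at both ends: on a chord, one bounds the slope at departure and the other the
    slope at arrival. *)
Lemma convex_tangent_le f (f1 f2 : R -> R) t c : 0 <= t ->
  (forall s, is_derive s 1 f (f1 s)) -> (forall s, is_derive s 1 f1 (f2 s)) ->
  (forall s, 0 <= s <= t -> c <= f2 s) ->
  f 0 + t * f1 0 + c / 2 * t ^+ 2 <= f t /\ f t - t * f1 t + c / 2 * t ^+ 2 <= f 0.
Proof.
move=> t0 df ddf cf2.
have dsqr s : is_derive s 1 (fun r : R => c / 2 * r ^+ 2) (c * s).
  by apply: is_derive_eq; rewrite /GRing.scale /=; field.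
split.
  have := @derive_ge0_le (fun s => f s - s * f1 0 - c / 2 * s ^+ 2)
    (fun s => f1 s - f1 0 - c * s) t t0.
  rewrite /= mul0r expr0n mulr0 !subr0 => h.
  suff : f 0 <= f t - t * f1 0 - c / 2 * t ^+ 2 by lra.
  apply: h => s.
    have := df s; have := dsqr s => ? ?; apply: is_derive_eq.
    rewrite /GRing.scale /=; ring.
  move=> /andP[s0 st].
  have := @derive_ge0_le (fun s => f1 s - c * s) (fun s => f2 s - c) s s0.
  rewrite /= mulr0 subr0 => h1.
  suff : f1 0 <= f1 s - c * s by lra.
  apply: h1 => r; last by move=> /andP[r0 rs]; rewrite subr_ge0 cf2 // r0 (le_trans rs).
  have := ddf r => ?; apply: is_derive_eq; rewrite /GRing.scale /=; ring.
have := @derive_ge0_le (fun s => s * f1 s - f s - c / 2 * s ^+ 2)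
  (fun s => s * (f2 s - c)) t t0.
rewrite /= mul0r sub0r expr0n mulr0 subr0 => h.
suff : - f 0 <= t * f1 t - f t - c / 2 * t ^+ 2 by lra.
apply: h => s; last by move=> /andP[s0 st]; rewrite mulr_ge0 // subr_ge0 cf2 // s0.
have := df s; have := ddf s; have := dsqr s => ? ? ?; apply: is_derive_eq.
rewrite /GRing.scale /=; ring.
Qed.

Lemma gronwall_exp f (f1 : R -> R) t c : 0 <= t ->
  (forall s, is_derive s 1 f (f1 s)) -> (forall s, 0 <= s <= t -> `|f1 s| <= c * f s) ->
  f 0 * expR (- (c * t)) <= f t <= f 0 * expR (c * t).
Proof.
move=> t0 df bd.
have exp_der k s : is_derive s 1 (fun s => expR (k * s)) (k * expR (k * s)).
  have dk : is_derive s 1 (fun s => k * s) k.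
    by apply: is_derive_eq; rewrite /GRing.scale /=; ring.
  have := @is_derive1_comp R expR (fun s => k * s) s _ _ (is_derive_expR _) dk.
  by rewrite mulrC.
have key g (g1 : R -> R) := @derive_ge0_le g g1 t t0.
apply/andP; split.
  rewrite expRN ler_pdivrMr ?expR_gt0 //.
  have := key (fun s => f s * expR (c * s)) (fun s => (f1 s + c * f s) * expR (c * s)).
  rewrite /= mulr0 expR0 mulr1; apply=> s.
    have := df s; have := exp_der c s => ? ?; apply: is_derive_eq.
    rewrite /GRing.scale /=; ring.
  move=> /bd; rewrite ler_norml => /andP[h _].
  by rewrite mulr_ge0 ?expR_ge0 // -lerBlDr sub0r.
have := key (fun s => - f s * expR (- c * s)) (fun s => (c * f s - f1 s) * expR (- c * s)).
rewrite /= mulr0 expR0 mulr1 => h.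
have : - f 0 <= - f t * expR (- c * t).
  apply: h => s.
    have := df s; have := exp_der (- c) s => ? ?; apply: is_derive_eq.
    rewrite /GRing.scale /=; ring.
  move=> /bd; rewrite ler_norml => /andP[_ h].
  by rewrite mulr_ge0 ?expR_ge0 // subr_ge0.
by rewrite mulNr lerN2 mulNr expRN ler_pdivrMr ?expR_gt0.
Qed.

End OneVariable.

Lemma nearP_norm (R : realType) (W : normedModType R) (x : W) (P : W -> Prop) :
  (\forall y \near x, P y) <-> exists2 d : R, 0 < d & forall y, `|y - x| < d -> P y.
Proof.
split.
  move=> /nbhs_ballP[d d0 h]; exists d => // y yd; apply: h.
  by rewrite -ball_normE /= distrC.
move=> [d d0 h]; apply/nbhs_ballP; exists d => // y.
by rewrite -ball_normE /= distrC; exact: h.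
Qed.

Lemma short_ray (R : realType) (W : normedModType R) (u : W) (d : R) : 0 < d ->
  exists2 r : R, 0 < r & `|r *: u| < d.
Proof.
move=> d0; have k0 : 0 < `|u| + 1 by rewrite ltr_wpDl.
exists (d / 2 / (`|u| + 1)); first by rewrite !divr_gt0.
rewrite normrZ gtr0_norm ?divr_gt0 // mulrAC ltr_pdivrMr //.
apply: (@le_lt_trans _ _ (d / 2 * (`|u| + 1))); last by rewrite ltr_pM2r ?half_lt.
by rewrite ler_wpM2l ?lerDl // divr_ge0 // ltW.
Qed.

(** * Differentiability along a filter, in epsilon form *)

Section LittleoCriterion.
Variables (R : realType) (V W : normedModType R).

(** The base point of [differentiable f F] is [lim F]. Keeping [F] arbitrary serves both full
    neighbourhoods and neighbourhoods relative to the closed domain. *)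
Lemma differentiable_filterW (F : filter_on V) (f : V -> W) (df : {linear V -> W}) :
  continuous df ->
  (forall e : R, 0 < e -> \forall y \near F,
    `|f y - f (lim F) - df (y - lim F)| <= e * `|y - lim F|) ->
  differentiable f F.
Proof.
move=> cdf hdf; apply/diffP.
apply: (@getPex _ (fun (df : {linear V -> W}) => continuous df /\
  forall y, f y = f (lim F) + df (y - lim F) +o_(y \near F) (y - lim F))).
exists df; split=> //.
have : f = (fun y => f (lim F) + df (y - lim F)) +o_F (fun y => y - lim F).
  apply/eqaddoP => e e0; have := hdf e e0; apply: filterS => y /=.
  by rewrite /GRing.add /= /GRing.opp /= opprD addrA.
by rewrite funeqE.
Qed.

Lemma differentiable_filter_le (F : filter_on V) (f : V -> W) :
  differentiable f F ->
  forall e : R, 0 < e -> \forall y \near F,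
    `|f y - f (lim F) - 'd f F (y - lim F)| <= e * `|y - lim F|.
Proof.
move=> /diffE hf e e0.
have /eqaddoP/(_ e e0) : f = (fun y => f (lim F) + 'd f F (y - lim F)) +o_F (fun y => y - lim F).
  by rewrite funeqE.
by apply: filterS => y /=; rewrite /GRing.add /= /GRing.opp /= opprD addrA.
Qed.

Lemma differentiable_normW x (f : V -> W) (df : {linear V -> W}) :
  continuous df ->
  (forall e : R, 0 < e -> exists2 d : R, 0 < d & forall y, `|y - x| < d ->
    `|f y - f x - df (y - x)| <= e * `|y - x|) ->
  differentiable f x.
Proof.
move=> cdf hdf; apply: (@differentiable_filterW _ _ _ cdf) => e /hdf hd.
rewrite lim_id; last exact: norm_hausdorff.
by have /nearP_norm := hd.
Qed.

Lemma differentiable_norm_le x (f : V -> W) : differentiable f x ->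
  forall e : R, 0 < e -> exists2 d : R, 0 < d & forall y, `|y - x| < d ->
    `|f y - f x - 'd f x (y - x)| <= e * `|y - x|.
Proof.
move=> /differentiable_filter_le df e /df.
rewrite lim_id; last exact: norm_hausdorff.
by move=> h; have := nearP_norm x (fun y => `|f y - f x - 'd f x (y - x)| <= e * `|y - x|)
  => -[/(_ h)].
Qed.

End LittleoCriterion.

(** * Smooth functions: from partial derivatives to directional derivatives of any order *)

Section SmoothFunctions.
Variables (R : realType) (n : nat).
Local Notation V := 'rV[R]_n.
Implicit Types (f g : V -> R) (x y u v w h c : V).

Lemma is_derive_line f y e (u : R) : (forall x, derivable f x e) ->
  is_derive u 1 (fun s : R => f (y + s *: e)) ('D_e f (y + u *: e)).
Proof.
move=> df.
have E : (fun h : R => h^-1 *: (((fun s : R => f (y + s *: e)) \o shift u) h%:A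
      - f (y + u *: e)))
    = (fun h : R => h^-1 *: ((f \o shift (y + u *: e)) (h *: e) - f (y + u *: e))).
  apply/funext => h /=; rewrite [h%:A]mulr1; congr (_ *: (f _ - _)).
  by rewrite scalerDl addrCA.
by split; [have := df (y + u *: e); rewrite /derivable E|rewrite /derive E].
Qed.

Lemma line_increment_le f y e (c d b : R) : (forall x, derivable f x e) ->
  (forall s : R, `|s| <= `|c| -> `|'D_e f (y + s *: e) - d| <= b) ->
  `|f (y + c *: e) - f y - c * d| <= b * `|c|.
Proof.
move=> df bd.
pose g (s : R) := f (y + s *: e) - s * d.
have dg (s : R) : is_derive s 1 g ('D_e f (y + s *: e) - d).
  have := is_derive_line y s df => ?; apply: is_derive_eq.
  by rewrite scaler0 add0r [_%:A]mulr1.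
have g0 : g 0 = f y by rewrite /g scale0r addr0 mul0r subr0.
have -> : f (y + c *: e) - f y - c * d = g c - g 0 by rewrite g0 /g; ring.
have [c0|/ltW c0] := leP 0 c.
  rewrite [X in _ <= _ * X]ger0_norm // -[X in _ <= _ * X]subr0.
  apply: (mvt_le c0 dg) => s /andP[s0 sc].
  by apply: bd; rewrite !ger0_norm.
rewrite distrC [X in _ <= _ * X]ler0_norm // -[X in _ <= _ * X]sub0r.
apply: (mvt_le c0 dg) => s /andP[cs s0].
by apply: bd; rewrite !ler0_norm // lerN2.
Qed.

(** Corners of the staircase from 0 to [h] that changes one coordinate at a time. *)
Definition row_trunc (k : nat) (h : V) : V :=
  \row_j (if (j < k)%N then h 0 j else 0).

Lemma row_trunc0 h : row_trunc 0 h = 0.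
Proof. by apply/rowP => j; rewrite !mxE. Qed.

Lemma row_truncn h : row_trunc n h = h.
Proof. by apply/rowP => j; rewrite !mxE ltn_ord. Qed.

Lemma row_truncS (k : 'I_n) h :
  row_trunc k.+1 h = row_trunc k h + h 0 k *: delta_mx 0 k.
Proof.
apply/rowP => j; rewrite !mxE eqxx /= ltnS leq_eqVlt.
have -> : (j == k :> nat) = (j == k) by [].
case: eqVneq => [->|jk] /=; first by rewrite ltnn add0r mulr1.
by rewrite mulr0 addr0.
Qed.

Lemma entry_le_norm (h : V) j : `|h 0 j| <= `|h|.
Proof.
rewrite /Num.norm /= mx_normrE; apply: le_trans (le_bigmax _ _ (0, j)).
by [].
Qed.

Lemma norm_le_entries (h : V) (b : R) : 0 <= b -> (forall j, `|h 0 j| <= b) -> `|h| <= b.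
Proof.
move=> b0 hb; rewrite /Num.norm /= mx_normrE; apply/bigmax_leP; split => //= -[i j] _ /=.
by rewrite ord1.
Qed.

Lemma row_trunc_line_le (k : 'I_n) h (s : R) : `|s| <= `|h 0 k| ->
  `|row_trunc k h + s *: delta_mx 0 k| <= `|h|.
Proof.
move=> sh; apply: norm_le_entries => // j; rewrite !mxE eqxx /=.
have [->|jk] := eqVneq j k.
  by rewrite ltnn add0r mulr1 (le_trans sh) // entry_le_norm.
by rewrite mulr0 addr0; case: ifP => _; rewrite ?normr0 // entry_le_norm.
Qed.

Definition rowform (c h : V) : R := \sum_i h 0 i * c 0 i.

Lemma rowform_is_linear c : linear (rowform c).
Proof.
move=> a u w; rewrite /rowform scaler_sumr -big_split; apply: eq_bigr => i _ /=.
by rewrite !mxE mulrDl -[a *: _]/(a * _) mulrA.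
Qed.

HB.instance Definition _ c :=
  GRing.isLinear.Build R V R _ (rowform c) (@rowform_is_linear c).

Lemma rowform_le c h : `|rowform c h| <= n%:R * `|c| * `|h|.
Proof.
apply: le_trans (ler_norm_sum _ _ _) _.
have -> : n%:R * `|c| * `|h| = \sum_(i < n) `|h| * `|c|.
  by rewrite sumr_const card_ord -mulr_natl; ring.
by apply: ler_sum => i _; rewrite normrM ler_pM // entry_le_norm.
Qed.

Lemma linear_le_continuous (W : normedModType R) (L : {linear V -> W}) (k : R) :
  (forall h : V, `|L h| <= k * `|h|) -> continuous L.
Proof.
move=> Lk; apply/linear_bounded_continuous/linear_boundedP; near=> r => x.
apply: le_trans (Lk x) _; rewrite ler_wpM2r //.
Unshelve. all: by end_near. Qed.

Lemma rowform_continuous c : continuous (rowform c).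
Proof.
exact: (@linear_le_continuous _ (rowform c) (n%:R * `|c|) (rowform_le c)).
Qed.

(** The increment is telescoped along the staircase of [row_trunc]. Each edge is parallel to an
    axis, so the mean value theorem and the continuity of one partial derivative bound its error by
    [e' * |h|]. *)
Lemma differentiable_partials f :
  (forall i x, derivable f x (delta_mx 0 i)) -> (forall i, continuous (partial i f)) ->
  forall x, differentiable f x.
Proof.
move=> df cf x.
apply: (@differentiable_normW _ _ _ _ _ (rowform (\row_i partial i f x))).
  exact: rowform_continuous.
move=> e e0.
(* The denominator is [n.+1] so as to stay positive for [n = 0]. *)
pose e' : R := e / n.+1%:R.
have e'0 : 0 < e' by rewrite divr_gt0.
have : \forall y \near x, forall i : 'I_n, `|partial i f y - partial i f x| <= e'.
  apply: (@filter_forall V 'I_n (fun i y => `|partial i f y - partial i f x| <= e') (nbhs x)) => i.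
  by have /cvgr_dist_le /(_ _ e'0) := cf i x; under eq_near do rewrite distrC.
move=> /nearP_norm[d d0 hd]; exists d => // y.
set h := y - x => hltd.
have telescope (m : nat) : (m <= n)%N ->
  `|f (x + row_trunc m h) - f x
     - \sum_(i < n | (i < m)%N) h 0 i * partial i f x| <= e' * `|h| *+ m.
  elim: m => [|m IH] mn.
    by rewrite row_trunc0 addr0 subrr big_pred0 // subr0 normr0 mulr0n.
  pose k := Ordinal mn.
  rewrite (bigD1 k) //= (eq_bigl (fun i : 'I_n => (i < m)%N)); last first.
    by move=> i; rewrite ltnS -(inj_eq val_inj) /= ltn_neqAle andbC.
  rewrite (@row_truncS k) addrA.
  set A := f (_ + h 0 k *: _); set B := \sum_(i < n | _) _.
  have -> : A - f x - (h 0 k * partial k f x + B) =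
    (A - f (x + row_trunc m h) - h 0 k * partial k f x)
      + (f (x + row_trunc m h) - f x - B) by ring.
  rewrite mulrS (le_trans (ler_normD _ _)) // lerD //; last by rewrite IH // ltnW.
  apply: (@le_trans _ _ (e' * `|h 0 k|)).
    apply: line_increment_le => // s sh; apply: hd => /=.
    rewrite -!addrA addrC -!addrA addNr addr0.
    exact: le_lt_trans (row_trunc_line_le sh) hltd.
  by rewrite ler_wpM2l ?entry_le_norm // ltW.
have := telescope n (leqnn n); rewrite row_truncn subrKC.
rewrite (eq_bigr (fun i => h 0 i * (\row_i partial i f x) 0 i)); last first.
  by move=> i _; rewrite mxE.
rewrite (eq_bigl xpredT) => [/le_trans|i]; last by rewrite ltn_ord.
apply; rewrite -mulr_natl mulrA ler_wpM2r // /e' mulrA ler_pdivrMr // mulrC.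
by rewrite ler_wpM2l ?ler_nat // ltW.
Qed.

End SmoothFunctions.

Section SmoothCalculus.
Variables (R : realType) (n : nat).
Local Notation V := 'rV[R]_n.
Implicit Types (f g : V -> R) (x y u v w h c : V).

Lemma smooth_differentiable f x : smooth f -> differentiable f x.
Proof.
move=> sf; apply: differentiable_partials => i.
  by have [_ h] := sf [::]; exact: h.
by have [h _] := sf [:: i].
Qed.

Lemma smooth_continuous f : smooth f -> continuous f.
Proof. by move=> /(_ [::])[]. Qed.

Lemma smooth_derivable f x u : smooth f -> derivable f x u.
Proof. by move=> sf; exact/diff_derivable/smooth_differentiable. Qed.

Lemma iter_partial_rcons (s : seq 'I_n) i f :
  iter_partial (rcons s i) f = iter_partial s (partial i f).
Proof. by rewrite /iter_partial foldr_rcons. Qed.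

Lemma derive_partialE f x u : differentiable f x ->
  'D_u f x = \sum_i u 0 i * partial i f x.
Proof.
move=> df; rewrite deriveE // [in LHS](row_sum_delta u) linear_sum.
by apply: eq_bigr => i _; rewrite linearZ /partial deriveE.
Qed.

Lemma iter_partial_sum (s : seq 'I_n) (a : 'I_n -> R) (F : 'I_n -> V -> R) :
  (forall i, smooth (F i)) ->
  iter_partial s (fun x => \sum_i a i * F i x)
    = (fun x => \sum_i a i * iter_partial s (F i) x).
Proof.
move=> sF; elim: s => [//|j s IH] /=.
rewrite IH; apply/funext => x; rewrite /partial.
have dF i : derivable (fun x => a i * iter_partial s (F i) x) x (delta_mx 0 j).
  by apply: derivableZ; have [_ h] := sF i s; exact: h.
have -> : (fun x => \sum_i a i * iter_partial s (F i) x) =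
   \sum_i (fun x => a i * iter_partial s (F i) x).
  by apply/funext => y; rewrite fct_sumE.
rewrite derive_sum //; apply: eq_bigr => i _.
by rewrite deriveZ //; have [_ h] := sF i s; exact: h.
Qed.

Lemma smooth_derive f u : smooth f -> smooth ('D_u f).
Proof.
move=> sf.
have -> : 'D_u f = (fun x => \sum_i u 0 i * partial i f x).
  by apply/funext => x; rewrite derive_partialE //; exact: smooth_differentiable.
have sp i : smooth (partial i f).
  by move=> s; rewrite -iter_partial_rcons; exact: sf.
move=> s; rewrite iter_partial_sum //.
split=> [|i x].
  apply: (@continuous_big R _ +%R 0 xpredT add_continuous) => i _ x.
  apply: continuousM; first exact: cst_continuous.
  by have [h _] := sp i s; exact: h.
have -> : (fun x => \sum_i u 0 i * iter_partial s (partial i f) x) =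
   \sum_i (fun x => u 0 i * iter_partial s (partial i f) x).
  by apply/funext => y; rewrite fct_sumE.
apply: derivable_sum => j; apply: derivableZ.
by have [_ h] := sp j s; exact: h.
Qed.

Lemma deriveDr f x u w : differentiable f x -> 'D_(u + w) f x = 'D_u f x + 'D_w f x.
Proof. by move=> df; rewrite !deriveE // linearD. Qed.

Lemma deriveZr f x (a : R) u : differentiable f x -> 'D_(a *: u) f x = a * 'D_u f x.
Proof. by move=> df; rewrite !deriveE // linearZ. Qed.

Lemma smooth_line f p u (s : R) : smooth f ->
  is_derive s 1 (fun s => f (p + s *: u)) ('D_u f (p + s *: u)).
Proof. by move=> sf; apply: is_derive_line => x; exact: smooth_derivable. Qed.

(** The mean value theorem is applied once in each direction. The left side is symmetric in [u] and
    [w], apart from [d], which is what yields the symmetry of second derivatives. *)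
Lemma second_difference_le f x u w (h d b : R) : smooth f -> 0 <= h ->
  (forall a c : R, 0 <= a <= h -> 0 <= c <= h ->
    `|'D_w ('D_u f) (x + a *: u + c *: w) - d| <= b) ->
  `|f (x + h *: u + h *: w) - f (x + h *: u) - f (x + h *: w) + f x - h * h * d|
    <= b * h * h.
Proof.
move=> sf h0 bd.
pose F (a : R) := f (x + a *: u + h *: w) - f (x + a *: u) - a * (h * d).
have dF (a : R) : is_derive a 1 F
   ('D_u f (x + a *: u + h *: w) - 'D_u f (x + a *: u) - h * d).
  have d1 := smooth_line (x + h *: w) u a sf.
  have d2 := smooth_line x u a sf.
  have -> : F = (fun a : R => f (x + h *: w + a *: u) - f (x + a *: u) - a * (h * d)).
    by apply/funext => a'; rewrite /F [x + a' *: u + _]addrAC.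
  apply: is_derive_eq; rewrite scaler0 add0r [_%:A]mulr1.
  by rewrite [x + h *: w + _]addrAC.
have -> : f (x + h *: u + h *: w) - f (x + h *: u) - f (x + h *: w) + f x - h * h * d
   = F h - F 0.
  by rewrite /F scale0r addr0; ring.
rewrite -[X in _ <= _ * X]subr0; apply: (mvt_le h0 dF) => a ah.
pose G (c : R) := 'D_u f (x + a *: u + c *: w) - c * d.
have dG (c : R) : is_derive c 1 G ('D_w ('D_u f) (x + a *: u + c *: w) - d).
  have d1 := smooth_line (x + a *: u) w c (smooth_derive u sf).
  by apply: is_derive_eq; rewrite scaler0 add0r [_%:A]mulr1.
have -> : 'D_u f (x + a *: u + h *: w) - 'D_u f (x + a *: u) - h * d = G h - G 0.
  by rewrite /G scale0r addr0 mul0r subr0; ring.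
by rewrite -[X in _ <= _ * X]subr0; apply: (mvt_le h0 dG) => c ch; exact: bd.
Qed.

(** For small [h], both mixed derivatives are within [e / 2] of the same second difference divided
    by [h ^+ 2]. *)
Lemma deriveC f x u w : smooth f -> 'D_u ('D_w f) x = 'D_w ('D_u f) x.
Proof.
move=> sf.
apply/eqP; rewrite -subr_eq0 -normr_le0; apply/ler_addgt0Pl => e e0; rewrite addr0.
have near_const g : smooth g -> exists2 d : R, 0 < d &
    forall y, `|y - x| < d -> `|g y - g x| <= e / 2.
  move=> sg; apply/nearP_norm.
  have /cvgr_dist_le /(_ _ (divr_gt0 e0 (ltr0n R 2))) := @smooth_continuous _ sg x.
  by under eq_near do rewrite distrC.
have [d1 d10 h1] := near_const _ (smooth_derive w (smooth_derive u sf)).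
have [d2 d20 h2] := near_const _ (smooth_derive u (smooth_derive w sf)).
pose h := Num.min d1 d2 / (`|u| + `|w| + 1) / 2.
have k0 : 0 < `|u| + `|w| + 1 by rewrite ltr_wpDl ?addr_ge0.
have h0 : 0 < h by rewrite !divr_gt0 // lt_min d10 d20.
have close (a c : R) u' w' : `|u'| + `|w'| = `|u| + `|w| -> 0 <= a <= h -> 0 <= c <= h ->
    `|x + a *: u' + c *: w' - x| < d1 /\ `|x + a *: u' + c *: w' - x| < d2.
  move=> uw /andP[a0 ah] /andP[c0 ch]; rewrite -!addrA addrC -!addrA addNr addr0.
  apply/andP; rewrite -lt_min; apply: (@le_lt_trans _ _ (h * (`|u| + `|w| + 1))).
    rewrite (le_trans (ler_normD _ _)) // !normrZ !ger0_norm //.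
    rewrite (@le_trans _ _ (h * (`|u'| + `|w'|))) //.
      by rewrite mulrDr; apply: lerD; apply: ler_wpM2r.
    by rewrite uw ler_wpM2l ?lerDl // ltW.
  rewrite /h mulrAC divfK ?gt_eqF // ltr_pdivrMr // ltr_pMr ?lt_min ?d10 ?d20 //.
  by rewrite ltr1n.
have A1 := @second_difference_le f x u w h _ (e / 2) sf (ltW h0)
  (fun (a c : R) ha hc => h1 _ (close a c u w erefl ha hc).1).
have A2 := @second_difference_le f x w u h _ (e / 2) sf (ltW h0)
  (fun (a c : R) ha hc => h2 _ (close a c w u (addrC _ _) ha hc).2).
rewrite [x + h *: w + _]addrAC in A2.
move: A1 A2; move: (f _) (f _) (f _) (f _) => T S Q P A1 A2.
set X := 'D_u _ x in A2 *; set Y := 'D_w _ x in A1 *; clearbody X Y h.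
have : `|h * h * (X - Y)| <= e * (h * h).
  have -> : h * h * (X - Y) =
    (P - Q - S + T - h * h * Y) - (P - S - Q + T - h * h * X) by ring.
  rewrite (le_trans (ler_normB _ _)) // (le_trans (lerD A1 A2)) //.
  by apply: ler_eq; field.
rewrite normrM ger0_norm ?mulr_ge0 ?(ltW h0) // mulrC ler_pM2r //.
exact: mulr_gt0.
Qed.

Definition partials_le (K : set V) (k : nat) f (M : R) :=
  forall s : seq 'I_n, (size s <= k)%N -> forall x, K x -> `|iter_partial s f x| <= M.

Lemma partials_le_derive K k f M u : smooth f -> partials_le K k.+1 f M ->
  partials_le K k ('D_u f) (n%:R * `|u| * M).
Proof.
move=> sf bf s sk x Kx.
have -> : 'D_u f = (fun x => \sum_i u 0 i * partial i f x).
  by apply/funext => y; rewrite derive_partialE //; exact: smooth_differentiable.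
rewrite iter_partial_sum; last first.
  by move=> i s'; rewrite -iter_partial_rcons; exact: sf.
apply: le_trans (ler_norm_sum _ _ _) _.
have -> : n%:R * `|u| * M = \sum_(i < n) `|u| * M.
  by rewrite sumr_const card_ord -[RHS]mulr_natl mulrA.
apply: ler_sum => i _; rewrite normrM ler_pM // ?entry_le_norm //.
by rewrite -iter_partial_rcons bf // size_rcons ltnS.
Qed.

Lemma partials_le_fun K k f M x : partials_le K k f M -> K x -> `|f x| <= M.
Proof. by move=> /(_ [::]) h; exact: h. Qed.

Lemma partials_bounded (K : set V) k f : smooth f -> compact K ->
  exists2 M : R, 0 < M & partials_le K k f M.
Proof.
move=> sf cK; elim: k f sf => [|k IH] f sf; last first.
  have sp i : smooth (partial i f).
    by move=> s; rewrite -iter_partial_rcons; exact: sf.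
  have [M0 M00 hM0] : exists2 M : R, 0 < M & forall x, K x -> `|f x| <= M.
    by have [M M0 hM] := IH f sf; exists M => // x Kx; exact: (hM [::]).
  have [M hM H] := fin_all_exists2 (fun i => IH _ (sp i)).
  exists (M0 + \sum_i M i).
    by rewrite ltr_wpDr // sumr_ge0 // => i _; exact: ltW.
  case/lastP => [|s i] sk x Kx.
    by rewrite (le_trans (hM0 x Kx)) // lerDl sumr_ge0 // => i _; exact: ltW.
  rewrite iter_partial_rcons (le_trans (H i s _ x Kx)) //.
    by rewrite size_rcons in sk.
  rewrite (bigD1 i) //= addrCA lerDl addr_ge0 ?(ltW M00) // sumr_ge0 // => j _.
  exact: ltW.
have [->|K0] := eqVneq K set0; first by exists 1 => // s _ x [].
have := EVT_max_rV (_ : K !=set0) cK (_ : {within K, continuous (fun x => `|f x|)}).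
case => [||c _ hc]; first exact/set0P.
  apply: continuous_subspaceT => x; apply: continuous_comp; last exact: norm_continuous.
  exact: (@smooth_continuous f sf x).
exists (`|f c| + 1); first by rewrite ltr_wpDl.
move=> [|//] _ x Kx /=; rewrite (le_trans (hc x _)) ?lerDl //; exact: mem_set.
Qed.

End SmoothCalculus.

(* [dd] and [gradv] are opaque copies of ['D_u f x] and [grad f x]: comparing two
   transparent derivatives makes conversion unfold the limits defining them. *)
HB.lock Definition dd (R : realType) n (u : 'rV[R]_n) (f : 'rV[R]_n -> R) (x : 'rV[R]_n) : R :=
  'D_u f x.
HB.lock Definition gradv (R : realType) n (f : 'rV[R]_n -> R) (x : 'rV[R]_n) : 'rV[R]_n :=
  grad f x.

Section LockedDerivatives.
Variables (R : realType) (n : nat).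
Local Notation V := 'rV[R]_n.
Implicit Types (f g : V -> R) (x y u v w h c : V).

Lemma ddE u f : dd u f = 'D_u f.
Proof. by apply/funext => x; rewrite dd.unlock. Qed.

Lemma gradvE f x j : gradv f x 0 j = dd (delta_mx 0 j) f x.
Proof. by rewrite gradv.unlock mxE dd.unlock. Qed.

Lemma smooth_dd f u : smooth f -> smooth (dd u f).
Proof. by rewrite ddE; exact: smooth_derive. Qed.

Lemma ddC f u w : smooth f -> dd u (dd w f) = dd w (dd u f).
Proof. by move=> sf; apply/funext => x; rewrite !ddE deriveC. Qed.

Lemma dd_linear f (a : R) u w x : smooth f ->
  dd (a *: u + w) f x = a * dd u f x + dd w f x.
Proof.
move=> sf; have df := smooth_differentiable x sf.
by rewrite !ddE deriveDr // deriveZr.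
Qed.

Lemma ddZ f (a : R) u x : smooth f -> dd (a *: u) f x = a * dd u f x.
Proof. by move=> sf; rewrite !ddE deriveZr //; exact: smooth_differentiable. Qed.

Lemma ddN f u x : smooth f -> dd (- u) f x = - dd u f x.
Proof. by move=> sf; rewrite -scaleN1r ddZ // mulN1r. Qed.

Lemma ddD f u w x : smooth f -> dd (u + w) f x = dd u f x + dd w f x.
Proof. by move=> sf; rewrite !ddE deriveDr //; exact: smooth_differentiable. Qed.

Lemma ddB f u w x : smooth f -> dd (u - w) f x = dd u f x - dd w f x.
Proof. by move=> sf; rewrite ddD // ddN. Qed.

Lemma dd_comb f g (a : R) u : smooth f -> smooth g ->
  dd u (fun x => a * f x + g x) = (fun x => a * dd u f x + dd u g x).
Proof.
move=> sf sg; apply/funext => x; rewrite !ddE.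
have df := @smooth_derivable _ _ f x u sf; have dg := @smooth_derivable _ _ g x u sg.
have -> : (fun y => a * f y + g y) = a *: f + g by [].
by rewrite (deriveD (@derivableZ _ _ _ f a x _ df) dg) (@deriveZ _ _ _ f a x _ df).
Qed.

(** [gradv (dd u f) x] is the Hessian of [f] at [x] applied to [u]; it appears in this form
    throughout. *)
Lemma gradv_hess_linear f (a : R) u w x : smooth f ->
  gradv (dd (a *: u + w) f) x = a *: gradv (dd u f) x + gradv (dd w f) x.
Proof.
move=> sf; apply/rowP => j; rewrite gradvE [RHS]mxE [X in _ = X + _]mxE !gradvE.
have -> : dd (a *: u + w) f = (fun x => a * dd u f x + dd w f x).
  by apply/funext => y; exact: dd_linear.
by rewrite dd_comb //; exact: smooth_dd.
Qed.

Lemma dd_gradv f u x : smooth f -> dd u f x = dot u (gradv f x).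
Proof.
move=> sf; rewrite ddE derive_partialE; last exact: smooth_differentiable.
by apply: eq_bigr => i _; rewrite gradvE ddE.
Qed.

Lemma dd_hess f u w x : smooth f -> dd u (dd w f) x = dot u (gradv (dd w f) x).
Proof. by move=> sf; rewrite dd_gradv //; exact: smooth_dd. Qed.

Lemma is_derive_dd f p u (s : R) : smooth f ->
  is_derive s 1 (fun s => f (p + s *: u)) (dd u f (p + s *: u)).
Proof. by move=> sf; rewrite ddE; exact: smooth_line. Qed.

Lemma partials_le_dd (K : set V) k f (M : R) u : smooth f -> partials_le K k.+1 f M ->
  partials_le K k (dd u f) (n%:R * `|u| * M).
Proof. by rewrite ddE; exact: partials_le_derive. Qed.

End LockedDerivatives.

(** * Variation of one bounce *)

Section BigO.
Variables (R : realType) (I : Type).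

(** [f = O(g)] with one constant for the whole index type. The index will be the type of all
    admissible flights, so that the constants depend only on the parameters of the domain. *)
Definition dominated (W : normedModType R) (f : I -> W) (g : I -> R) :=
  exists2 C : R, 0 <= C & forall i, `|f i| <= C * g i.

Lemma dominated_eq (W : normedModType R) (f f1 : I -> W) g :
  dominated f g -> (forall i, f1 i = f i) -> dominated f1 g.
Proof. by move=> [C C0 h] e; exists C => // i; rewrite e. Qed.

Lemma dominated_eqr (W : normedModType R) (f : I -> W) g g1 :
  dominated f g -> (forall i, g1 i = g i) -> dominated f g1.
Proof. by move=> [C C0 h] e; exists C => // i; rewrite e. Qed.

Lemma dominated_mulr1 (W : normedModType R) (f : I -> W) g :
  dominated f (fun i => g i * 1) -> dominated f g.
Proof. by move=> [C C0 h]; exists C => // i; rewrite -[g i]mulr1. Qed.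

Lemma dominated_trans (W : normedModType R) (f : I -> W) (g h : I -> R) :
  dominated f g -> dominated g h -> dominated f h.
Proof.
move=> [C C0 hC] [D D0 hD]; exists (C * D); first exact: mulr_ge0.
move=> i; apply: le_trans (hC i) _; rewrite -mulrA ler_wpM2l //.
by apply: le_trans (hD i); exact: ler_norm.
Qed.

Lemma dominatedD (W : normedModType R) (f1 f2 : I -> W) g :
  dominated f1 g -> dominated f2 g -> dominated (fun i => f1 i + f2 i) g.
Proof.
move=> [C C0 hC] [D D0 hD]; exists (C + D); first exact: addr_ge0.
by move=> i; rewrite mulrDl (le_trans (ler_normD _ _)) // lerD.
Qed.

Lemma dominatedN (W : normedModType R) (f : I -> W) g :
  dominated f g -> dominated (fun i => - f i) g.
Proof. by move=> [C C0 hC]; exists C => // i; rewrite normrN. Qed.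

Lemma dominatedB (W : normedModType R) (f1 f2 : I -> W) g :
  dominated f1 g -> dominated f2 g -> dominated (fun i => f1 i - f2 i) g.
Proof. by move=> h1 h2; apply: dominatedD => //; exact: dominatedN. Qed.

Lemma dominatedZ (W : normedModType R) (f : I -> R) (h : I -> W) g1 g2 :
  dominated f g1 -> dominated h g2 -> dominated (fun i => f i *: h i) (fun i => g1 i * g2 i).
Proof.
move=> [C C0 hC] [D D0 hD]; exists (C * D); first exact: mulr_ge0.
by move=> i; rewrite normrZ mulrACA ler_pM.
Qed.

Lemma dominatedM (f h : I -> R) g1 g2 :
  dominated f g1 -> dominated h g2 -> dominated (fun i => f i * h i) (fun i => g1 i * g2 i).
Proof. exact: dominatedZ. Qed.

Lemma dominated_refl (f : I -> R) : (forall i, 0 <= f i) -> dominated f f.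
Proof. by move=> f0; exists 1 => // i; rewrite mul1r ger0_norm. Qed.

Lemma dominated_le (W : normedModType R) (f : I -> W) (g : I -> R) (C : R) : 0 <= C ->
  (forall i, `|f i| <= C * g i) -> dominated f g.
Proof. by move=> C0 h; exists C. Qed.

Lemma dominated_le1 (W : normedModType R) (f : I -> W) (g : I -> R) :
  (forall i, `|f i| <= g i) -> dominated f g.
Proof. by move=> h; exists 1 => // i; rewrite mul1r. Qed.

Lemma dominated_norm (W : normedModType R) (f : I -> W) (g : I -> R) :
  dominated f g -> dominated (fun i => `|f i|) g.
Proof. by move=> [C C0 h]; exists C => // i; rewrite normr_id. Qed.

Lemma dominated_div (f h : I -> R) (g : I -> R) (c : R) : 0 < c ->
  (forall i, 0 < h i) -> (forall i, c * h i <= `|f i|) ->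
  forall k : I -> R, dominated (fun i => f i * k i) (fun i => h i * g i) -> dominated k g.
Proof.
move=> c0 h0 hf k [C C0 hC]; exists (C / c); first by rewrite divr_ge0 // ltW.
move=> i; rewrite mulrAC ler_pdivlMr // -(ler_pM2l (h0 i)).
rewrite (le_trans (y := `|f i * k i|)) //; last by rewrite (le_trans (hC i)) // mulrCA.
by rewrite mulrCA mulrC normrM ler_wpM2r // mulrC.
Qed.

Lemma dominated_absorbl (W : normedModType R) (f : I -> W) (g h : I -> R) :
  dominated f (fun i => h i * g i) -> (forall i, 0 <= g i) -> dominated h (fun=> 1) ->
  dominated f g.
Proof.
move=> fhg g0 h1; apply: dominated_trans fhg _.
by apply: dominated_eqr (dominatedM h1 (dominated_refl g0)) _ => i; rewrite mul1r.
Qed.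

End BigO.

(** * Exterior products, and recovering a vector from its products with another *)

Section Wedge.
Variables (R : realType) (n : nat).
Local Notation V := 'rV[R]_n.
Implicit Types (x y z w : V).

(** The exterior product as an antisymmetric matrix; it plays the role of the cross product, in any
    dimension. *)
Definition wedge x y : 'M[R]_n := \matrix_(j, k) (x 0 j * y 0 k - x 0 k * y 0 j).

Lemma mx_norm_le (A : 'M[R]_n) (b : R) : 0 <= b -> (forall j k, `|A j k| <= b) -> `|A| <= b.
Proof.
move=> b0 hb; rewrite /Num.norm /= mx_normrE; apply/bigmax_leP; split => //= -[j k] _ /=.
Qed.

Lemma mx_entry_le (A : 'M[R]_n) j k : `|A j k| <= `|A|.
Proof.
rewrite /Num.norm /= mx_normrE; apply: le_trans (le_bigmax _ _ (j, k)).
by [].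
Qed.

Lemma wedge_le x y : `|wedge x y| <= 2 * (`|x| * `|y|).
Proof.
apply: mx_norm_le => [|j k]; first by rewrite !mulr_ge0.
rewrite mxE (le_trans (ler_normB _ _)) // mulr_natl mulr2n !normrM.
by rewrite lerD // ler_pM // entry_le_norm.
Qed.

Lemma wedge_linl (a : R) x y z : wedge (a *: x + y) z = a *: wedge x z + wedge y z.
Proof. by apply/matrixP => j k; rewrite !mxE; ring. Qed.

Lemma wedge_linr (a : R) x y z : wedge z (a *: x + y) = a *: wedge z x + wedge z y.
Proof. by apply/matrixP => j k; rewrite !mxE; ring. Qed.

Lemma wedgexx x : wedge x x = 0.
Proof. by apply/matrixP => j k; rewrite !mxE; ring. Qed.

Lemma dotDl x y z : dot (x + y) z = dot x z + dot y z.
Proof. by rewrite /dot -big_split; apply: eq_bigr => i _; rewrite mxE mulrDl. Qed.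

Lemma dotZl (a : R) x y : dot (a *: x) y = a * dot x y.
Proof. by rewrite /dot mulr_sumr; apply: eq_bigr => i _; rewrite mxE mulrA. Qed.

Lemma dotC x y : dot x y = dot y x.
Proof. by apply: eq_bigr => i _; rewrite mulrC. Qed.

Lemma dotDr x y z : dot z (x + y) = dot z x + dot z y.
Proof. by rewrite !(dotC z) dotDl. Qed.

Lemma dotZr (a : R) x y : dot y (a *: x) = a * dot y x.
Proof. by rewrite !(dotC y) dotZl. Qed.

Lemma dotBr x y z : dot z (x - y) = dot z x - dot z y.
Proof. by rewrite dotDr -scaleN1r dotZr mulN1r. Qed.

(** Expand [x_j y_k y_k] as [x_k y_k y_j + (x_j y_k - x_k y_j) y_k] and sum over [k]. *)
Lemma dot_wedge x y j :
  dot y y * x 0 j = dot x y * y 0 j + \sum_k wedge x y j k * y 0 k.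
Proof.
rewrite /dot !mulr_suml -big_split; apply: eq_bigr => k _ /=.
rewrite mxE; ring.
Qed.

Lemma dot_wedge_le x y : dot y y * `|x| <= `|y| * (`|dot x y| + n%:R * `|wedge x y|).
Proof.
have y0 : 0 <= dot y y by apply: sumr_ge0 => i _; rewrite -expr2 sqr_ge0.
have -> : dot y y * `|x| = `|dot y y *: x| by rewrite normrZ ger0_norm.
apply: norm_le_entries.
  by rewrite mulr_ge0 // addr_ge0 // mulr_ge0.
move=> j; rewrite mxE dot_wedge (le_trans (ler_normD _ _)) // mulrDr lerD //.
  by rewrite normrM mulrC ler_wpM2r // entry_le_norm.
rewrite (le_trans (ler_norm_sum _ _ _)) //.
have -> : `|y| * (n%:R * `|wedge x y|) = \sum_(k < n) `|wedge x y| * `|y|.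
  by rewrite sumr_const card_ord -[RHS]mulr_natl; ring.
apply: ler_sum => k _; rewrite normrM ler_pM // ?mx_entry_le ?entry_le_norm //.
Qed.

End Wedge.

Section DominatedForms.
Variables (R : realType) (n : nat) (I : Type).
Local Notation V := 'rV[R]_n.
Implicit Types (f h : I -> V) (g : I -> R).

Lemma dominated_wedge f h g1 g2 : dominated f g1 -> dominated h g2 ->
  dominated (fun i => wedge (f i) (h i)) (fun i => g1 i * g2 i).
Proof.
move=> [C C0 hC] [D D0 hD]; exists (2 * (C * D)); first by rewrite !mulr_ge0.
move=> i; rewrite (le_trans (wedge_le _ _)) // -mulrA ler_wpM2l // mulrACA.
by rewrite ler_pM.
Qed.

Lemma dot_le (x y : V) : `|dot x y| <= n%:R * (`|x| * `|y|).
Proof.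
rewrite (le_trans (ler_norm_sum _ _ _)) //.
have -> : n%:R * (`|x| * `|y|) = \sum_(k < n) `|x| * `|y|.
  by rewrite sumr_const card_ord -[RHS]mulr_natl.
by apply: ler_sum => k _; rewrite normrM ler_pM // entry_le_norm.
Qed.

Lemma dominated_dot f h g1 g2 : dominated f g1 -> dominated h g2 ->
  dominated (fun i => dot (f i) (h i)) (fun i => g1 i * g2 i).
Proof.
move=> [C C0 hC] [D D0 hD]; exists (n%:R * (C * D)); first by rewrite !mulr_ge0.
move=> i; rewrite (le_trans (dot_le _ _)) // -mulrA ler_wpM2l // mulrACA.
by rewrite ler_pM.
Qed.

(** By [dot_wedge], a vector is controlled by its scalar and exterior products with a field [h]
    bounded above and away from 0. In the applications [h] is the gradient of [xi] at boundary
    points. *)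
Lemma dominated_row f h g (c : R) : 0 < c -> (forall i, c <= dot (h i) (h i)) ->
  dominated h (fun=> 1) -> dominated (fun i => dot (f i) (h i)) g ->
  dominated (fun i => wedge (f i) (h i)) g -> dominated f g.
Proof.
move=> c0 hc [C C0 hC] [D D0 hD] [F F0 hF].
exists (C * (D + n%:R * F) / c).
  by rewrite divr_ge0 ?mulr_ge0 ?addr_ge0 ?mulr_ge0 // ltW.
move=> i; rewrite mulrAC ler_pdivlMr // mulrC.
apply: (@le_trans _ _ (dot (h i) (h i) * `|f i|)); first by rewrite ler_wpM2r.
rewrite (le_trans (dot_wedge_le _ _)) // -mulrA ler_pM //.
- by rewrite -[leRHS]mulr1.
- by rewrite mulrDl lerD // -mulrA ler_wpM2l.
Qed.

End DominatedForms.

Section AffineDerivative.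
Variable R : realType.

Lemma is_derive_ext (f g : R -> R) (s df dg : R) :
  is_derive s 1 f df -> (forall r, g r = f r) -> dg = df -> is_derive s 1 g dg.
Proof. by move=> h /funext -> ->. Qed.

Lemma is_derive_affine (a b c : R) (P Q W : R -> R) (s dP dQ dW : R) :
  is_derive s 1 P dP -> is_derive s 1 Q dQ -> is_derive s 1 W dW ->
  is_derive s 1 (fun r => a * P r + b * Q r + c * (r * W r))
    (a * dP + b * dQ + c * (W s + s * dW)).
Proof.
move=> hP hQ hW; apply: is_derive_eq; rewrite /GRing.scale /=; ring.
Qed.

End AffineDerivative.

(** Order four comes from the trapezoidal estimate of the varied function, which takes three
    derivatives along the chord after the one in the direction [dp] or [dv]. *)
Record derivative_bounds (R : realType) n (f : 'rV[R]_n -> R) (K : set 'rV[R]_n) (M : R) : Prop :=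
  DerivativeBounds {
  db_ge0 : 0 <= M;
  db_1 : forall x u, K x -> `|dd u f x| <= M * `|u|;
  db_2 : forall x u w, K x -> `|dd w (dd u f) x| <= M * (`|w| * `|u|);
  db_3 : forall x u w z, K x -> `|dd z (dd w (dd u f)) x| <= M * (`|z| * (`|w| * `|u|));
  db_4 : forall x u w z y, K x ->
    `|dd y (dd z (dd w (dd u f))) x| <= M * (`|y| * (`|z| * (`|w| * `|u|)))
}.

(** * Expansions of [xi] and of its variation along one chord *)

Section OneChord.
Variables (R : realType) (n : nat).
Local Notation V := 'rV[R]_n.
Variables (xi : V -> R) (K : set V) (M : R).
Hypothesis smooth_xi : smooth xi.
Hypothesis db : derivative_bounds xi K M.
Let M0 : 0 <= M := db_ge0 db.
Variables (p v : V) (t : R).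
Hypothesis t0 : 0 <= t.
Hypothesis tM : t <= M.
Hypothesis v1 : `|v| <= 1.
Hypothesis chordK : forall s : R, 0 <= s <= t -> K (p - s *: v).

Lemma is_derive_chord (g : V -> R) (s : R) : smooth g ->
  is_derive s 1 (fun s : R => g (p - s *: v)) (- dd v g (p - s *: v)).
Proof.
move=> sg; have := is_derive_dd p (- v) s sg.
rewrite ddN // scalerN; congr (is_derive _ _ _ _).
by apply/funext => r; rewrite scalerN.
Qed.

Lemma chord0K : K p. Proof. by have := @chordK 0; rewrite scale0r subr0 lexx; exact. Qed.
Lemma chordtK : K (p - t *: v). Proof. by apply: chordK; rewrite t0 lexx. Qed.

Lemma norm_delta_le (j : 'I_n) : `|delta_mx 0 j : V| <= 1.
Proof.
apply: norm_le_entries => // k; rewrite mxE eqxx /=.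
by case: eqP => _; rewrite ?normr1 ?normr0.
Qed.

Lemma grad_le x : K x -> `|gradv xi x| <= M.
Proof.
move=> Kx; apply: norm_le_entries => // j; rewrite gradvE.
by rewrite (le_trans (db_1 db _ Kx)) // ler_piMr // norm_delta_le.
Qed.

Lemma hess_le x u : K x -> `|gradv (dd u xi) x| <= M * `|u|.
Proof.
move=> Kx; apply: norm_le_entries => [|j]; first exact: mulr_ge0.
by rewrite gradvE (le_trans (db_2 db _ _ Kx)) // ler_wpM2l // ler_piMl // norm_delta_le.
Qed.

Lemma grad_increment1 : `|gradv xi (p - t *: v) - gradv xi p| <= M * t.
Proof.
apply: norm_le_entries => [|j]; first exact: mulr_ge0.
rewrite !mxE !gradvE.
have := mvt_le t0 (fun s => is_derive_chord s (smooth_dd (delta_mx 0 j) smooth_xi)) (c := M).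
rewrite /= scale0r !subr0; apply => s st; rewrite normrN.
rewrite (le_trans (db_2 db _ _ (chordK st))) // ler_piMr //.
by rewrite mulr_ile1 // norm_delta_le.
Qed.

Lemma grad_increment2 :
  `|gradv xi (p - t *: v) - gradv xi p + t *: gradv (dd v xi) p| <= M * t ^+ 2.
Proof.
apply: norm_le_entries => [|j]; first by rewrite mulr_ge0 // sqr_ge0.
rewrite !mxE !gradvE ddC //.
pose g := dd (delta_mx 0 j) xi; have sg : smooth g by exact: smooth_dd.
have d1 (s : R) : is_derive s 1 (fun s : R => - dd v g (p - s *: v)) (dd v (dd v g) (p - s *: v)).
  have := is_derive_chord s (smooth_dd v sg) => ?.
  by apply: is_derive_eq; rewrite opprK.
have := taylor2_le t0 (fun s => is_derive_chord s sg) d1 (c := M).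
rewrite /= scale0r !subr0 mulrN opprK; apply => s st.
rewrite (le_trans (db_3 db _ _ _ (chordK st))) // ler_piMr //.
by rewrite !mulr_ile1 // ?norm_delta_le // mulr_ge0.
Qed.

Lemma hess_increment u :
  `|gradv (dd u xi) (p - t *: v) - gradv (dd u xi) p| <= M * t * `|u|.
Proof.
apply: norm_le_entries => [|j]; first by rewrite !mulr_ge0.
rewrite !mxE !gradvE.
have := mvt_le t0 (fun s => is_derive_chord s
  (smooth_dd (delta_mx 0 j) (smooth_dd u smooth_xi))) (c := M * `|u|).
rewrite /= scale0r !subr0 mulrAC; apply => s st; rewrite normrN.
rewrite (le_trans (db_3 db _ _ _ (chordK st))) // ler_wpM2l // mulrA ler_piMl //.
by rewrite mulr_ile1 // norm_delta_le.
Qed.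

(** Flights are run backwards in time, from [p] to [p - t v]. Reflection at the second endpoint
    reverses the sign of the normal velocity, so [ar] is its value after the bounce, the one to be
    compared with [a]. *)
Let a := dd v xi p.
Let ar := - dd v xi (p - t *: v).
Let kappa (s : R) := dd v (dd v xi) (p - s *: v).

Lemma is_derive_chord1 (s : R) :
  is_derive s 1 (fun s : R => - dd v xi (p - s *: v)) (kappa s).
Proof.
have := is_derive_chord s (smooth_dd v smooth_xi) => ?.
by apply: is_derive_eq; rewrite opprK.
Qed.

Section Endpoints.
Hypothesis xip : xi p = 0.
Hypothesis xipt : xi (p - t *: v) = 0.

(** Since [xi] vanishes at both endpoints, the trapezoidal rule contains only the end slopes; after
    division by [t] it says [ar - a = O(t^2)]. *)
Lemma chord_trapezoid : `|t * (ar - a)| <= M * t ^+ 3.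
Proof.
have := trapezoid_le t0 (fun s => is_derive_chord s smooth_xi) is_derive_chord1
  (fun s => is_derive_chord s (smooth_dd v (smooth_dd v smooth_xi))) (c := M).
rewrite /= scale0r !subr0 xip xipt subr0 mulr0 subr0 -/ar -/a; apply => s st.
rewrite normrN (le_trans (db_3 db _ _ _ (chordK st))) // ler_piMr //.
by rewrite !mulr_ile1 // mulr_ge0.
Qed.

Lemma chord_curvature : `|ar + a - t * kappa 0| <= M * t ^+ 2.
Proof.
have := taylor2_le t0 is_derive_chord1
  (fun s => is_derive_chord s (smooth_dd v (smooth_dd v smooth_xi))) (c := M).
rewrite /= scale0r !subr0 -/ar -/a opprK; apply => s st.
rewrite normrN (le_trans (db_3 db _ _ _ (chordK st))) // ler_piMr //.
by rewrite !mulr_ile1 // mulr_ge0.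
Qed.

Lemma chord_curvature_increment : `|kappa t - kappa 0| <= M * t.
Proof.
have := mvt_le t0 (fun s => is_derive_chord s (smooth_dd v (smooth_dd v smooth_xi)))
  (c := M).
rewrite /= !subr0; apply => s st.
rewrite normrN (le_trans (db_3 db _ _ _ (chordK st))) // ler_piMr //.
by rewrite !mulr_ile1 // mulr_ge0.
Qed.

Lemma chord_length_ub : t * a <= M * t ^+ 2.
Proof.
have := taylor2_le t0 (fun s => is_derive_chord s smooth_xi) is_derive_chord1 (c := M).
rewrite /= scale0r !subr0 xip xipt subr0 sub0r mulrN opprK -/a => h.
apply: le_trans (ler_norm _) _; apply: h => s st.
rewrite (le_trans (db_2 db _ _ (chordK st))) // ler_piMr //.
by rewrite mulr_ile1.
Qed.

Lemma chord_length_lb (c : R) :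
  (forall s, 0 <= s <= t -> c <= kappa s) ->
  c / 2 * t ^+ 2 <= t * a /\ c / 2 * t ^+ 2 <= t * ar.
Proof.
move=> /(convex_tangent_le t0 (fun s => is_derive_chord s smooth_xi) is_derive_chord1) [].
rewrite /= scale0r !subr0 xip xipt -/a -/ar mulrN.
by move: (t * a) (t * ar) (c / 2 * t ^+ 2) => x y z h1 h2; split; lra.
Qed.

End Endpoints.

Section Variation.
Variables (dp dv : V) (dt : R).
Let dpr := dp - t *: dv - dt *: v.
Let da := dd dv xi p + dd dp (dd v xi) p.
Let dar := - (dd dv xi (p - t *: v) + dd dpr (dd v xi) (p - t *: v)).
Hypothesis tangent : dd dp xi p = 0.
Hypothesis tangentr : dd dpr xi (p - t *: v) = 0.
(** In [f2] and [f3] the coefficients are at most 3, and the factor [s] of the last term is at most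
    [t <= M]; this is where [3 M] and [M ^+ 2] come from. *)
Let C := M * 3 + M ^+ 2.
Let D := C * (`|dp| + `|dv|).

(** The derivative of [xi (p - s v)] in the parameter, at fixed [s]. Both endpoints stay on the
    boundary, so it is 0 at [s = 0] and [- ar dt] at [s = t], where [dt] is here the variation of
    the duration. Its end slopes are [- da] and [dar - dt * kappa t]. *)
Let f (s : R) := dd dp xi (p - s *: v) - s * dd dv xi (p - s *: v).
Let f1 (s : R) := - dd v (dd dp xi) (p - s *: v) - dd dv xi (p - s *: v)
  + s * dd v (dd dv xi) (p - s *: v).
Let f2 (s : R) := dd v (dd v (dd dp xi)) (p - s *: v) + 2 * dd v (dd dv xi) (p - s *: v)
  - s * dd v (dd v (dd dv xi)) (p - s *: v).
Let f3 (s : R) := - dd v (dd v (dd v (dd dp xi))) (p - s *: v)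
  - 3 * dd v (dd v (dd dv xi)) (p - s *: v)
  + s * dd v (dd v (dd v (dd dv xi))) (p - s *: v).

Lemma variation_der (s : R) : is_derive s 1 f (f1 s).
Proof.
have h := is_derive_affine 1 0 (-1)
  (is_derive_chord s (smooth_dd dp smooth_xi)) (is_derive_cst 0 s 1)
  (is_derive_chord s (smooth_dd dv smooth_xi)).
by refine (is_derive_ext h _ _) => [r|]; rewrite /f /f1 /=; ring.
Qed.

Lemma variation_der1 (s : R) : is_derive s 1 f1 (f2 s).
Proof.
have h := is_derive_affine (-1) (-1) 1
  (is_derive_chord s (smooth_dd v (smooth_dd dp smooth_xi)))
  (is_derive_chord s (smooth_dd dv smooth_xi))
  (is_derive_chord s (smooth_dd v (smooth_dd dv smooth_xi))).
by refine (is_derive_ext h _ _) => [r|]; rewrite /f1 /f2 /=; ring.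
Qed.

Lemma variation_der2 (s : R) : is_derive s 1 f2 (f3 s).
Proof.
have h := is_derive_affine 1 2 (-1)
  (is_derive_chord s (smooth_dd v (smooth_dd v (smooth_dd dp smooth_xi))))
  (is_derive_chord s (smooth_dd v (smooth_dd dv smooth_xi)))
  (is_derive_chord s (smooth_dd v (smooth_dd v (smooth_dd dv smooth_xi)))).
by refine (is_derive_ext h _ _) => [r|]; rewrite /f2 /f3 /=; ring.
Qed.

Let C0 : 0 <= C. Proof. by rewrite addr_ge0 ?mulr_ge0 ?sqr_ge0. Qed.
Let D0 : 0 <= D. Proof. by rewrite mulr_ge0 // addr_ge0. Qed.

Lemma variation_ft : f t = - (ar * dt).
Proof.
move: tangentr; rewrite /f /ar /dpr !ddB // !ddZ // => h.
apply/eqP; rewrite -subr_eq0 -[X in _ == X]h; apply/eqP.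
by move: (dd dp xi _) (dd dv xi _) (dd v xi _) => x y z; ring.
Qed.

Lemma variation_f10 : f1 0 = - da.
Proof.
rewrite /f1 /da scale0r subr0 mul0r addr0 (ddC v dp smooth_xi).
by move: (dd dp _ _) (dd dv xi _) => x y; ring.
Qed.

Lemma variation_f1t : f1 t = dar - dt * kappa t.
Proof.
have sv := smooth_dd v smooth_xi.
rewrite /f1 /dar /dpr /kappa !(ddB _ _ _ sv) !(ddZ _ _ _ sv).
rewrite (ddC dp v smooth_xi) (ddC dv v smooth_xi).
move: (dd v (dd dp xi) _) (dd v (dd dv xi) _) (dd dv xi _) (dd v (dd v xi) _) => x y z w.
by ring.
Qed.

Lemma variation_sum (k x y z : R) : k <= 3 -> x <= M * `|dp| -> y <= M * `|dv| ->
  z <= M * (M * `|dv|) -> 0 <= y -> x + k * y + z <= D.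
Proof.
move=> k3 hx hy hz y0.
have hk : k * y <= 3 * (M * `|dv|) by rewrite (le_trans (y := 3 * y)) ?ler_wpM2r ?ler_wpM2l.
have P0 : 0 <= M * `|dp| by rewrite mulr_ge0.
have Q0 : 0 <= M ^+ 2 * `|dp| by rewrite mulr_ge0 ?sqr_ge0.
by rewrite /D /C; lra.
Qed.

Lemma variation_f2_le (s : R) : 0 <= s <= t -> `|f2 s| <= D.
Proof.
move=> /[dup] st /andP[s0 s_le].
have Ks := chordK st.
have b1 : `|dd v (dd v (dd dp xi)) (p - s *: v)| <= M * `|dp|.
  rewrite (le_trans (db_3 db _ _ _ Ks)) // ler_wpM2l // mulrA ler_piMl //.
  by rewrite mulr_ile1.
have b2 : `|dd v (dd dv xi) (p - s *: v)| <= M * `|dv|.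
  by rewrite (le_trans (db_2 db _ _ Ks)) // ler_wpM2l // ler_piMl.
have b3 : `|s * dd v (dd v (dd dv xi)) (p - s *: v)| <= M * (M * `|dv|).
  rewrite normrM (ger0_norm s0) ler_pM // ?(le_trans s_le) //.
  rewrite (le_trans (db_3 db _ _ _ Ks)) // ler_wpM2l // mulrA ler_piMl //.
  by rewrite mulr_ile1.
rewrite /f2 (le_trans (ler_normB _ _)) // (le_trans (lerD (ler_normD _ _) (lexx _))) //.
rewrite [`|2 * _|]normrM (ger0_norm (ler0n _ 2)).
by apply: variation_sum b1 b2 b3 _; rewrite ?ler_nat.
Qed.

Lemma variation_f3_le (s : R) : 0 <= s <= t -> `|f3 s| <= D.
Proof.
move=> /[dup] st /andP[s0 s_le].
have Ks := chordK st.
have b1 : `|dd v (dd v (dd v (dd dp xi))) (p - s *: v)| <= M * `|dp|.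
  rewrite (le_trans (db_4 db _ _ _ _ Ks)) // ler_wpM2l // !mulrA ler_piMl //.
  by rewrite !mulr_ile1 // mulr_ge0.
have b2 : `|dd v (dd v (dd dv xi)) (p - s *: v)| <= M * `|dv|.
  rewrite (le_trans (db_3 db _ _ _ Ks)) // ler_wpM2l // mulrA ler_piMl //.
  by rewrite mulr_ile1.
have b3 : `|s * dd v (dd v (dd v (dd dv xi))) (p - s *: v)| <= M * (M * `|dv|).
  rewrite normrM (ger0_norm s0) ler_pM // ?(le_trans s_le) //.
  rewrite (le_trans (db_4 db _ _ _ _ Ks)) // ler_wpM2l // !mulrA ler_piMl //.
  by rewrite !mulr_ile1 // mulr_ge0.
rewrite /f3 (le_trans (ler_normD _ _)) // (le_trans (lerD (ler_normB _ _) (lexx _))) //.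
rewrite normrN [`|3 * _|]normrM (ger0_norm (ler0n _ 3)).
by apply: variation_sum b1 b2 b3 _; rewrite ?ler_nat.
Qed.

Lemma variation_time_le : `|ar * dt - t * da| <= D * t ^+ 2.
Proof.
have := taylor2_le t0 variation_der variation_der1 variation_f2_le.
rewrite variation_ft variation_f10 /f scale0r subr0 tangent mul0r !subr0.
by rewrite mulrN opprK distrC addrC.
Qed.

Lemma variation_velocity_le :
  `|t * (dar - dt * kappa t - da) + 2 * (ar * dt)| <= D * t ^+ 3.
Proof.
have := trapezoid_le t0 variation_der variation_der1 variation_der2 variation_f3_le.
rewrite variation_ft variation_f10 variation_f1t /f scale0r subr0 tangent mul0r.
by rewrite !subr0 mulrN opprK.
Qed.

End Variation.
End OneChord.

(** * Growth of the energy over one bounce *)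

Section BounceStep.
Variables (R : realType) (n : nat).
Local Notation V := 'rV[R]_n.

(* [dp], [dv], [dt] are variations of the position, velocity and time of a bounce, so that
   [dp - dt v] is the displacement at frozen time; [jac_wedge] is the variation at frozen
   time of [v ^ grad xi], which reflections preserve. *)
Definition jac_wedge (xi : V -> R) (p v dp dv : V) (dt : R) : 'M[R]_n :=
  wedge dv (gradv xi p) + wedge v (gradv (dd (dp - dt *: v) xi) p).

Definition jac_energy (xi : V -> R) (p v dp dv : V) (dt : R) : R :=
  `|dp - dt *: v| + `|jac_wedge xi p v dp dv dt|
  + `|dd dv xi p + dd dp (dd v xi) p| + dd v xi p * `|dt|.

Variables (xi : V -> R) (K : set V) (M c g0 : R).
Hypothesis smooth_xi : smooth xi.
Hypothesis db : derivative_bounds xi K M.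
Let M0 : 0 <= M := db_ge0 db.
Hypothesis c0 : 0 < c.
Hypothesis g00 : 0 < g0.

(** One flight between two bounces, its variation and all their constraints form a single type, so
    that [dominated] over it means uniformity over all flights. A final [r] marks the state at the
    next bounce, after reflection for velocities; [bdt] is the variation of the time of the first
    bounce and [bdtau] that of the duration [bt]. *)
Record bounce : Type := Bounce {
  bp : V; bv : V; bdp : V; bdv : V; bvr : V; bdvr : V;
  bt : R; bdtau : R; bdt : R; blam : R;
  bpr := bp - bt *: bv;
  bdpr := bdp - bt *: bdv - bdtau *: bv;
  bt_gt0 : 0 < bt;
  bt_le : bt <= M;
  bv_le : `|bv| <= 1;
  bchord : forall s, 0 <= s <= bt -> K (bp - s *: bv);
  bcurv : forall s, 0 <= s <= bt -> c <= dd bv (dd bv xi) (bp - s *: bv);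
  bxi : xi bp = 0;
  bxir : xi bpr = 0;
  bgrad : g0 <= dot (gradv xi bp) (gradv xi bp);
  bgradr : g0 <= dot (gradv xi bpr) (gradv xi bpr);
  btangent : dd bdp xi bp = 0;
  btangentr : dd bdpr xi bpr = 0;
  bvrE : bvr = bv + blam *: gradv xi bpr;
  blamE : blam * dot (gradv xi bpr) (gradv xi bpr) = 2 * - dd bv xi bpr;
  bwedge : wedge bdvr (gradv xi bpr) + wedge bvr (gradv (dd bdpr xi) bpr)
    = wedge bdv (gradv xi bpr) + wedge bv (gradv (dd bdpr xi) bpr);
  bnormal : dd bdvr xi bpr + dd bdpr (dd bvr xi) bpr
    = - (dd bdv xi bpr + dd bdpr (dd bv xi) bpr)
}.

Let X b := bdp b - bdt b *: bv b.
Let a b := dd (bv b) xi (bp b).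
Let ar b := - dd (bv b) xi (bpr b).
Let da b := dd (bdv b) xi (bp b) + dd (bdp b) (dd (bv b) xi) (bp b).
Let dar b := - (dd (bdv b) xi (bpr b) + dd (bdpr b) (dd (bv b) xi) (bpr b)).
Let G b := gradv xi (bp b).
Let Gr b := gradv xi (bpr b).
Let kappa b := dd (bv b) (dd (bv b) xi) (bp b).
Let kappar b := dd (bv b) (dd (bv b) xi) (bpr b).
Let DL b := jac_wedge xi (bp b) (bv b) (bdp b) (bdv b) (bdt b).
Let E b := jac_energy xi (bp b) (bv b) (bdp b) (bdv b) (bdt b).

Let t0 b : 0 <= bt b. Proof. exact/ltW/bt_gt0. Qed.

Lemma bpK b : K (bp b).
Proof. exact: (chord0K (t0 b) (@bchord b)). Qed.

Lemma bprK b : K (bpr b).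
Proof. exact: (chordtK (t0 b) (@bchord b)). Qed.

Let a_lb b : c / 2 * bt b <= a b /\ c / 2 * bt b <= ar b.
Proof.
have [h1 h2] := chord_length_lb smooth_xi (t0 b) (bxi b) (bxir b) (@bcurv b).
have tt : c / 2 * bt b ^+ 2 = bt b * (c / 2 * bt b) by ring.
by move: h1 h2; rewrite tt !ler_pM2l ?bt_gt0.
Qed.

Let a_ge0 b : 0 <= a b.
Proof. by apply: le_trans (a_lb b).1; rewrite mulr_ge0 ?divr_ge0 // ltW. Qed.

Let a_ub b : a b <= M * bt b.
Proof.
have := chord_length_ub smooth_xi db (t0 b) (bv_le b) (@bchord b) (bxi b) (bxir b).
have -> : M * bt b ^+ 2 = bt b * (M * bt b) by ring.
by rewrite ler_pM2l ?bt_gt0.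
Qed.

Let ar_a b : `|ar b - a b| <= M * bt b ^+ 2.
Proof.
have := chord_trapezoid smooth_xi db (t0 b) (bv_le b) (@bchord b) (bxi b) (bxir b).
rewrite normrM (ger0_norm (t0 b)).
have -> : M * bt b ^+ 3 = bt b * (M * bt b ^+ 2) by ring.
by rewrite ler_pM2l ?bt_gt0.
Qed.

Let ar_kappa b : `|2 * ar b - bt b * kappa b| <= 2 * M * bt b ^+ 2.
Proof.
have := chord_curvature smooth_xi db (t0 b) (bv_le b) (@bchord b).
rewrite scale0r subr0 -/(ar b) -/(a b) -/(kappa b) => h.
have -> : 2 * ar b - bt b * kappa b = (ar b - a b) + (ar b + a b - bt b * kappa b) by ring.
by rewrite (le_trans (ler_normD _ _)) // (le_trans (lerD (ar_a b) h)) //; lra.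
Qed.

Let E_ge b : [/\ `|X b| <= E b, `|DL b| <= E b, `|da b| <= E b & a b * `|bdt b| <= E b].
Proof.
rewrite /E /jac_energy -/(X b) -/(DL b) -/(da b) -/(a b).
have h1 : 0 <= `|X b| by []. have h2 : 0 <= `|DL b| by []. have h3 : 0 <= `|da b| by [].
have h4 : 0 <= a b * `|bdt b| by rewrite mulr_ge0.
move: h1 h2 h3 h4; move: `|X b| `|DL b| `|da b| (a b * `|bdt b|) => x y z w *.
by split; lra.
Qed.

Let E0 b : 0 <= E b. Proof. by have [h _ _ _] := E_ge b; exact: le_trans h. Qed.

Let oX : dominated X E. Proof. by apply: dominated_le1 => b; have [] := E_ge b. Qed.
Let oDL : dominated DL E. Proof. by apply: dominated_le1 => b; have [] := E_ge b. Qed.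
Let oda : dominated da E. Proof. by apply: dominated_le1 => b; have [] := E_ge b. Qed.
Let one (b : bounce) : R := 1.
Let ot1 : dominated bt one.
Proof. by apply: (dominated_le M0) => b; rewrite mulr1 ger0_norm ?bt_le. Qed.
Let ov : dominated bv one. Proof. by apply: dominated_le1 => b; exact: bv_le. Qed.
Let oG : dominated G one.
Proof. by apply: (dominated_le M0) => b; rewrite mulr1; apply: (grad_le db (bpK b)). Qed.
Let oGr : dominated Gr one.
Proof. by apply: (dominated_le M0) => b; rewrite mulr1; apply: (grad_le db (bprK b)). Qed.
Let oar : dominated ar bt.
Proof.
apply: (@dominated_le _ _ _ _ _ (M + M * M)); first by rewrite addr_ge0 // mulr_ge0.
move=> b; have -> : ar b = a b + (ar b - a b) by ring.
rewrite (le_trans (ler_normD _ _)) // mulrDl lerD //; first by rewrite ger0_norm.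
by rewrite (le_trans (ar_a b)) // expr2 mulrA ler_wpM2r // ler_wpM2l // bt_le.
Qed.
Let olam : dominated blam bt.
Proof.
apply: (@dominated_div _ _ (fun b => dot (Gr b) (Gr b)) (fun=> 1) bt g0) => //.
  by move=> b; rewrite mulr1 ger0_norm ?bgradr // (le_trans (ltW g00)) ?bgradr.
have := dominatedD oar oar.
move=> /dominated_eq h; apply: (dominated_eqr (h _ _)) => b; last by rewrite mul1r.
by rewrite mulrC blamE mulr_natl mulr2n.
Qed.

Let odd2 (x : bounce -> V) (f h : bounce -> V) g1 g2 : (forall b, K (x b)) ->
  dominated f g1 -> dominated h g2 ->
  dominated (fun b => dd (f b) (dd (h b) xi) (x b)) (fun b => g1 b * g2 b).
Proof.
move=> Kx [C C0 hC] [D D0 hD]; exists (M * (C * D)); first by rewrite !mulr_ge0.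
move=> b; rewrite (le_trans (db_2 db _ _ (Kx b))) // -mulrA ler_wpM2l // mulrACA.
by rewrite ler_pM.
Qed.

Let ohess (x f : bounce -> V) g : (forall b, K (x b)) -> dominated f g ->
  dominated (fun b => gradv (dd (f b) xi) (x b)) g.
Proof.
move=> Kx [C C0 hC]; exists (M * C); first exact: mulr_ge0.
move=> b; rewrite (le_trans (hess_le db _ (Kx b))) // -mulrA ler_wpM2l //.
Qed.

(** Convexity in the form [a >= c t / 2] turns the term [a |dt|] of the energy into a bound on
    [t |dt|]; the energy gives no uniform bound on [dt] itself. *)
Let otdt : dominated (fun b => bt b * bdt b) E.
Proof.
apply: (@dominated_le _ _ _ _ _ (2 / c)); first by rewrite divr_ge0 // ltW.
move=> b; have [_ _ _ h] := E_ge b; have [la _] := a_lb b.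
rewrite normrM (ger0_norm (t0 b)).
rewrite -(@ler_pM2l _ (c / 2)) ?divr_gt0 // !mulrA.
have -> : c / 2 * 2 / c = 1 by field; rewrite gt_eqF.
by rewrite mul1r (le_trans _ h) // ler_wpM2r.
Qed.

(** The size of the raw variations [dp] and [dv], which contain [dt]. A factor [t] brings them back
    to [O(E)]. *)
Let EdT b := E b + `|bdt b|.
Let EdT0 b : 0 <= EdT b. Proof. by rewrite addr_ge0. Qed.

Let oE_EdT (W : normedModType R) (f : bounce -> W) : dominated f E -> dominated f EdT.
Proof.
by move=> h; apply: dominated_trans h _; apply: dominated_le1 => b; rewrite ger0_norm // lerDl.
Qed.

Let odt_EdT : dominated bdt EdT.
Proof. by apply: dominated_le1 => b; rewrite lerDr. Qed.

Let otEdT : dominated (fun b => bt b * EdT b) E.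
Proof.
have h1 : dominated (fun b => bt b * E b) E.
  by apply: dominated_absorbl ot1 => //; apply: dominated_refl => b; rewrite mulr_ge0.
apply: dominated_eq (dominatedD h1 (dominated_norm otdt)) _ => b.
by rewrite normrM (ger0_norm (t0 b)) -mulrDr.
Qed.

Let odp : dominated bdp EdT.
Proof.
apply: dominated_le1 => b; have -> : bdp b = X b + bdt b *: bv b by rewrite subrK.
rewrite (le_trans (ler_normD _ _)) // lerD //; first by have [] := E_ge b.
by rewrite normrZ ler_piMr // bv_le.
Qed.

Let dd_dv b : dd (bdv b) xi (bp b)
  = da b - dd (X b) (dd (bv b) xi) (bp b) - bdt b * kappa b.
Proof.
have -> : X b = (- bdt b) *: bv b + bdp b by rewrite scaleNr addrC.
rewrite dd_linear; last exact: smooth_dd.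
by rewrite /da /kappa; ring.
Qed.

Let okappa : dominated kappa one.
Proof. exact: dominated_mulr1 (odd2 bpK ov ov). Qed.

Let oXv : dominated (fun b => dd (X b) (dd (bv b) xi) (bp b)) E.
Proof. exact: dominated_mulr1 (odd2 bpK oX ov). Qed.

Let owedge_dvG : dominated (fun b => wedge (bdv b) (G b)) E.
Proof.
have h : dominated (fun b => wedge (bv b) (gradv (dd (X b) xi) (bp b))) E.
  by apply: dominated_eqr (dominated_wedge ov (ohess bpK oX)) _ => b; rewrite mul1r.
by apply: dominated_eq (dominatedB oDL h) _ => b; rewrite addrK.
Qed.

Let odv : dominated bdv EdT.
Proof.
apply: (dominated_row g00 bgrad oG _ (oE_EdT owedge_dvG)).
have h1 : dominated (fun b => bdt b * kappa b) EdT.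
  exact: dominated_mulr1 (dominatedM odt_EdT okappa).
apply: dominated_eq (dominatedB (dominatedB (oE_EdT oda) (oE_EdT oXv)) h1) _ => b.
by rewrite -dd_gradv // dd_dv.
Qed.

Let otdv : dominated (fun b => bt b *: bdv b) E.
Proof.
apply: dominated_trans otEdT.
by apply: dominatedZ odv; apply: dominated_refl.
Qed.

Let tE b := bt b * E b.

Let otE (W : normedModType R) (f : bounce -> W) :
  dominated f E -> dominated (fun b => bt b *: f b) tE.
Proof. by move=> h; apply: dominatedZ h; apply: dominated_refl. Qed.

Let odG : dominated (fun b => Gr b - G b) bt.
Proof.
apply: (dominated_le M0) => b.
exact: (grad_increment1 smooth_xi db (t0 b) (bv_le b) (@bchord b)).
Qed.

Let odGt : dominated (fun b => (bt b)^-1 *: (Gr b - G b)) one.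
Proof.
have [C C0 hC] := odG; exists C => // b.
rewrite normrZ ger0_norm ?invr_ge0 // mulr1 ler_pdivrMl ?bt_gt0 //.
by rewrite (le_trans (hC b)) // mulrC.
Qed.

Let t2 b := bt b * bt b.

Let odG2 : dominated (fun b => Gr b - G b + bt b *: gradv (dd (bv b) xi) (bp b)) t2.
Proof.
apply: (dominated_le M0) => b; rewrite /t2 -expr2.
exact: (grad_increment2 smooth_xi db (t0 b) (bv_le b) (@bchord b)).
Qed.

Let odH (f : bounce -> V) g : dominated f g ->
  dominated (fun b => gradv (dd (f b) xi) (bpr b) - gradv (dd (f b) xi) (bp b))
    (fun b => bt b * g b).
Proof.
move=> [C C0 hC]; exists (M * C); first exact: mulr_ge0.
move=> b; rewrite (le_trans (hess_increment smooth_xi db (t0 b) (bv_le b) (@bchord b) _)) //.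
by rewrite -!mulrA ler_wpM2l // mulrCA ler_wpM2l.
Qed.

(* the velocity variation with the averaged acceleration of the bounce taken out *)
Let Dv b := bdv b + (blam b / bt b * bdt b) *: Gr b.

(** The main cancellation. In the direction of [Gr], the variation [dv] contributes [- dt kappa] and
    the correction contributes [2 ar dt / t]; by [ar_kappa] their sum is [O(t dt)], hence [O(E)].
    The exterior product with [Gr] does not see the correction. *)
Let oDv : dominated Dv E.
Proof.
apply: (dominated_row g00 bgradr oGr).
  have h1 : dominated (fun b => dot (bt b *: bdv b) ((bt b)^-1 *: (Gr b - G b))) E.
    exact: dominated_mulr1 (dominated_dot otdv odGt).
  have h2 : dominated (fun b => (2 * ar b - bt b * kappa b) / bt b * bdt b) E.
    apply: dominated_trans (dominated_norm otdt).
    apply: (@dominated_le _ _ _ _ _ (2 * M)); first exact: mulr_ge0.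
    move=> b; rewrite !normrM normfV !(ger0_norm (t0 b)).
    rewrite mulrA ler_wpM2r // ler_pdivrMr ?bt_gt0 //.
    by rewrite (le_trans (ar_kappa b)) // expr2 mulrA.
  apply: dominated_eq (dominatedD h1 (dominatedD (dominatedB oda oXv) h2)) _ => b.
  rewrite /Dv dotDl dotZl dotZl dotZr dotBr -!(dd_gradv (bdv b)) // dd_dv.
  have -> : blam b / bt b * bdt b * dot (Gr b) (Gr b) =
    (blam b * dot (Gr b) (Gr b)) / bt b * bdt b by ring.
  rewrite blamE -/(ar b).
  move: (bt_gt0 b); move: (bt b) (ar b) (kappa b) (bdt b) => t r k s t_gt0.
  by move: (dd _ _ _) (da b) (dd _ _ _) => x y z; field; rewrite gt_eqF.
have h1 : dominated (fun b => wedge (bt b *: bdv b) ((bt b)^-1 *: (Gr b - G b))) E.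
  exact: dominated_mulr1 (dominated_wedge otdv odGt).
apply: dominated_eq (dominatedD h1 owedge_dvG) _ => b.
rewrite /Dv addrC wedge_linl wedgexx scaler0 add0r.
rewrite -[bt b *: bdv b]addr0 wedge_linl -[_^-1 *: _]addr0 wedge_linr.
have -> : Gr b - G b = (-1) *: G b + Gr b by rewrite scaleN1r addrC.
rewrite wedge_linr.
apply/matrixP => j k; rewrite !mxE.
have := bt_gt0 b; move: (bdv b 0 j) (bdv b 0 k) (G b 0 j) (G b 0 k) (Gr b 0 j) (Gr b 0 k).
by move: (bt b) => t x1 x2 x3 x4 x5 x6 t_gt0; field; rewrite gt_eqF.
Qed.

Let C4 := M * 3 + M ^+ 2.
Let C40 : 0 <= C4. Proof. by rewrite addr_ge0 ?mulr_ge0 ?sqr_ge0. Qed.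
Let dy b := `|bdp b| + `|bdv b|.

Let otdy : dominated (fun b => bt b * dy b) E.
Proof.
apply: dominated_trans otEdT.
apply: dominatedM; first exact: dominated_refl.
by apply: dominatedD; apply: dominated_norm.
Qed.

(** The relation [ar dtau = t da + O(t^2 (|dp| + |dv|))] has a right side of size [t E], and
    [ar >= c t / 2]. *)
Let odtau : dominated bdtau E.
Proof.
apply: (@dominated_div _ _ ar bt E (c / 2)); first by rewrite divr_gt0.
- exact: bt_gt0.
- by move=> b; rewrite (le_trans (a_lb b).2) // ler_norm.
have h1 : dominated (fun b => ar b * bdtau b - bt b * da b) tE.
  have [C C0 hC] := otdy; exists (C4 * C); first exact: mulr_ge0.
  move=> b; have := variation_time_le smooth_xi db (t0 b) (bt_le b) (bv_le b)
    (@bchord b) (btangent b) (btangentr b).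
  rewrite -/(ar b) -/(da b) -/C4 -/(dy b) => /le_trans; apply.
  have := hC b; rewrite ger0_norm; last by rewrite mulr_ge0 // addr_ge0.
  move=> h; have -> : C4 * dy b * bt b ^+ 2 = C4 * bt b * (bt b * dy b) by ring.
  have -> : C4 * C * tE b = C4 * bt b * (C * E b) by rewrite /tE; ring.
  by rewrite ler_wpM2l // mulr_ge0.
by apply: dominated_eq (dominatedD h1 (otE oda)) _ => b; rewrite /GRing.scale /= subrK.
Qed.

(** Besides the trapezoidal error there remains [(t kappar - 2 ar) dtau]. Its coefficient is
    [O(t^2)], since the jump of the normal velocity is [t] times the curvature term to leading
    order. Division by [t] concludes. *)
Let odar : dominated (fun b => dar b - da b) tE.
Proof.
apply: (@dominated_div _ _ bt bt tE 1) => //; first exact: bt_gt0.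
  by move=> b; rewrite mul1r ger0_norm.
have h1 : dominated (fun b => bt b * (dar b - bdtau b * kappar b - da b)
    + 2 * (ar b * bdtau b)) (fun b => bt b * tE b).
  have [C C0 hC] := otdy; exists (C4 * C); first exact: mulr_ge0.
  move=> b; have := variation_velocity_le smooth_xi db
    (t0 b) (bt_le b) (bv_le b) (@bchord b) (btangent b) (btangentr b).
  rewrite -/(ar b) -/(da b) -/(dar b) -/(kappar b) -/C4 -/(dy b) => /le_trans; apply.
  have := hC b; rewrite ger0_norm; last by rewrite mulr_ge0 // addr_ge0.
  move=> h; have -> : C4 * dy b * bt b ^+ 3 = C4 * bt b ^+ 2 * (bt b * dy b) by ring.
  have -> : C4 * C * (bt b * tE b) = C4 * bt b ^+ 2 * (C * E b) by rewrite /tE; ring.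
  by rewrite ler_wpM2l // mulr_ge0 // sqr_ge0.
have h2 : dominated (fun b => bt b * kappar b - 2 * ar b) t2.
  apply: (@dominated_le _ _ _ _ _ (2 * M + M)); first by rewrite addr_ge0 // mulr_ge0.
  move=> b; have := chord_curvature_increment smooth_xi db (t0 b) (bv_le b) (@bchord b).
  rewrite scale0r subr0 -/(kappa b) -/(kappar b) => h.
  have -> : bt b * kappar b - 2 * ar b
    = bt b * (kappar b - kappa b) - (2 * ar b - bt b * kappa b) by ring.
  rewrite (le_trans (ler_normB _ _)) // [leRHS]mulrDl [leLHS]addrC lerD //.
  by rewrite normrM (ger0_norm (t0 b)) /t2 mulrCA ler_wpM2l.
have h3 : dominated (fun b => (bt b * kappar b - 2 * ar b) * bdtau b) (fun b => bt b * tE b).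
  by apply: dominated_eqr (dominatedM h2 odtau) _ => b; rewrite /tE /t2 mulrA.
by apply: dominated_eq (dominatedD h1 h3) _ => b; ring.
Qed.

Let Xr b := bdpr b - (bdt b - bdtau b) *: bvr b.

Let XrE b : Xr b - X b = - (bt b *: Dv b) + (blam b * bdtau b) *: Gr b.
Proof.
rewrite /Xr /X bvrE -/(Gr b) /Dv /bdpr; apply/rowP => j; rewrite !mxE.
have := bt_gt0 b; move: (bdv b 0 j) (bdp b 0 j) (bv b 0 j) (Gr b 0 j).
move: (bt b) (bdt b) (bdtau b) (blam b) => t s r l x1 x2 x3 x4 t_gt0.
by field; rewrite gt_eqF.
Qed.

Let olamdtau : dominated (fun b => blam b * bdtau b) tE.
Proof. exact: (dominatedM olam odtau). Qed.

Let oXr : dominated (fun b => Xr b - X b) tE.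
Proof.
have h : dominated (fun b => (blam b * bdtau b) *: Gr b) tE.
  exact: dominated_mulr1 (dominatedZ olamdtau oGr).
exact: dominated_eq (dominatedD (dominatedN (otE oDv)) h) XrE.
Qed.

Let Hr b (u : V) := gradv (dd u xi) (bpr b).
Let H b (u : V) := gradv (dd u xi) (bp b).

Let HrX b : Hr b (Xr b) = (- (bdt b - bdtau b)) *: Hr b (bvr b) + Hr b (bdpr b).
Proof.
rewrite /Hr -gradv_hess_linear //; congr (gradv (dd _ _) _).
by rewrite /Xr scaleNr addrC.
Qed.

Let Hrdpr b : Hr b (bdpr b) = (- bt b) *: Hr b (Dv b) + ((blam b * bdtau b) *: Hr b (Gr b)
  + ((bdt b - bdtau b) *: Hr b (bvr b) + Hr b (X b))).
Proof.
rewrite /Hr -!gradv_hess_linear //; congr (gradv (dd _ _) _).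
have := XrE b; rewrite /Xr => h.
rewrite -[LHS](subrK ((bdt b - bdtau b) *: bvr b)) -[X in X + _](subrK (X b)) h.
by move: (X b) => Z; rewrite scaleNr -!addrA [Z + _]addrC.
Qed.

Let DLr b := jac_wedge xi (bpr b) (bvr b) (bdpr b) (bdvr b) (bdt b - bdtau b).

(** The terms are grouped so that each is visibly [O(t E)]. The raw [dv] meets only the second-order
    remainder of [Gr - G]; [dt] occurs with [lam = O(t)] and a difference of Hessian terms which is
    again [O(t)]; the other terms contain [dtau], [X] or [Dv], all [O(E)], with a small factor. *)
Let DLrE b : DLr b - DL b = wedge (bdv b) (Gr b - G b + bt b *: H b (bv b))
  - bt b *: wedge (Dv b) (H b (bv b))
  + (blam b * bdt b) *: wedge (Gr b) (H b (bv b) - Hr b (bvr b))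
  + (blam b * bdtau b) *: wedge (Gr b) (Hr b (bvr b))
  + wedge (bv b) (Hr b (X b) - H b (X b) - bt b *: Hr b (Dv b)
      + (blam b * bdtau b) *: Hr b (Gr b)).
Proof.
have E1 : DLr b = wedge (bdv b) (Gr b) + wedge (bv b) (Hr b (bdpr b))
   + (- (bdt b - bdtau b)) *: wedge (bvr b) (Hr b (bvr b)).
  rewrite /Hr -bwedge /DLr /jac_wedge -/(Xr b) -/(Hr b (Xr b)) HrX wedge_linr.
  by rewrite -addrA; congr (_ + _); rewrite addrC.
rewrite E1 Hrdpr {E1} bvrE -/(Gr b) /DL /jac_wedge -/(X b) -/(H b (X b)) -/(G b).
rewrite -bvrE; set W := Hr b (bvr b).
rewrite /Dv; move: (H b (bv b)) (H b (X b)) (Hr b (X b)) (Hr b _) (Hr b (Gr b)) W.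
move=> H1 H2 H3 H4 H5 W.
rewrite bvrE -/(Gr b); apply/matrixP => j k; rewrite !mxE.
move: (bt_gt0 b).
move: (bdv b 0 j) (bdv b 0 k) (bv b 0 j) (bv b 0 k) (Gr b 0 j) (Gr b 0 k) (G b 0 j) (G b 0 k).
move: (H1 0 j) (H1 0 k) (H2 0 j) (H2 0 k) (H3 0 j) (H3 0 k) (H4 0 j) (H4 0 k).
move: (H5 0 j) (H5 0 k) (W 0 j) (W 0 k) (bt b) (bdt b) (bdtau b) (blam b).
move=> *; field; exact: lt0r_neq0.
Qed.

Let ovr : dominated bvr one.
Proof.
have h : dominated (fun b => blam b *: Gr b) one.
  have h1 : dominated (fun b => blam b *: Gr b) bt.
    exact: dominated_mulr1 (dominatedZ olam oGr).
  exact: dominated_trans h1 ot1.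
by apply: dominated_eq (dominatedD ov h) _ => b; rewrite bvrE.
Qed.

Let oHHr : dominated (fun b => H b (bv b) - Hr b (bvr b)) bt.
Proof.
have h1 : dominated (fun b => Hr b (bv b) - H b (bv b)) bt.
  exact: dominated_mulr1 (odH ov).
have h2 : dominated (fun b => blam b *: Hr b (Gr b)) bt.
  exact: dominated_mulr1 (dominatedZ olam (ohess bprK oGr)).
apply: dominated_eq (dominatedN (dominatedD h1 h2)) _ => b.
have -> : Hr b (bvr b) = blam b *: Hr b (Gr b) + Hr b (bv b).
  by rewrite /Hr -gradv_hess_linear // bvrE addrC.
move: (H b (bv b)) (Hr b (bv b)) (blam b *: _) => x y z.
by apply/rowP => j; rewrite !mxE; ring.
Qed.

Let oDLr : dominated (fun b => DLr b - DL b) tE.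
Proof.
have w1 : dominated (fun b => wedge (bdv b) (Gr b - G b + bt b *: H b (bv b))) tE.
  have h : dominated (fun b => bt b * (bt b * EdT b)) tE.
    by apply: dominatedM otEdT; apply: dominated_refl.
  apply: dominated_trans h; apply: dominated_eqr (dominated_wedge odv odG2) _ => b.
  by rewrite /t2; ring.
have w2 : dominated (fun b => bt b *: wedge (Dv b) (H b (bv b))) tE.
  by apply: otE; apply: dominated_eqr (dominated_wedge oDv (ohess bpK ov)) _ => b; rewrite mulr1.
have w3 : dominated (fun b => (blam b * bdt b) *: wedge (Gr b) (H b (bv b) - Hr b (bvr b))) tE.
  have h : dominated (fun b => blam b * bdt b) E.
    apply: dominated_trans (dominated_norm otdt).
    apply: dominated_eqr (dominatedM olam (_ : dominated bdt (fun b => `|bdt b|))) _.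
      exact: dominated_le1.
    by move=> b; rewrite normrM (ger0_norm (t0 b)).
  apply: dominated_eqr (dominatedZ h (dominated_wedge oGr oHHr)) _ => b.
  by rewrite /tE /one; ring.
have w4 : dominated (fun b => (blam b * bdtau b) *: wedge (Gr b) (Hr b (bvr b))) tE.
  apply: dominated_eqr (dominatedZ olamdtau (dominated_wedge oGr (ohess bprK ovr))) _ => b.
  by rewrite /one; ring.
have w5 : dominated (fun b => wedge (bv b) (Hr b (X b) - H b (X b) - bt b *: Hr b (Dv b)
      + (blam b * bdtau b) *: Hr b (Gr b))) tE.
  have h1 : dominated (fun b => Hr b (X b) - H b (X b)) tE by exact: odH oX.
  have h2 : dominated (fun b => bt b *: Hr b (Dv b)) tE by exact: otE (ohess bprK oDv).
  have h3 : dominated (fun b => (blam b * bdtau b) *: Hr b (Gr b)) tE.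
    exact: dominated_mulr1 (dominatedZ olamdtau (ohess bprK oGr)).
  apply: dominated_eqr (dominated_wedge ov (dominatedD (dominatedB h1 h2) h3)) _ => b.
  by rewrite mul1r.
exact: dominated_eq (dominatedD (dominatedD (dominatedD (dominatedB w1 w2) w3) w4) w5) DLrE.
Qed.

Let oardt : dominated (fun b => ar b * (bdt b - bdtau b) - a b * bdt b) tE.
Proof.
have h1 : dominated (fun b => (ar b - a b) * bdt b) tE.
  have h : dominated (fun b => bt b * (bt b * `|bdt b|)) tE.
    apply: otE; apply: dominated_eq (dominated_norm otdt) _ => b.
    by rewrite normrM (ger0_norm (t0 b)).
  apply: dominated_trans h; apply: (dominated_le M0) => b.
  by rewrite normrM !mulrA ler_wpM2r // -mulrA -expr2.
have h2 : dominated (fun b => ar b * bdtau b) tE by exact: (dominatedM oar odtau).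
by apply: dominated_eq (dominatedB h1 h2) _ => b; ring.
Qed.

Let ddvr b : dd (bvr b) xi (bpr b) = ar b.
Proof.
rewrite bvrE addrC dd_linear // [dd (gradv _ _) _ _]dd_gradv // blamE /ar; ring.
Qed.

Lemma jac_energy_bounce : exists2 C : R, 0 <= C & forall b,
  jac_energy xi (bpr b) (bvr b) (bdpr b) (bdvr b) (bdt b - bdtau b)
    <= (1 + C * bt b) * jac_energy xi (bp b) (bv b) (bdp b) (bdv b) (bdt b).
Proof.
have [C1 C10 h1] := oXr; have [C2 C20 h2] := oDLr.
have [C3 C30 h3] := odar; have [C5 C50 h5] := oardt.
exists (C1 + C2 + C3 + C5); first by rewrite !addr_ge0.
move=> b; rewrite -/(E b).
have e1 : `|Xr b| <= `|X b| + C1 * tE b.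
  by rewrite -{1}(subrK (X b) (Xr b)) (le_trans (ler_normD _ _)) // addrC lerD.
have e2 : `|DLr b| <= `|DL b| + C2 * tE b.
  by rewrite -{1}(subrK (DL b) (DLr b)) (le_trans (ler_normD _ _)) // addrC lerD.
have e3 : `|dar b| <= `|da b| + C3 * tE b.
  by rewrite -{1}(subrK (da b) (dar b)) (le_trans (ler_normD _ _)) // addrC lerD.
have e5 : ar b * `|bdt b - bdtau b| <= a b * `|bdt b| + C5 * tE b.
  have ar0 : 0 <= ar b by apply: le_trans (a_lb b).2; rewrite mulr_ge0 // divr_ge0 // ltW.
  rewrite -[X in X * `|_ - _|](ger0_norm ar0) -[X in X * `|bdt b|](ger0_norm (a_ge0 b)) -!normrM.
  rewrite -{1}(subrK (a b * bdt b) (ar b * _)) (le_trans (ler_normD _ _)) // addrC lerD //.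
rewrite {1}/jac_energy bnormal -/(dar b) -/(Xr b) -/(DLr b) ddvr.
have -> : (1 + (C1 + C2 + C3 + C5) * bt b) * E b
   = E b + (C1 * tE b + C2 * tE b + C3 * tE b + C5 * tE b) by rewrite /tE; ring.
rewrite {1}/E /jac_energy -/(X b) -/(DL b) -/(da b) -/(a b).
by move: e1 e2 e3 e5; lra.
Qed.

End BounceStep.

(** * The domain and the exit time *)

Section EuclideanNorm.
Variables (R : realType) (n : nat).
Local Notation V := 'rV[R]_n.
Implicit Types (x y u v : V).

Lemma dot_ge0 u : 0 <= dot u u.
Proof. by apply: sumr_ge0 => i _; rewrite -expr2 sqr_ge0. Qed.

Lemma enormE u : enorm u = Num.sqrt (dot u u).
Proof.
by rewrite /enorm big_ord1.
Qed.

Lemma enorm_ge0 m k (A : 'M[R]_(m, k)) : 0 <= enorm A.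
Proof. exact: sqrtr_ge0. Qed.

Lemma enorm_sqr u : enorm u ^+ 2 = dot u u.
Proof. by rewrite enormE sqr_sqrtr // dot_ge0. Qed.

Lemma dot_eq0 u : (dot u u == 0) = (u == 0).
Proof.
apply/idP/eqP => [|->]; last first.
  by rewrite /dot big1 // => i _; rewrite mxE mul0r.
rewrite psumr_eq0 => [/allP h|i _]; last by rewrite -expr2 sqr_ge0.
apply/rowP => j; have := h j; rewrite mem_index_enum => /(_ isT).
by rewrite mulf_eq0 orbb mxE => /eqP.
Qed.

Lemma enorm_gt0 u : u != 0 -> 0 < enorm u.
Proof. by move=> u0; rewrite enormE sqrtr_gt0 lt_neqAle dot_ge0 eq_sym dot_eq0 u0. Qed.

Lemma norm_le_enorm u : `|u| <= enorm u.
Proof.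
apply: norm_le_entries => [|j]; first exact: enorm_ge0.
rewrite -(ger0_norm (enorm_ge0 u)) -ler_sqr ?nnegrE // !real_normK ?num_real // enorm_sqr.
rewrite /dot (bigD1 j) //= -expr2 lerDl sumr_ge0 // => i _.
by rewrite -expr2 sqr_ge0.
Qed.

Lemma enormZ (k : R) u : 0 <= k -> enorm (k *: u) = k * enorm u.
Proof.
move=> k0; rewrite !enormE dotZl dotC dotZl mulrA -expr2 sqrtrM ?sqr_ge0 //.
by rewrite sqrtr_sqr ger0_norm.
Qed.

Lemma enorm_le_entries m k (A : 'M[R]_(m, k)) (b : R) : 0 <= b ->
  (forall i j, `|A i j| <= b) -> enorm A <= (m * k)%:R * b.
Proof.
move=> b0 hA; rewrite /enorm.
have bb : 0 <= (m * k)%:R * b by rewrite mulr_ge0.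
rewrite -(ger0_norm bb) -sqrtr_sqr ler_sqrt ?sqr_ge0 //.
apply: (@le_trans _ _ (\sum_(i < m) \sum_(j < k) b ^+ 2)).
  apply: ler_sum => i _; apply: ler_sum => j _.
  by rewrite -(@real_normK _ (A i j)) ?num_real // ler_sqr ?nnegrE.
rewrite !sumr_const !card_ord -mulrnA exprMn -[X in X <= _]mulr_natl mulnC.
rewrite ler_wpM2r ?sqr_ge0 // expr2 -natrM ler_nat; by case: (_ * _)%N => // q; rewrite leq_pmulr.
Qed.

Lemma bilin_hess (f : V -> R) u x : smooth f -> bilin u (hess f x) u = dd u (dd u f) x.
Proof.
move=> sf; rewrite dd_hess // /bilin; apply: eq_bigr => i _.
rewrite gradvE (ddC _ _ sf) dd_gradv; last exact: smooth_dd.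
rewrite /dot mulr_sumr; apply: eq_bigr => j _.
rewrite gradvE mxE (ddC _ _ sf) /partial !ddE; ring.
Qed.

Lemma gradv_grad (f : V -> R) x : gradv f x = grad f x.
Proof. by rewrite gradv.unlock. Qed.

End EuclideanNorm.

(** * Compactness of the closed domain and uniform constants *)

Section DomainConstants.
Variable R : realType.
Local Notation V := 'rV[R]_3.
Variables (Omega : set V) (xi : V -> R).
Hypothesis dom : strictly_convex_domain Omega xi.

Lemma closure_near (A : set V) x (e : R) : closure A x -> 0 < e ->
  exists2 y, A y & `|y - x| < e.
Proof.
move=> cx e0; have [|y [Ay ye]] := cx [set y | `|y - x| < e]; last by exists y.
by apply/nbhs_ballP; exists e => // y; rewrite -ball_normE /= distrC.
Qed.

Lemma closure_xi x : closure Omega x <-> xi x <= 0.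
Proof.
have sxi := scd_smooth dom.
split=> [cx|].
  rewrite leNgt; apply/negP => x0.
  have /nearP_norm[d d0 hd] : \forall y \near x, 0 < xi y.
    by have /cvgr_gt/(_ _ x0) := @smooth_continuous _ _ _ sxi x.
  have [y Oy /hd] := closure_near cx d0.
  by move: Oy; rewrite {1}(scd_interior dom) /= => y0; rewrite ltNge (ltW y0).
rewrite le_eqVlt => /orP[/eqP x0|x0].
  have : boundary Omega x by rewrite (scd_boundary dom).
  by case.
by apply: subset_closure; rewrite (scd_interior dom).
Qed.

Lemma OmegaE x : Omega x <-> xi x < 0.
Proof. by rewrite {1}(scd_interior dom). Qed.

Lemma closure_norm_le : exists2 B : R, 0 < B & forall x, closure Omega x -> `|x| <= B.
Proof.
have [B [_ hB]] := scd_bounded dom.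
exists (`|B| + 2) => [|x cx]; first by rewrite ltr_wpDl.
apply/ler_addgt0Pr => e e0; have [y Oy ye] := closure_near cx e0.
rewrite -[X in `|X|](subrK y) (le_trans (ler_normD _ _)) // addrC lerD //; last first.
  by rewrite distrC ltW.
apply: hB => //; rewrite (le_lt_trans (ler_norm B)) // ltrDl //.
Qed.

Lemma closure_compact : compact (closure Omega).
Proof.
apply: bounded_closed_compact; last exact: closed_closure.
have [B B0 hB] := closure_norm_le.
exists B; split => [|r Br x cx]; first by rewrite num_real.
by rewrite /= (le_trans (hB x cx)) // ltW.
Qed.

Lemma gradv_neq0 x : xi x = 0 -> gradv xi x != 0.
Proof.
move=> x0; have [d d0 hd] := scd_grad dom.
by rewrite gradv_grad; apply: hd; rewrite x0 normr0.
Qed.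

Lemma gradv_sqr_lb : exists2 g0 : R, 0 < g0 &
  forall x, xi x = 0 -> g0 <= dot (gradv xi x) (gradv xi x).
Proof.
have sxi := scd_smooth dom.
pose B := [set x | xi x = 0].
have [B0|B0] := eqVneq B set0.
  by exists 1 => // x x0; have : B x by []; rewrite B0.
have cB : compact B.
  apply: (subclosed_compact _ closure_compact); last first.
    by move=> x /= x0; apply/closure_xi; rewrite x0.
  by apply: (@preimage_closed _ _ xi [set 0]) => [x _|];
    [exact: (@smooth_continuous _ _ _ sxi x)|exact: closed_eq].
have := EVT_min_rV (_ : B !=set0) cB
  (_ : {within B, continuous (fun x => dot (gradv xi x) (gradv xi x))}).
case => [||x xB hx]; first exact/set0P.
  apply: continuous_subspaceT; rewrite /dot.
  apply: (@continuous_big R _ +%R 0 xpredT add_continuous) => i _ x.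
  have h : {for x, continuous (fun x => gradv xi x 0 i)}.
    have -> : (fun x : V => gradv xi x 0 i) = dd (delta_mx 0 i) xi.
      by apply/funext => y; rewrite gradvE.
    exact: (@smooth_continuous _ _ _ (smooth_dd _ sxi) x).
  exact: continuousM.
exists (dot (gradv xi x) (gradv xi x)) => [|y y0]; last by apply: hx; rewrite inE.
rewrite lt_neqAle dot_ge0 eq_sym dot_eq0 andbT; apply: gradv_neq0.
by rewrite inE in xB.
Qed.

Lemma domain_constants : exists M c g0 : R,
  [/\ derivative_bounds xi (closure Omega) M, 0 < c & 0 < g0] /\
  [/\ forall x, closure Omega x -> `|x| <= M / 6 /\ `|xi x| <= M,
     forall x u, closure Omega x -> c * enorm u ^+ 2 <= dd u (dd u xi) x &
     forall x, xi x = 0 -> g0 <= dot (gradv xi x) (gradv xi x)].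
Proof.
have sxi := scd_smooth dom.
have [B B0 hB] := closure_norm_le.
have [M1 M10 hM] := partials_bounded 4 sxi closure_compact.
have [c c0 hc] := scd_convex dom.
have [g0 g00 hg] := gradv_sqr_lb.
(* [81 = 3 ^ 4], since each of four directional derivatives costs a factor 3, the dimension. The
   term [6 * B] gives [|x| <= M / 6], from which Euclidean flight lengths will be at most [M]. *)
exists (81 * M1 + 6 * B), c, g0; set M := 81 * M1 + 6 * B.
have M0 : 0 <= M by rewrite addr_ge0 // mulr_ge0 // ltW.
have le_M (k : R) : k <= 81 -> k * M1 <= M.
  move=> k81; rewrite (@le_trans _ _ (81 * M1)) //; first by rewrite ler_wpM2r // ltW.
  by rewrite lerDl mulr_ge0 // ltW.
have h1 u := partials_le_dd u sxi hM.
have h2 u w := partials_le_dd w (smooth_dd u sxi) (h1 u).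
have h3 u w z := partials_le_dd z (smooth_dd w (smooth_dd u sxi)) (h2 u w).
have h4 u w z y := partials_le_dd y (smooth_dd z (smooth_dd w (smooth_dd u sxi))) (h3 u w z).
split; split => //; first split => //.
- move=> x u Kx; rewrite (le_trans (partials_le_fun (h1 u) Kx)) //.
  rewrite mulrAC ler_wpM2r // le_M //; lra.
- move=> x u w Kx; rewrite (le_trans (partials_le_fun (h2 u w) Kx)) //.
  have -> : 3 * `|w| * (3 * `|u| * M1) = 9 * M1 * (`|w| * `|u|) by ring.
  by rewrite ler_wpM2r ?mulr_ge0 // le_M //; lra.
- move=> x u w z Kx; rewrite (le_trans (partials_le_fun (h3 u w z) Kx)) //.
  have -> : 3 * `|z| * (3 * `|w| * (3 * `|u| * M1)) = 27 * M1 * (`|z| * (`|w| * `|u|)) by ring.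
  by rewrite ler_wpM2r ?mulr_ge0 // le_M //; lra.
- move=> x u w z y Kx; rewrite (le_trans (partials_le_fun (h4 u w z y) Kx)) //.
  have -> : 3 * `|y| * (3 * `|z| * (3 * `|w| * (3 * `|u| * M1)))
    = 81 * M1 * (`|y| * (`|z| * (`|w| * `|u|))) by ring.
  by rewrite ler_wpM2r ?mulr_ge0 // le_M.
- move=> x Kx; split; first by rewrite (le_trans (hB x Kx)) // /M; lra.
  rewrite (le_trans (partials_le_fun hM Kx)) // -[M1]mul1r le_M //; lra.
- by move=> x u Kx; rewrite -bilin_hess //; exact: hc.
Qed.

End DomainConstants.

(** Compactness of the segment makes a radius depending on the point uniform, because [P] passes to
    smaller radii. *)
Lemma segment_uniform (R : realType) (a b : R) (P : R -> R -> Prop) :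
  (forall d d1 s, d1 <= d -> P d s -> P d1 s) ->
  (forall s0, a <= s0 <= b -> exists2 d, 0 < d & forall s, `|s - s0| < d -> P d s) ->
  exists2 d, 0 < d & forall s, a <= s <= b -> P d s.
Proof.
move=> antiP locP.
have cov := (@compact_near_coveringP R `[a, b]%classic).1 (@segment_compact R a b).
have : \forall d \near 0^'+, `[a, b]%classic `<=` P d.
  apply: cov => s0; rewrite /= in_itv /= => sab; have [d d0 hd] := locP _ sab.
  exists ([set s | `|s - s0| < d], [set i | i < d]) => /=; first split.
  - by apply/nbhs_ballP; exists d => // s; rewrite /ball /= distrC.
  - exact: nbhs_right_lt.
  by move=> [s i] /= [sd id]; apply: (antiP d); [exact: ltW|exact: hd].
move=> [d /= d0 hd]; exists (d / 2); first by rewrite divr_gt0.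
move=> s sab; apply: (hd (d / 2)) => /=.
- by rewrite /ball /= sub0r normrN gtr0_norm ?divr_gt0 // half_lt.
- by rewrite divr_gt0.
- by rewrite in_itv.
Qed.

Section ExitTime.
Variable R : realType.
Local Notation V := 'rV[R]_3.
Implicit Types (x v u : V).

Lemma smooth_chord_near (f : V -> R) x0 v0 (s0 e : R) : smooth f -> 0 < e ->
  exists2 d : R, 0 < d & forall x v s, `|x - x0| < d -> `|v - v0| < d -> `|s - s0| < d ->
    `|f (x - s *: v) - f (x0 - s0 *: v0)| < e.
Proof.
move=> sf e0.
have /cvgr_dist_lt/(_ _ e0)/nearP_norm[r r0 hr] := @smooth_continuous _ _ _ sf (x0 - s0 *: v0).
pose k := 3 + `|v0| + `|s0|.
have k0 : 0 < k by rewrite ltr_wpDr // ltr_wpDr.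
exists (Num.min 1 (r / k)); first by rewrite lt_min ltr01 divr_gt0.
move=> x v s; rewrite !lt_min => /andP[x1 xr] /andP[v1 vr] /andP[s1 sr].
rewrite distrC; apply: hr.
have -> : x - s *: v - (x0 - s0 *: v0) = (x - x0) + ((s0 - s) *: v + s0 *: (v0 - v)).
  by apply/rowP => j; rewrite !mxE; ring.
rewrite (le_lt_trans (ler_normD _ _)) // (le_lt_trans (lerD (lexx _) (ler_normD _ _))) //.
rewrite !normrZ (distrC s0) (distrC v0).
have v2 : `|v| < `|v0| + 1.
  apply: (@le_lt_trans _ _ (`|v0| + `|v - v0|)); last by rewrite ltrD2l.
  by rewrite -{1}(subrKC v0 v) ler_normD.
have b1 : `|s - s0| * `|v| <= r / k * (`|v0| + 1) by rewrite ler_pM // ltW.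
have b2 : `|s0| * `|v - v0| <= `|s0| * (r / k) by rewrite ler_wpM2l // ltW.
apply: (@lt_le_trans _ _ (r / k + (r / k * (`|v0| + 1) + `|s0| * (r / k)))).
  by rewrite ltr_leD // lerD.
have -> : r / k + (r / k * (`|v0| + 1) + `|s0| * (r / k)) = r / k * (k - 1).
  rewrite /k; ring.
rewrite mulrAC ler_pdivrMr // ler_wpM2l ?(ltW r0) // lerBlDr lerDl //.
Qed.

Lemma smooth_dd_chord_near (f : V -> R) x0 v0 (s0 e : R) : smooth f -> 0 < e ->
  exists2 d : R, 0 < d & forall x v s, `|x - x0| < d -> `|v - v0| < d -> `|s - s0| < d ->
    `|dd v f (x - s *: v) - dd v0 f (x0 - s0 *: v0)| < e.
Proof.
move=> sf e0.
have grad_near (r : R) : 0 < r -> exists2 d : R, 0 < d & forall x v s,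
    `|x - x0| < d -> `|v - v0| < d -> `|s - s0| < d ->
    `|gradv f (x - s *: v) - gradv f (x0 - s0 *: v0)| <= r.
  move=> r0; have [d d0 hd] := fin_all_exists2
    (fun j => smooth_chord_near x0 v0 s0 (smooth_dd (delta_mx 0 j) sf) r0).
  exists (\big[Num.min/1]_j d j); first by apply/bigmin_gtP; split.
  move=> x v s hx hv hs; apply: norm_le_entries => [|j]; first exact: ltW.
  rewrite !mxE !gradvE; apply/ltW/hd.
  - exact: lt_le_trans hx (bigmin_le _ _ _).
  - exact: lt_le_trans hv (bigmin_le _ _ _).
  - exact: lt_le_trans hs (bigmin_le _ _ _).
set g0 := gradv f (x0 - s0 *: v0).
have k0 : 0 < 6 * (`|g0| + 1 + `|v0|) by rewrite mulr_gt0 // ltr_wpDr // ltr_wpDl.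
pose r := e / (6 * (`|g0| + 1 + `|v0|)).
have r0 : 0 < r by rewrite divr_gt0.
have m0 : 0 < Num.min 1 r by rewrite lt_min ltr01.
have [d d0 hd] := grad_near _ m0.
exists (Num.min d r); first by rewrite lt_min d0.
move=> x v s; rewrite !lt_min => /andP[xd _] /andP[vd vr] /andP[sd _].
have := hd x v s xd vd sd; rewrite le_min -/g0 => /andP[g1 gr].
rewrite !dd_gradv // -/g0; set g := gradv f _ in g1 gr *.
have -> : dot v g - dot v0 g0 = dot (v - v0) g + dot v0 (g - g0).
  rewrite dotBr dotDl -[- v0]scaleN1r dotZl; ring.
rewrite (le_lt_trans (ler_normD _ _)) // (le_lt_trans (lerD (dot_le _ _) (dot_le _ _))) //.
have gb : `|g| <= `|g0| + 1 by rewrite -(subrK g0 g) addrC (le_trans (ler_normD _ _)) // lerD.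
have b1 : `|v - v0| * `|g| <= r * (`|g0| + 1) by rewrite ler_pM // ltW.
have b2 : `|v0| * `|g - g0| <= r * `|v0| by rewrite mulrC ler_wpM2r.
have rE : r * (6 * (`|g0| + 1 + `|v0|)) = e by rewrite /r divfK ?gt_eqF.
clearbody r; move: b1 b2 rE; move: (`|v - v0| * _) (`|v0| * `|_ - _|) => p q b1 b2 rE.
lra.
Qed.

Lemma chord_mvt (f : V -> R) x v (a b : R) : smooth f -> a < b -> exists2 r : R, a < r < b &
  f (x - b *: v) - f (x - a *: v) = - dd v f (x - r *: v) * (b - a).
Proof.
move=> sf ab; have [|r rab e] := MVT ab (fun (r : R) _ => is_derive_chord x v r sf).
  apply: derivable_within_continuous => r _.
  by have := is_derive_chord x v r sf => ?; exact: ex_derive.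
by exists r => //; rewrite -in_itv.
Qed.

Lemma chord_mvt0 (f : V -> R) x v (s : R) : smooth f -> exists2 r : R, `|r| <= `|s| &
  f x - f (x - s *: v) = s * dd v f (x - r *: v).
Proof.
move=> sf; have [s0|s0|->] := ltgtP s 0; last by exists 0; rewrite // scale0r subr0 subrr mul0r.
  have [r /andP[r1 r2]] := chord_mvt x v sf s0; rewrite scale0r subr0 sub0r => ->.
  by exists r; [rewrite !ltr0_norm // lerN2 ltW|rewrite mulrNN mulrC].
have [r /andP[r1 r2]] := chord_mvt x v sf s0; rewrite scale0r !subr0 => h.
by exists r; [rewrite !gtr0_norm // ltW|rewrite -opprB h mulNr opprK mulrC].
Qed.

End ExitTime.

(** * The exit time: boundary value, transversality, continuity *)

Section Exit.
Variable R : realType.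
Local Notation V := 'rV[R]_3.
Variables (Omega : set V) (xi : V -> R).
Hypothesis dom : strictly_convex_domain Omega xi.
Implicit Types (x v u : V).

Let sxi := scd_smooth dom.

Definition exits x v : set R := [set tau | 0 < tau /\ ~ Omega (x - tau *: v)].

Lemma exits_nonempty x v : v != 0 -> exits x v !=set0.
Proof.
move=> v0; have [B B0 hB] := closure_norm_le dom.
have nv0 : 0 < `|v| by rewrite normr_gt0.
exists ((B + `|x| + 1) / `|v|); split; first by rewrite divr_gt0 // ltr_wpDl // addr_ge0 // ltW.
move=> /subset_closure /hB; apply/negP; rewrite -ltNge.
apply: (@lt_le_trans _ _ (`|((B + `|x| + 1) / `|v|) *: v| - `|x|)).
  rewrite normrZ normrM normfV normr_id divfK ?gt_eqF //.
  rewrite ger0_norm ?addr_ge0 // ?(ltW B0) //; lra.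
by rewrite distrC; exact: lerB_dist.
Qed.

Lemma exits_lbound x v : lbound (exits x v) 0.
Proof. by move=> s [/ltW]. Qed.

Lemma tb_ge0 x v : v != 0 -> 0 <= tb Omega x v.
Proof. by move=> v0; apply: lb_le_inf; [exact: exits_nonempty|exact: exits_lbound]. Qed.

Lemma tb_le x v (s : R) : 0 < s -> ~ Omega (x - s *: v) -> tb Omega x v <= s.
Proof.
by move=> s0 hs; apply: ge_inf; [exists 0; exact: exits_lbound|split].
Qed.

Lemma before_tb x v (s : R) : 0 < s < tb Omega x v -> Omega (x - s *: v).
Proof.
move=> /andP[s0 st]; apply: contrapT => /(tb_le s0).
by rewrite leNgt st.
Qed.

(** Points just before [tb] lie in [Omega], and exit times accumulate at [tb] from above; continuity
    of [xi] gives the two inequalities. When [tb = 0] the first comes from [x] being in the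
    closure. *)
Lemma xi_exit x v : closure Omega x -> v != 0 -> xi (x - tb Omega x v *: v) = 0.
Proof.
move=> Kx v0; apply/eqP; rewrite eq_le; apply/andP; split.
  rewrite leNgt; apply/negP => h.
  have [d d0 hd] := smooth_chord_near x v (tb Omega x v) sxi h.
  have := tb_ge0 x v0; rewrite le_eqVlt => /orP[/eqP e|tb0].
    by move: h; rewrite -e scale0r subr0 ltNge (closure_xi dom x).1.
  have [m [m0 mt md]] := gt0_common tb0 d0; pose s := tb Omega x v - m.
  have : Omega (x - s *: v) by apply: before_tb; rewrite /s subr_gt0 mt ltrBlDr ltrDl.
  move=> /(OmegaE dom); apply/negP; rewrite -leNgt.
  have := hd x v s; rewrite !subrr !normr0 => /(_ d0 d0).
  rewrite /s addrAC subrr sub0r normrN (gtr0_norm m0) => /(_ md).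
  by rewrite ltr_norml ltrBrDr addNr => /andP[+ _]; exact: ltW.
rewrite leNgt; apply/negP => h.
have nh : 0 < - xi (x - tb Omega x v *: v) by rewrite oppr_gt0.
have [d d0 hd] := smooth_chord_near x v (tb Omega x v) sxi nh.
have hasinf : has_inf (exits x v).
  by split; [exact: exits_nonempty|exists 0; exact: exits_lbound].
have [s [s0 Os] sd] := inf_adherent d0 hasinf.
have ts := tb_le s0 Os.
apply: Os; apply/(OmegaE dom).
have := hd x v s; rewrite !subrr !normr0 => /(_ d0 d0).
rewrite ger0_norm ?subr_ge0 // ltrBlDr addrC => /(_ sd).
by rewrite ltr_norml => /andP[_]; rewrite ltrBlDr addNr.
Qed.

Lemma chord_closure x v : closure Omega x -> v != 0 ->
  forall s, 0 <= s <= tb Omega x v -> closure Omega (x - s *: v).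
Proof.
move=> Kx v0 s /andP[]; rewrite le_eqVlt => /orP[/eqP <- _|s0].
  by rewrite scale0r subr0.
rewrite le_eqVlt => /orP[/eqP ->|st].
  by apply/(closure_xi dom); rewrite xi_exit.
by apply/subset_closure/before_tb; rewrite s0.
Qed.

Lemma chord_curvature_gt0 x v : closure Omega x -> v != 0 ->
  exists2 c : R, 0 < c & forall s, 0 <= s <= tb Omega x v ->
    c <= dd v (dd v xi) (x - s *: v).
Proof.
move=> Kx v0; have [C C0 hC] := scd_convex dom.
exists (C * enorm v ^+ 2); first by rewrite mulr_gt0 // exprn_gt0 // enorm_gt0.
by move=> s hs; rewrite -bilin_hess //; apply: hC; exact: chord_closure.
Qed.

(** The condition is void in the interior; on the boundary it is the complement of [gamma0]. *)
Definition nongrazing x v := xi x = 0 -> dd v xi x != 0.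

(** If [tb > 0], strict convexity along the chord, with [xi <= 0] at its start and [xi = 0] at its
    end, forces a nonzero slope at the exit. If [tb = 0], the point is on the boundary, and a
    positive [v . grad xi] would send the backward ray into [Omega] for a positive time. *)
Lemma exit_transversal x v : closure Omega x -> v != 0 -> nongrazing x v ->
  dd v xi (x - tb Omega x v *: v) < 0.
Proof.
move=> Kx v0 ng; set t := tb Omega x v.
have [c c0 hc] := chord_curvature_gt0 Kx v0.
have := tb_ge0 x v0; rewrite -/t le_eqVlt => /orP[/eqP t0|t0].
  have x0 : xi x = 0 by have := xi_exit Kx v0; rewrite -/t -t0 scale0r subr0.
  rewrite -t0 scale0r subr0 lt_neqAle ng //= leNgt; apply/negP => h.
  have [d d0 hd] := smooth_chord_near x v 0 (smooth_dd v sxi) h.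
  have [s [s0 Os] sd] : exists2 s, exits x v s & s < t + d.
    apply: inf_adherent d0 _; split; first exact: exits_nonempty.
    by exists 0; exact: exits_lbound.
  move: sd; rewrite -t0 add0r => sd.
  apply: Os; apply/(OmegaE dom); rewrite -x0 -subr_gt0.
  have [u /andP[u0 us]] := chord_mvt x v sxi s0; rewrite scale0r !subr0 => e.
  rewrite -opprB e mulNr opprK mulr_gt0 //.
  have := hd x v u; rewrite !subrr !normr0 subr0 => /(_ d0 d0).
  rewrite gtr0_norm // => /(_ (lt_trans us sd)).
  rewrite scale0r subr0 ltr_norml => /andP[+ _].
  by rewrite ltrBrDr addNr.
have [_] := convex_tangent_le (ltW t0) (fun s => is_derive_chord x v s sxi)
  (fun s => is_derive_chord1 sxi x v s) hc.
rewrite xi_exit // scale0r subr0 sub0r mulrN opprK => h.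
have : t * dd v xi (x - t *: v) < 0.
  have : 0 < c / 2 * t ^+ 2 by rewrite mulr_gt0 ?exprn_gt0 // divr_gt0.
  have := (closure_xi dom x).1 Kx; lra.
by rewrite pmulr_rlt0.
Qed.

(** By transversality [xi] is positive slightly beyond the exit point, and it stays positive there
    for nearby chords. *)
Lemma tb_lt_near x0 v0 (e : R) : closure Omega x0 -> v0 != 0 -> nongrazing x0 v0 -> 0 < e ->
  exists2 d : R, 0 < d & forall x v, `|x - x0| < d -> `|v - v0| < d ->
    tb Omega x v < tb Omega x0 v0 + e.
Proof.
move=> Kx0 v00 ng e0; set t := tb Omega x0 v0.
have t0 : 0 <= t by exact: tb_ge0.
have := exit_transversal Kx0 v00 ng; rewrite -/t -oppr_gt0 => A0.
have [d d0 hd] := smooth_chord_near x0 v0 t (smooth_dd v0 sxi) A0.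
have [m [m0 md me]] := gt0_common d0 e0.
have xr : 0 < xi (x0 - (t + m) *: v0).
  have [|r /andP[tr rm]] := @chord_mvt _ _ x0 v0 t (t + m) sxi; first by rewrite ltrDl.
  rewrite xi_exit // subr0 => ->; rewrite mulr_gt0 // ?oppr_gt0; last first.
    by rewrite addrAC subrr add0r.
  have := hd x0 v0 r; rewrite !subrr !normr0 => /(_ d0 d0).
  rewrite gtr0_norm ?subr_gt0 // ltrBlDr => /(_ (lt_trans rm _)).
  rewrite addrC ltrD2r => /(_ md).
  by rewrite ltr_norml => /andP[_]; rewrite ltrBlDr addNr.
have [d1 d10 hd1] := smooth_chord_near x0 v0 (t + m) sxi xr.
exists d1 => // x v xd vd; apply: (@le_lt_trans _ _ (t + m)); last by rewrite ltrD2l.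
apply: tb_le; first by rewrite ltr_wpDl.
move=> /(OmegaE dom); apply/negP; rewrite -leNgt.
have := hd1 x v (t + m) xd vd; rewrite subrr normr0 => /(_ d10).
by rewrite ltr_norml ltrBrDr addNr => /andP[+ _]; exact: ltW.
Qed.

(** [xi] is negative on the chord up to [t - e / 2], uniformly by compactness. The exception is
    [s = 0] when [x0] is on the boundary: there negativity for nearby chords comes from the slope
    [dd v0 xi x0 > 0] and from [xi x <= 0], not from the value of [xi] at [x0]. *)
Lemma tb_gt_near x0 v0 (e : R) : closure Omega x0 -> v0 != 0 -> 0 < e ->
  exists2 d : R, 0 < d & forall x v, closure Omega x -> v != 0 ->
    `|x - x0| < d -> `|v - v0| < d -> tb Omega x0 v0 - e < tb Omega x v.
Proof.
move=> Kx0 v00 e0; set t := tb Omega x0 v0.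
have [te|te] := ltP t e.
  by exists 1 => // x v Kx v_neq0 _ _; apply: lt_le_trans (tb_ge0 x v_neq0); rewrite subr_lt0.
have t0 : 0 < t by exact: lt_le_trans te.
pose P (d s : R) := forall x v, closure Omega x -> `|x - x0| < d -> `|v - v0| < d ->
  0 < s -> xi (x - s *: v) < 0.
have [|s0 /andP[]|d d0 hd] := @segment_uniform R 0 (t - e / 2) P.
- move=> d d1 s d1d Pd x v Kx xd vd s0.
  by apply: Pd => //; [exact: lt_le_trans xd d1d|exact: lt_le_trans vd d1d].
- move=> s00 s0t.
  have [neg|] := ltP (xi (x0 - s0 *: v0)) 0.
    have nneg : 0 < - xi (x0 - s0 *: v0) by rewrite oppr_gt0.
    have [d d0 hd] := smooth_chord_near x0 v0 s0 sxi nneg.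
    exists d => // s sd x v Kx xd vd _; have := hd x v s xd vd sd.
    by rewrite ltr_norml => /andP[_]; rewrite ltrBlDr addNr.
  move=> xi_ge0; have s00E : s0 = 0.
    apply/eqP; rewrite eq_le s00 andbT leNgt; apply/negP => s0_gt0.
    have : Omega (x0 - s0 *: v0).
      by apply: before_tb; rewrite s0_gt0 (le_lt_trans s0t) // ltrBlDr ltrDl divr_gt0.
    by move=> /(OmegaE dom); rewrite ltNge xi_ge0.
  have x00 : xi x0 = 0.
    apply/eqP; rewrite eq_le (closure_xi dom x0).1 //.
    by move: xi_ge0; rewrite s00E scale0r subr0.
  have [c c0 hc] := chord_curvature_gt0 Kx0 v00.
  have [ca _] := chord_length_lb sxi (ltW t0) x00 (xi_exit Kx0 v00) hc.
  have a0 : 0 < dd v0 xi x0.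
    rewrite -(pmulr_rgt0 _ t0) (lt_le_trans _ ca) // mulr_gt0 ?exprn_gt0 //.
    by rewrite divr_gt0.
  have [d d0 hd] := smooth_dd_chord_near x0 v0 0 sxi a0.
  exists d => // s; rewrite s00E subr0 => sd x v Kx xd vd s_gt0.
  have [r /andP[r0 rs]] := @chord_mvt _ _ x v 0 s sxi s_gt0.
  rewrite scale0r !subr0 => h.
  have : xi (x - s *: v) - xi x < 0.
    rewrite h pmulr_llt0 // oppr_lt0.
    have := hd x v r xd vd; rewrite subr0 gtr0_norm // => /(_ (lt_trans rs _)).
    rewrite gtr0_norm // in sd; move=> /(_ sd); rewrite scale0r subr0.
    by rewrite ltr_norml => /andP[+ _]; rewrite ltrBrDr addNr.
  have := (closure_xi dom x).1 Kx; lra.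
exists d => // x v Kx v_neq0 xd vd; apply: (@lt_le_trans _ _ (t - e / 2)).
  by rewrite ltrD2l ltrN2 half_lt.
apply: lb_le_inf; first exact: exits_nonempty.
move=> s [s0 Os]; rewrite leNgt; apply/negP => st; apply: Os; apply/(OmegaE dom).
by apply: hd => //; rewrite !ltW.
Qed.

Lemma tb_continuous x0 v0 (e : R) : closure Omega x0 -> v0 != 0 -> nongrazing x0 v0 -> 0 < e ->
  exists2 d : R, 0 < d & forall x v, closure Omega x -> v != 0 ->
    `|x - x0| < d -> `|v - v0| < d -> `|tb Omega x v - tb Omega x0 v0| < e.
Proof.
move=> Kx0 v00 ng e0.
have [d d0 hd] := tb_lt_near Kx0 v00 ng e0; have [d1 d10 hd1] := tb_gt_near Kx0 v00 e0.
exists (Num.min d d1); first by rewrite lt_min d0.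
move=> x v Kx vn0; rewrite !lt_min => /andP[xd xd1] /andP[vd vd1].
rewrite ltr_norml; have := hd x v xd vd; have := hd1 x v Kx vn0 xd1 vd1; lra.
Qed.

End Exit.

(** * Relative derivatives *)

Section RelativeDerivative.
Variables (R : realType) (n : nat).
Local Notation U := 'rV[R]_n.
Variables (F : set_system U) (y : U).
Context {FF : Filter F}.
Hypothesis Fy : forall d : R, 0 < d -> \forall z \near F, `|z - y| < d.

Section Orders.
Variable W : normedModType R.
Implicit Types (f g : U -> W).

Definition lito f := forall e : R, 0 < e -> \forall z \near F, `|f z| <= e * `|z - y|.
Definition bigo f := exists2 C : R, 0 <= C & \forall z \near F, `|f z| <= C * `|z - y|.
Definition small f := forall e : R, 0 < e -> \forall z \near F, `|f z| <= e.
Definition bnd f := exists2 C : R, 0 <= C & \forall z \near F, `|f z| <= C.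

Lemma lito_near f g : lito f -> (\forall z \near F, g z = f z) -> lito g.
Proof.
move=> hf fg e /hf he; apply: filterS2 fg he => z -> //.
Qed.

Lemma lito_eq f g : lito f -> (forall z, g z = f z) -> lito g.
Proof. by move=> hf fg; apply: lito_near hf _; apply: nearW. Qed.

Lemma litoD f g : lito f -> lito g -> lito (fun z => f z + g z).
Proof.
move=> hf hg e e0; have e2 : 0 < e / 2 by rewrite divr_gt0.
apply: filterS2 (hf _ e2) (hg _ e2) => z h1 h2.
by rewrite (le_trans (ler_normD _ _)) // (le_trans (lerD h1 h2)) // -mulrDl -splitr.
Qed.

Lemma litoN f : lito f -> lito (fun z => - f z).
Proof. by move=> hf e /hf; apply: filterS => z; rewrite normrN. Qed.

Lemma lito_bigo f : lito f -> bigo f.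
Proof. by move=> hf; exists 1 => //; exact: hf. Qed.

Lemma bigo_eq f g : bigo f -> (forall z, g z = f z) -> bigo g.
Proof.
by move=> [C C0 hf] fg; exists C => //; apply: filterS hf => z; rewrite fg.
Qed.

Lemma bigoD f g : bigo f -> bigo g -> bigo (fun z => f z + g z).
Proof.
move=> [C C0 hf] [D D0 hg]; exists (C + D); first exact: addr_ge0.
apply: filterS2 hf hg => z h1 h2.
by rewrite (le_trans (ler_normD _ _)) // mulrDl lerD.
Qed.

Lemma bigo_small f : bigo f -> small f.
Proof.
move=> [C C0 hf] e e0.
have d0 : 0 < e / (C + 1) by rewrite divr_gt0 // ltr_wpDl.
apply: filterS2 hf (Fy d0) => z h1 h2; rewrite (le_trans h1) //.
move: h2; rewrite ltr_pdivlMr ?ltr_wpDl // => /ltW h2.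
by rewrite (le_trans _ h2) // mulrC ler_wpM2l // lerDl.
Qed.

End Orders.

Section Products.
Variable W : normedModType R.
Implicit Types (f : U -> W) (a : U -> R).

Lemma lito_bnd a f : bnd a -> lito f -> lito (fun z => a z *: f z).
Proof.
move=> [C C0 ha] hf e e0.
have d0 : 0 < e / (C + 1) by rewrite divr_gt0 // ltr_wpDl.
apply: filterS2 ha (hf _ d0) => z h1 h2; rewrite normrZ.
apply: (@le_trans _ _ ((C + 1) * (e / (C + 1) * `|z - y|))).
  by rewrite ler_pM // (le_trans h1) // lerDl.
by rewrite mulrA mulrCA divff ?mulr1 // gt_eqF // ltr_wpDl.
Qed.

Lemma lito_bndr a f : lito a -> bnd f -> lito (fun z => a z *: f z).
Proof.
move=> ha [C C0 hf] e e0.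
have d0 : 0 < e / (C + 1) by rewrite divr_gt0 // ltr_wpDl.
apply: filterS2 (ha _ d0) hf => z h1 h2; rewrite normrZ.
apply: (@le_trans _ _ ((e / (C + 1) * `|z - y|) * (C + 1))).
  by rewrite ler_pM // (le_trans h2) // lerDl.
by rewrite mulrAC divfK // gt_eqF // ltr_wpDl.
Qed.

Lemma lito_small a f : small a -> bigo f -> lito (fun z => a z *: f z).
Proof.
move=> ha [C C0 hf] e e0.
have d0 : 0 < e / (C + 1) by rewrite divr_gt0 // ltr_wpDl.
apply: filterS2 (ha _ d0) hf => z h1 h2; rewrite normrZ.
apply: (@le_trans _ _ (e / (C + 1) * ((C + 1) * `|z - y|))).
  by rewrite ler_pM // (le_trans h2) // ler_wpM2r // lerDl.
by rewrite mulrA divfK // gt_eqF // ltr_wpDl.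
Qed.

End Products.

(** A derivative with its linear map made explicit, along a filter only known to concentrate at [y].
    Uniqueness of [L] is not part of it; it is recovered at the end from [spanning]. *)
Definition hasd (W : normedModType R) (f L : U -> W) :=
  [/\ linear L, exists2 k : R, 0 <= k & forall h, `|L h| <= k * `|h| &
      lito (fun z => f z - f y - L (z - y))].

Section HasdTheory.
Variable W : normedModType R.
Implicit Types (f g L : U -> W) (a : U -> R).

Lemma hasd_bigo f L : hasd f L -> bigo (fun z => f z - f y).
Proof.
move=> [_ [k k0 hk] hf].
have hL : bigo (fun z => L (z - y)) by exists k => //; apply: nearW => z.
by apply: bigo_eq (bigoD (lito_bigo hf) hL) _ => z; rewrite subrK.
Qed.

Lemma hasd_small f L : hasd f L -> small (fun z => f z - f y).
Proof. by move=> /hasd_bigo; exact: bigo_small. Qed.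

Lemma hasd_near f g L : hasd f L -> g y = f y -> (\forall z \near F, g z = f z) -> hasd g L.
Proof.
move=> [lL kL hf] gy gf; split => //; apply: lito_near hf _.
by apply: filterS gf => z ->; rewrite gy.
Qed.

Lemma hasd_cst (c : W) : hasd (fun=> c) (fun=> 0).
Proof.
split; first by move=> a u v; rewrite scaler0 addr0.
  by exists 0 => // h; rewrite normr0 mul0r.
move=> e e0; apply: nearW => z; rewrite !subrr normr0 mulr_ge0 // ltW //.
Qed.

Lemma hasdD f g L M : hasd f L -> hasd g M -> hasd (fun z => f z + g z) (fun h => L h + M h).
Proof.
move=> [lL [k k0 kL] hf] [lM [m m0 mM] hg]; split.
- by move=> a u v; rewrite lL lM scalerDr addrACA.
- exists (k + m) => [|h]; first exact: addr_ge0.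
  by rewrite (le_trans (ler_normD _ _)) // mulrDl lerD.
- apply: lito_eq (litoD hf hg) _ => z /=.
  by rewrite [- (f y + g y)]opprD addrACA opprD [LHS]addrACA.
Qed.

Lemma hasdN f L : hasd f L -> hasd (fun z => - f z) (fun h => - L h).
Proof.
move=> [lL [k k0 kL] hf]; split.
- by move=> a u v; rewrite lL opprD scalerN.
- by exists k => // h; rewrite normrN.
- by apply: lito_eq (litoN hf) _ => z; rewrite !opprD !opprK.
Qed.

Lemma hasdB f g L M : hasd f L -> hasd g M -> hasd (fun z => f z - g z) (fun h => L h - M h).
Proof. by move=> hf hg; apply: hasdD => //; exact: hasdN. Qed.

End HasdTheory.

Lemma hasdZ (W : normedModType R) (a : U -> R) (f : U -> W) La L : hasd a La -> hasd f L ->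
  hasd (fun z => a z *: f z) (fun h => La h *: f y + a y *: L h).
Proof.
move=> ha hf; have sa := hasd_small ha; have bf := hasd_bigo hf.
move: ha hf => [lLa [k k0 kLa] ha] [lL [m m0 mL] hf]; split.
- move=> c u v; rewrite lLa lL scalerDl !scalerDr !scalerA addrACA.
  by rewrite /GRing.scale /= [a y * c]mulrC.
- exists (k * `|f y| + `|a y| * m) => [|h]; first by rewrite addr_ge0 // mulr_ge0.
  rewrite (le_trans (ler_normD _ _)) // !normrZ mulrDl lerD //.
    by rewrite mulrAC ler_wpM2r.
  by rewrite -mulrA ler_wpM2l.
have bc (V : normedModType R) (c : V) : bnd (fun=> c : V).
  by exists `|c| => //; apply: nearW.
apply: lito_eq (litoD (litoD (lito_bndr ha (bc W (f y))) (lito_bnd (bc _ (a y)) hf))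
  (lito_small sa bf)) _ => z.
move: (a z) (a y) (La _) (f z) (f y) (L _) => A B C P Q S.
transitivity ((A - B) *: P + B *: (P - Q) - (C *: Q + B *: S)).
  by rewrite scalerBl scalerBr addrA subrK.
rewrite [(A - B - C) *: Q]scalerBl [B *: (P - Q - S)]scalerBr.
have -> : (A - B) *: P = (A - B) *: (P - Q) + (A - B) *: Q by rewrite -scalerDr subrK.
by rewrite opprD [RHS]addrC -!addrA [X in _ + (_ + X) = _]addrCA.
Qed.

Lemma hasd_id : hasd (fun z => z) (fun h => h).
Proof.
split => //; first by exists 1 => // h; rewrite mul1r.
by move=> e e0; apply: nearW => z; rewrite subrr normr0 mulr_ge0 // ltW.
Qed.

Lemma hasdM (a b La Lb : U -> R) : hasd a La -> hasd b Lb ->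
  hasd (fun z => a z * b z) (fun h => La h * b y + a y * Lb h).
Proof. exact: hasdZ. Qed.

(** The error splits into the littleo of [a], times a bounded factor, and [La (z - y)] times a
    factor that tends to 0 because [a z] tends to [a y]. *)
Lemma hasdV (a La : U -> R) : a y != 0 -> hasd a La ->
  hasd (fun z => (a z)^-1) (fun h => - La h / a y ^+ 2).
Proof.
move=> ay0 ha; have sa := hasd_small ha; have ba := hasd_bigo ha.
move: ha => [lL [k k0 kL] ha].
have n0 : 0 < `|a y| / 2 by rewrite divr_gt0 // normr_gt0.
have away : \forall z \near F, `|a y| / 2 <= `|a z|.
  apply: filterS (sa _ n0) => z h.
  have := ler_distD 0 (a y) (a z); rewrite subr0 sub0r normrN => _.
  have : `|a y| <= `|a z| + `|a z - a y|.
    by rewrite -{1}(subKr (a z) (a y)) (le_trans (ler_normB _ _)).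
  lra.
split.
- move=> c u v; rewrite lL /GRing.scale /=; ring.
- exists (k / `|a y| ^+ 2) => [|h]; first by rewrite divr_ge0 // sqr_ge0.
  by rewrite normrM normrN normfV normrX mulrAC ler_wpM2r // invr_ge0 sqr_ge0.
have bV : bnd (fun z => - (a z * a y)^-1).
  exists (`|a y| / 2 * `|a y|)^-1; first by rewrite invr_ge0 mulr_ge0 // ltW.
  apply: filterS away => z h; rewrite normrN normfV normrM lef_pV2 ?posrE ?mulr_gt0 //.
  - by rewrite ler_wpM2r.
  - by apply: lt_le_trans n0 h.
  - by rewrite normr_gt0.
  - by rewrite normr_gt0.
  - by rewrite normr_gt0.
have bL : bigo (fun z => La (z - y)).
  by exists k; [exact: k0|apply: nearW => u; exact: kL].
have sV : small (fun z => - (a z - a y) * - (a z * a y)^-1 / a y).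
  move=> e e0; have [C C0 hC] := bV.
  have d0 : 0 < e * `|a y| / (C + 1) by rewrite divr_gt0 ?mulr_gt0 ?normr_gt0 // ltr_wpDl.
  apply: filterS2 hC (sa _ d0) => z h1 h2.
  rewrite normrM normfV ler_pdivrMr ?normr_gt0 // normrM normrN.
  apply: (@le_trans _ _ (e * `|a y| / (C + 1) * (C + 1))).
    by rewrite ler_pM // (le_trans h1) // lerDl.
  by rewrite divfK // gt_eqF // ltr_wpDl.
apply: lito_near (litoD (lito_bnd bV ha) (lito_small sV bL)) _.
apply: filterS away => z h.
have az0 : a z != 0 by rewrite -normr_gt0 (lt_le_trans n0).
move: (La _) az0 ay0; rewrite /GRing.scale /=; move: (a z) (a y) => p q w p0 q0.
by field; rewrite ?p0 ?q0.
Qed.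

End RelativeDerivative.

Section SmoothLittleo.
Variables (R : realType) (m : nat).
Local Notation V := 'rV[R]_m.

Lemma smooth_littleo (f : V -> R) (x : V) (e : R) : smooth f -> 0 < e ->
  exists2 d : R, 0 < d & forall z, `|z - x| < d ->
    `|f z - f x - dd (z - x) f x| <= e * `|z - x|.
Proof.
move=> sf e0; have dfx := smooth_differentiable x sf.
have [d d0 hd] := differentiable_norm_le dfx e0.
by exists d => // z /hd; rewrite ddE deriveE.
Qed.

Lemma dd_le (f : V -> R) (x u : V) : smooth f ->
  `|dd u f x| <= m%:R * `|gradv f x| * `|u|.
Proof. by move=> sf; rewrite dd_gradv // (le_trans (dot_le _ _)) // -mulrA [`|u| * _]mulrC. Qed.

End SmoothLittleo.

Section SmoothComposition.
Variables (R : realType) (n m : nat).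
Local Notation U := 'rV[R]_n.
Local Notation V := 'rV[R]_m.
Variables (F : set_system U) (y : U).
Context {FF : Filter F}.
Hypothesis Fy : forall d : R, 0 < d -> \forall z \near F, `|z - y| < d.
Local Notation hasd := (hasd F y).

Lemma smooth_comp_lito (f : V -> R) (p : U -> V) : smooth f ->
  bigo F y (fun z => p z - p y) ->
  lito F y (fun z => f (p z) - f (p y) - dd (p z - p y) f (p y)).
Proof.
move=> sf bp e e0; have sp : small F (fun z => p z - p y) by exact: (bigo_small Fy bp).
have [C C0 hC] := bp.
have e1 : 0 < e / (C + 1) by rewrite divr_gt0 // ltr_wpDl.
have [d d0 hd] := smooth_littleo (p y) sf e1.
have d2 : 0 < d / 2 by rewrite divr_gt0.
apply: filterS2 hC (sp _ d2) => z h1 h2.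
rewrite (le_trans (hd _ _)) //.
  by rewrite (le_lt_trans h2) // half_lt.
apply: (@le_trans _ _ (e / (C + 1) * ((C + 1) * `|z - y|))).
  by rewrite ler_wpM2l ?(ltW e1) // (le_trans h1) // ler_wpM2r // lerDl.
by rewrite mulrA divfK // gt_eqF // ltr_wpDl.
Qed.

Lemma dd_lito (f : V -> R) (x : V) (q : U -> V) : smooth f -> lito F y q ->
  lito F y (fun z => dd (q z) f x).
Proof.
move=> sf hq e e0; set k := m%:R * `|gradv f x| + 1.
have k0 : 0 < k by rewrite ltr_wpDl // mulr_ge0.
have e1 : 0 < e / k by rewrite divr_gt0.
apply: filterS (hq _ e1) => z h; rewrite (le_trans (dd_le _ _ sf)) //.
apply: (@le_trans _ _ (k * (e / k * `|z - y|))).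
  by rewrite ler_pM ?mulr_ge0 // lerDl.
by rewrite mulrA mulrCA divff ?mulr1 // gt_eqF.
Qed.

Lemma hasd_comp (f : V -> R) (p Lp : U -> V) : smooth f -> hasd p Lp ->
  hasd (fun z => f (p z)) (fun h => dd (Lp h) f (p y)).
Proof.
move=> sf hp; have bp : bigo F y (fun z => p z - p y) by exact: (hasd_bigo hp).
move: hp => [lL [k k0 kL] hp]; split.
- by move=> a u w; rewrite lL dd_linear.
- exists (m%:R * `|gradv f (p y)| * k) => [|h]; first by rewrite !mulr_ge0.
  by rewrite (le_trans (dd_le _ _ sf)) // -[leRHS]mulrA ler_wpM2l // mulr_ge0.
apply: lito_eq (litoD (smooth_comp_lito sf bp) (dd_lito (p y) sf hp)) _ => z /=.
by rewrite (ddB (p z - p y) (Lp (z - y)) _ sf) addrA subrK.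
Qed.

Lemma hasd_row (f L : U -> V) :
  (forall j, hasd (fun z => f z 0 j) (fun h => L h 0 j)) -> hasd f L.
Proof.
move=> hf; split.
- move=> a u w; apply/rowP => j; rewrite !mxE; have [lL _ _] := hf j; exact: lL.
- have hb j : exists2 k : R, 0 <= k & forall h, `|L h 0 j| <= k * `|h| by have [] := hf j.
  have [k k0 hk] := fin_all_exists2 hb.
  exists (\sum_j k j) => [|h]; first by apply: sumr_ge0 => j _; exact: k0.
  apply: norm_le_entries => [|j].
    by rewrite mulr_ge0 // sumr_ge0 // => j _; exact: k0.
  rewrite (le_trans (hk j h)) // ler_wpM2r // (bigD1 j) //= lerDl sumr_ge0 //.
- move=> e e0.
  have : \forall z \near F, forall j : 'I_m,
      `|f z 0 j - f y 0 j - L (z - y) 0 j| <= e * `|z - y|.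
    apply: (@filter_forall U 'I_m (fun j z => `|f z 0 j - f y 0 j - L (z - y) 0 j|
      <= e * `|z - y|) F) => j.
    by have [_ _ h] := hf j; exact: h.
  apply: filterS => z h; apply: norm_le_entries => [|j]; first by rewrite mulr_ge0 // ltW.
  by rewrite !mxE; exact: h.
Qed.

Lemma hasd_coord (f L : U -> V) j : hasd f L -> hasd (fun z => f z 0 j) (fun h => L h 0 j).
Proof.
move=> [lL [k k0 kL] hf]; split.
- by move=> a u w; rewrite lL !mxE.
- by exists k => // h; rewrite (le_trans (entry_le_norm _ _)).
- move=> e /hf; apply: filterS => z; apply: le_trans.
  by apply: le_trans (entry_le_norm _ j); rewrite !mxE.
Qed.

Lemma hasd_gradv (f : V -> R) (p Lp : U -> V) : smooth f -> hasd p Lp ->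
  hasd (fun z => gradv f (p z)) (fun h => gradv (dd (Lp h) f) (p y)).
Proof.
move=> sf hp; apply: hasd_row => j.
have -> : (fun h => gradv (dd (Lp h) f) (p y) 0 j)
    = (fun h => dd (Lp h) (dd (delta_mx 0 j) f) (p y)).
  by apply/funext => h; rewrite gradvE (ddC _ _ sf).
have -> : (fun z => gradv f (p z) 0 j) = (fun z => dd (delta_mx 0 j) f (p z)).
  by apply/funext => z; rewrite gradvE.
by apply: hasd_comp => //; exact: smooth_dd.
Qed.

Lemma hasd_sum (I : Type) (r : seq I) (f L : I -> U -> R) :
  (forall i, hasd (f i) (L i)) ->
  hasd (fun z => \sum_(i <- r) f i z) (fun h => \sum_(i <- r) L i h).
Proof.
move=> hf; elim: r => [|i r IH].
  under eq_fun do rewrite big_nil; under [X in hasd _ X]eq_fun do rewrite big_nil.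
  exact: hasd_cst.
under eq_fun do rewrite big_cons; under [X in hasd _ X]eq_fun do rewrite big_cons.
exact: hasdD.
Qed.

Lemma hasd_dot (f g Lf Lg : U -> V) : hasd f Lf -> hasd g Lg ->
  hasd (fun z => dot (f z) (g z)) (fun h => dot (Lf h) (g y) + dot (f y) (Lg h)).
Proof.
move=> hf hg; rewrite /dot.
under [X in hasd _ X]eq_fun do rewrite -big_split /=.
by apply: hasd_sum => i; apply: hasdM => //; exact: hasd_coord.
Qed.

Lemma hasd_eqL (W : normedModType R) (f L M : U -> W) : hasd f L -> (forall h, M h = L h) ->
  hasd f M.
Proof. by move=> hf /funext ->. Qed.

End SmoothComposition.

(** * Derivatives of reflections, of hitting times and of a whole bounce *)

Section Reflection.
Variables (R : realType).
Local Notation V := 'rV[R]_3.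
Implicit Types (xi : V -> R) (x v : V).

(** Writing the reflection as [v + l grad xi] with [l] rational in scalar products avoids
    differentiating the square root of the unit normal, and makes the invariance of [v ^ grad xi]
    immediate. *)
Definition refl_coef xi x v : R := - (2 * dot v (gradv xi x) / dot (gradv xi x) (gradv xi x)).

Lemma reflect_velE xi x v : reflect_vel xi x v = v + refl_coef xi x v *: gradv xi x.
Proof.
rewrite /reflect_vel /normal -gradv_grad; set g := gradv xi x.
rewrite dotC dotZl dotC scalerA -scaleNr; congr (_ + _ *: _); rewrite /refl_coef -/g.
have -> : dot g g = enorm g * enorm g by rewrite -expr2 enorm_sqr.
by rewrite invfM; ring.
Qed.

Lemma refl_coefE xi x v : gradv xi x != 0 ->
  refl_coef xi x v * dot (gradv xi x) (gradv xi x) = 2 * - dot v (gradv xi x).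
Proof.
by move=> g0; rewrite /refl_coef mulNr divfK ?mulrN // dot_eq0.
Qed.

Lemma enorm_reflect xi x v : enorm (reflect_vel xi x v) = enorm v.
Proof.
rewrite reflect_velE; have [->|g0] := eqVneq (gradv xi x) 0; first by rewrite scaler0 addr0.
rewrite !enormE; congr Num.sqrt.
have := refl_coefE v g0; move: (refl_coef xi x v) (gradv xi x) => l g h.
rewrite !(dotDl, dotDr, dotZl, dotZr) (dotC g v).
have -> : dot v v + l * dot v g + (l * dot v g + l * (l * dot g g))
  = dot v v + l * (2 * dot v g + l * dot g g) by ring.
by rewrite h; ring.
Qed.

Lemma dd_reflect xi x v : smooth xi -> gradv xi x != 0 ->
  dd (reflect_vel xi x v) xi x = - dd v xi x.
Proof.
move=> sxi g0; rewrite reflect_velE !dd_gradv // dotDl dotZl refl_coefE //; ring.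
Qed.

Variables (n : nat) (F : set_system 'rV[R]_n) (y : 'rV[R]_n).
Context {FF : Filter F}.
Hypothesis Fy : forall d : R, 0 < d -> \forall z \near F, `|z - y| < d.
Local Notation U := 'rV[R]_n.

(* the second identity of [reflection_variation] is the derivative of
   [vr . grad xi = - v . grad xi], the first one that of [vr ^ grad xi = v ^ grad xi] *)
Definition reflection_variation xi (p v dp dv vr dvr : V) : Prop :=
  wedge dvr (gradv xi p) + wedge vr (gradv (dd dp xi) p)
    = wedge dv (gradv xi p) + wedge v (gradv (dd dp xi) p) /\
  dd dvr xi p + dd dp (dd vr xi) p = - (dd dv xi p + dd dp (dd v xi) p).

(** The derivative comes from the product and quotient rules, but its formula is kept hidden: only
    the two identities of [reflection_variation] are passed on. *)
Lemma hasd_reflect xi (P Q LP LQ : U -> V) : smooth xi -> gradv xi (P y) != 0 ->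
  hasd F y P LP -> hasd F y Q LQ ->
  exists Lr : U -> V, hasd F y (fun z => reflect_vel xi (P z) (Q z)) Lr /\
    forall h, reflection_variation xi (P y) (Q y) (LP h) (LQ h)
      (reflect_vel xi (P y) (Q y)) (Lr h).
Proof.
move=> sxi g0 hP hQ.
have hG : hasd F y (fun z => gradv xi (P z)) (fun h => gradv (dd (LP h) xi) (P y)).
  by exact: (hasd_gradv Fy sxi hP).
have gg0 : dot (gradv xi (P y)) (gradv xi (P y)) != 0 by rewrite dot_eq0.
have hGG := @hasd_dot _ _ _ _ _ FF Fy _ _ _ _ hG hG.
have hQG := @hasd_dot _ _ _ _ _ FF Fy _ _ _ _ hQ hG.
have hV := @hasdV _ _ _ _ FF Fy _ _ gg0 hGG.
have h2 : hasd F y (fun=> 2 : R) (fun=> 0) by exact: hasd_cst.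
have hc := @hasdM _ _ _ _ FF Fy _ _ _ _ h2 hQG.
have hl := @hasdN _ _ _ _ FF _ _ _ (@hasdM _ _ _ _ FF Fy _ _ _ _ hc hV).
have hr := @hasdD _ _ _ _ FF _ _ _ _ _ hQ (@hasdZ _ _ _ _ FF Fy _ _ _ _ _ hl hG).
eexists; split.
  have -> : (fun z => reflect_vel xi (P z) (Q z))
    = (fun z => Q z + (- (2 * dot (Q z) (gradv xi (P z))
    * (dot (gradv xi (P z)) (gradv xi (P z)))^-1)) *: gradv xi (P z)).
    by apply/funext => z; rewrite reflect_velE.
  exact: hr.
move=> h /=; rewrite /reflection_variation reflect_velE.
set l := - (2 * dot (Q y) _ * _).
have -> : refl_coef xi (P y) (Q y) = l by [].
have l_eq : l * dot (gradv xi (P y)) (gradv xi (P y)) = - (2 * dot (Q y) (gradv xi (P y))).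
  by rewrite /l mulNr divfK.
rewrite (ddC (LP h) _ sxi) (ddC (LP h) (Q y) sxi).
rewrite !(dd_gradv _ _ (smooth_dd _ sxi)) !(dd_gradv _ _ sxi).
set L := - ((0 * _ + _) * _ + _).
have L_eq : L * dot (gradv xi (P y)) (gradv xi (P y)) =
   - 2 * (dot (LQ h) (gradv xi (P y)) + dot (Q y) (gradv (dd (LP h) xi) (P y)))
   - l * (2 * dot (gradv xi (P y)) (gradv (dd (LP h) xi) (P y))).
  rewrite /L /l (dotC (gradv (dd (LP h) xi) (P y))).
  move: gg0; move: (dot _ _) (dot _ _) (dot _ _) (dot _ _) => x1 x2 x3 x4 x10.
  by field.
move: l_eq L_eq; move: l L (gradv xi (P y)) (gradv (dd (LP h) xi) (P y)) => l L G g l_eq L_eq.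
split.
  by apply/matrixP => j k; rewrite !mxE; ring.
rewrite !dotDl !dotZl (dotC g G).
rewrite L_eq; ring.
Qed.

(* By the mean value theorem [T z - T y] is the quotient of [f (P z - T y *: Q z)] by a
   number close to the derivative of [f] along [Q y]. *)
Lemma hasd_hit_time (f : V -> R) (P Q LP LQ : U -> V) (T : U -> R) : smooth f ->
  hasd F y P LP -> hasd F y Q LQ -> small F (fun z => T z - T y) ->
  (\forall z \near F, f (P z - T z *: Q z) = 0) -> f (P y - T y *: Q y) = 0 ->
  dd (Q y) f (P y - T y *: Q y) != 0 ->
  hasd F y T (fun h => dd (LP h - T y *: LQ h) f (P y - T y *: Q y)
    / dd (Q y) f (P y - T y *: Q y)).
Proof.
move=> sf hP hQ sT fz fy B0; set q0 := P y - T y *: Q y in fy B0 *.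
set B := dd (Q y) f q0 in B0 *; have nB : 0 < `|B| by rewrite normr_gt0.
have hT : hasd F y (fun=> T y) (fun=> 0) by exact: hasd_cst.
pose w z := P z - T y *: Q z.
have hw : hasd F y w (fun h => LP h - T y *: LQ h).
  have h := @hasdB _ _ _ _ FF _ _ _ _ _ hP (@hasdZ _ _ _ _ FF Fy _ _ _ _ _ hT hQ).
  by apply: (hasd_eqL h) => u; rewrite scale0r add0r.
have sw : small F (fun z => w z - w y) by exact: (hasd_small Fy hw).
have sQ : small F (fun z => Q z - Q y) by exact: (hasd_small Fy hQ).
have hf : hasd F y (fun z => f (w z)) (fun h => dd (LP h - T y *: LQ h) f q0).
  exact: (hasd_comp Fy sf hw).
have [C C0 hC] : bigo F y (fun z => f (w z) - f (w y)) by exact: (hasd_bigo hf).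
have mv e : 0 < e -> \forall z \near F, exists2 b, `|b - B| <= e & f (w z) = (T z - T y) * b.
  move=> e0; have [d d0 hd] := smooth_dd_chord_near q0 (Q y) 0 sf e0.
  have d2 : 0 < d / 2 by rewrite divr_gt0.
  apply: filterS2 fz (filterI (sT _ d2) (filterI (sw _ d2) (sQ _ d2))) => z fz0 [sz [wz Qz]].
  have lt_d (x : R) : x <= d / 2 -> x < d by move=> h; rewrite (le_lt_trans h) ?half_lt.
  have [r rs fE] := chord_mvt0 (w z) (Q z) (T z - T y) sf.
  exists (dd (Q z) f (w z - r *: Q z)).
    rewrite -[B]/(dd (Q y) f q0) -[in X in _ - X](subr0 q0) -(scale0r (Q y)).
    by apply/ltW/hd; rewrite ?subr0 ?lt_d // (le_trans rs).
  rewrite -fE (_ : w z - _ = P z - T z *: Q z) ?fz0 ?subr0 //.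
  by rewrite /w scalerBl opprB addrA subrK.
have [lL [k k0 hk] lf] := hf; split.
- by move=> a u v; rewrite lL /GRing.scale /=; ring.
- exists (k / `|B|) => [|h]; first by rewrite divr_ge0.
  by rewrite normrM normfV mulrAC ler_wpM2r ?invr_ge0.
move=> e e0; have C1 : 0 < C + 1 by rewrite ltr_wpDl.
have eB : 0 < e * `|B| / 2 by rewrite divr_gt0 ?mulr_gt0.
have p2 : 0 < `|B| / 2 * (e * `|B| / 2 / (C + 1)) by rewrite mulr_gt0 ?(divr_gt0 eB) // divr_gt0.
have [e1 [e10 e1B e1e]] := gt0_common (divr_gt0 nB (ltr0n R 2)) p2.
apply: filterS2 (mv _ e10) (filterI hC (lf _ eB)) => z [b bB fE] [wz lz].
have fy0 : f (w y) = 0 by exact: fy.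
move: wz lz; rewrite fy0 !subr0 fE; set X := dd _ f q0; move: (T z - T y) => sg wz lz.
have -> : sg - X / B = (sg * (B - b) + (sg * b - X)) / B by field.
rewrite normrM normfV ler_pdivrMr // (le_trans (ler_normD _ _)) //.
have -> : e * `|z - y| * `|B| = e * `|B| / 2 * `|z - y| + e * `|B| / 2 * `|z - y| by field.
rewrite lerD // normrM [`|B - b|]distrC.
have bge : `|B| / 2 <= `|b|.
  have : `|B| <= `|b| + `|b - B| by rewrite -{1}(subKr b B) (le_trans (ler_normB _ _)).
  lra.
have sC : `|sg| * (`|B| / 2) <= C * `|z - y|.
  by apply: le_trans wz; rewrite normrM ler_wpM2l.
apply: (@le_trans _ _ (`|sg| * (`|B| / 2) * (e * `|B| / 2 / (C + 1)))).
  by rewrite -mulrA ler_wpM2l // (le_trans bB) // ltW.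
apply: (@le_trans _ _ (C * `|z - y| * (e * `|B| / 2 / (C + 1)))).
  by rewrite ler_wpM2r // divr_ge0 ?ltW.
have -> : C * `|z - y| * (e * `|B| / 2 / (C + 1)) = e * `|B| / 2 * `|z - y| * (C / (C + 1)) by ring.
by rewrite ler_piMr // ?(mulr_ge0 (ltW eB)) // ler_pdivrMr // mul1r lerDl.
Qed.

Lemma hasd_bounce (Omega : set V) xi (P Q LP LQ : U -> V) (T LT : U -> R) :
  strictly_convex_domain Omega xi ->
  hasd F y P LP -> hasd F y Q LQ -> hasd F y T LT ->
  closure Omega (P y) -> Q y != 0 -> nongrazing xi (P y) (Q y) ->
  (\forall z \near F, closure Omega (P z) /\ Q z != 0) ->
  let t := tb Omega (P y) (Q y) in
  let p1 := xb Omega (P y) (Q y) in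
  exists (LP1 LQ1 : U -> V) (Lt : U -> R),
    [/\ hasd F y (fun z => xb Omega (P z) (Q z)) LP1,
        hasd F y (fun z => reflect_vel xi (xb Omega (P z) (Q z)) (Q z)) LQ1 &
        hasd F y (fun z => T z - tb Omega (P z) (Q z)) (fun h => LT h - Lt h)] /\
    forall h, [/\ LP1 h = LP h - t *: LQ h - Lt h *: Q y,
      dd (LP1 h) xi p1 = 0 &
      reflection_variation xi p1 (Q y) (LP1 h) (LQ h) (reflect_vel xi p1 (Q y)) (LQ1 h)].
Proof.
move=> dom hP hQ hT KP Q0 ng near_ok t p1; have sxi := scd_smooth dom.
have xi1 : xi p1 = 0 by exact: xi_exit.
have tr := exit_transversal dom KP Q0 ng.
have sP : small F (fun z => P z - P y) by exact: (hasd_small Fy hP).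
have sQ : small F (fun z => Q z - Q y) by exact: (hasd_small Fy hQ).
have st : small F (fun z => tb Omega (P z) (Q z) - t).
  move=> e e0; have [d d0 hd] := tb_continuous dom KP Q0 ng e0.
  have d2 : 0 < d / 2 by rewrite divr_gt0.
  have dd2 : d / 2 < d by exact: half_lt.
  near=> z.
  have [Kz Qz] : closure Omega (P z) /\ Q z != 0 by near: z.
  apply/ltW/hd => //; apply: (le_lt_trans _ dd2); near: z; [exact: sP|exact: sQ].
have ht : hasd F y (fun z => tb Omega (P z) (Q z))
    (fun h => dd (LP h - t *: LQ h) xi p1 / dd (Q y) xi p1).
  apply: (hasd_hit_time sxi hP hQ st).
  - by apply: filterS near_ok => z [Kz Qz]; exact: xi_exit.
  - exact: xi1.
  - by rewrite lt_eqF.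
set Lt := (fun h => _ / _) in ht.
have h1 := @hasdB _ _ _ _ FF _ _ _ _ _ hP (@hasdZ _ _ _ _ FF Fy _ _ _ _ _ ht hQ).
have [Lr [hr relr]] := @hasd_reflect xi (fun z => xb Omega (P z) (Q z)) Q _ LQ sxi
  (gradv_neq0 dom xi1) h1 hQ.
exists (fun h => LP h - (Lt h *: Q y + t *: LQ h)), Lr, Lt; split.
  by split => //; exact: (hasdB hT ht).
move=> h; split.
- by rewrite opprD addrA addrAC.
- rewrite opprD addrA addrAC ddB // ddZ // /Lt divfK ?subrr // lt_eqF //.
- exact: relr.
Unshelve. all: by end_near. Qed.

End Reflection.

(** * The first flight and general speeds *)

Section FirstHit.
Variables (R : realType).
Local Notation V := 'rV[R]_3.
Variables (xi : V -> R) (K : set V) (M c g0 : R).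
Hypothesis smooth_xi : smooth xi.
Hypothesis db : derivative_bounds xi K M.
Let M0 : 0 <= M := db_ge0 db.
Hypothesis c0 : 0 < c.
Hypothesis g00 : 0 < g0.

(** The counterpart of [bounce] for the first flight, which may start inside the domain or have zero
    duration; it is the normal velocity on arrival that is bounded below by the duration. *)
Record first_hit : Type := FirstHit {
  fx : V; fv : V; fdx : V; fdv : V; fvr : V; fdvr : V;
  ft : R; fdtau : R; flam : R;
  fpr := fx - ft *: fv;
  fdpr := fdx - ft *: fdv - fdtau *: fv;
  ft_ge0 : 0 <= ft;
  fv_le : `|fv| <= 1;
  fK : K fpr;
  fa_lb : c / 2 * ft <= - dd fv xi fpr;
  fa_gt0 : 0 < - dd fv xi fpr;
  fgrad : g0 <= dot (gradv xi fpr) (gradv xi fpr);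
  ftangent : dd fdpr xi fpr = 0;
  fvrE : fvr = fv + flam *: gradv xi fpr;
  flamE : flam * dot (gradv xi fpr) (gradv xi fpr) = 2 * - dd fv xi fpr;
  frefl : reflection_variation xi fpr fv fdpr fdv fvr fdvr
}.

Let a b := - dd (fv b) xi (fpr b).
Let g b := `|fdx b| / a b + `|fdv b|.
Let G b := gradv xi (fpr b).
Let one (b : first_hit) : R := 1.

Let a_le b : a b <= M.
Proof.
rewrite (le_trans (ler_norm _)) // normrN (le_trans (db_1 db _ (fK b))) //.
by rewrite ler_piMr // fv_le.
Qed.

Let odx : dominated fdx g.
Proof.
apply: (dominated_le M0) => b; apply: (@le_trans _ _ (M * (`|fdx b| / a b))).
  rewrite mulrA ler_pdivlMr ?fa_gt0 // mulrC ler_wpM2r // a_le.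
by rewrite ler_wpM2l // lerDl.
Qed.

Let odv : dominated fdv g.
Proof. by apply: dominated_le1 => b; rewrite lerDr divr_ge0 // ltW // fa_gt0. Qed.

Let ot_a : dominated ft a.
Proof.
apply: (@dominated_le _ _ _ _ _ (2 / c)) => [|b]; first by rewrite divr_ge0 // ltW.
rewrite (ger0_norm (ft_ge0 b)) -(@ler_pM2l _ (c / 2)) ?divr_gt0 //.
rewrite mulrA; have -> : c / 2 * (2 / c) = 1 by field; rewrite gt_eqF.
by rewrite mul1r fa_lb.
Qed.

Let oa : dominated a one.
Proof. by apply: (dominated_le M0) => b; rewrite mulr1 ger0_norm ?a_le // ltW // fa_gt0. Qed.

Let ot1 : dominated ft one. Proof. exact: dominated_trans ot_a oa. Qed.
Let ov : dominated fv one. Proof. by apply: dominated_le1 => b; exact: fv_le. Qed.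
Let oG : dominated G one.
Proof. by apply: (dominated_le M0) => b; rewrite mulr1; apply: (grad_le db (fK b)). Qed.

Let otdv : dominated (fun b => ft b *: fdv b) g.
Proof. by apply: dominated_eqr (dominatedZ ot1 odv) _ => b; rewrite mul1r. Qed.

Let adtau b : a b * fdtau b = - dd (fdx b - ft b *: fdv b) xi (fpr b).
Proof.
have := ftangent b; rewrite /fdpr (ddB _ (fdtau b *: fv b) _ smooth_xi) (ddZ _ _ _ smooth_xi).
rewrite /a; move: (dd _ _ _) (dd _ _ _) => p q /eqP; rewrite subr_eq0 => /eqP ->; ring.
Qed.

Let oadtau : dominated (fun b => a b * fdtau b) g.
Proof.
have [C C0 hC] := dominatedB odx otdv; exists (M * C); first exact: mulr_ge0.
by move=> b; rewrite adtau normrN (le_trans (db_1 db _ (fK b))) // -mulrA ler_wpM2l.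
Qed.

(** From [a |dtau| <= M (|dx| + t |dv|)] and [t = O(a)]: only [dx] ends up divided by the normal
    velocity. *)
Let odtau : dominated fdtau g.
Proof.
have [C C0 hC] := ot_a.
have [Ct Ct0 hCt] := ot_a.
exists (M + M * Ct); first by rewrite addr_ge0 // mulr_ge0.
move=> b; rewrite -(ler_pM2l (fa_gt0 b)) -/(a b).
have -> : a b * `|fdtau b| = `|a b * fdtau b| by rewrite normrM gtr0_norm // fa_gt0.
rewrite adtau normrN (le_trans (db_1 db _ (fK b))) //.
apply: (@le_trans _ _ (M * (`|fdx b| + Ct * a b * `|fdv b|))).
  rewrite ler_wpM2l // (le_trans (ler_normB _ _)) // lerD2l normrZ ler_wpM2r //.
have -> : a b * ((M + M * Ct) * g b) = M * `|fdx b| + M * Ct * `|fdx b| + M * (a b * `|fdv b|)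
  + M * Ct * (a b * `|fdv b|).
  have := fa_gt0 b; rewrite -/(a b) /g; move: (a b) => q q0; field; exact: lt0r_neq0.
rewrite mulrDr; have h1 : 0 <= M * Ct * `|fdx b| by rewrite !mulr_ge0.
have h2 : 0 <= M * (a b * `|fdv b|) by rewrite !mulr_ge0 // ltW // fa_gt0.
have -> : M * (Ct * a b * `|fdv b|) = M * Ct * (a b * `|fdv b|) by ring.
by move: h1 h2; lra.
Qed.

Let olam : dominated flam a.
Proof.
apply: (@dominated_div _ _ (fun b => dot (G b) (G b)) (fun=> 1) a g0) => //.
  by move=> b; rewrite mulr1 ger0_norm ?fgrad // (le_trans (ltW g00)) ?fgrad.
apply: (@dominated_le _ _ _ _ _ 2) => // b.
by rewrite mulrC flamE -/(a b) normrM !ger0_norm ?mul1r // ltW // fa_gt0.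
Qed.

Let olamdtau : dominated (fun b => flam b * fdtau b) g.
Proof.
have [C C0 hC] := olam; have [D D0 hD] := oadtau.
exists (C * D) => [|b]; first exact: mulr_ge0.
rewrite normrM (le_trans (ler_wpM2r _ (hC b))) // -mulrA -mulrA ler_wpM2l //.
by rewrite (le_trans _ (hD b)) // normrM (gtr0_norm (fa_gt0 b)).
Qed.

Let odpr : dominated fdpr g.
Proof.
have h : dominated (fun b => fdtau b *: fv b) g.
  exact: dominated_mulr1 (dominatedZ odtau ov).
exact: dominated_eq (dominatedB (dominatedB odx otdv) h) _.
Qed.

Let ovr : dominated fvr one.
Proof.
have h1 : dominated (fun b => flam b *: G b) a.
  exact: dominated_mulr1 (dominatedZ olam oG).
have h2 : dominated (fun b => flam b *: G b) one by exact: dominated_trans h1 oa.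
by apply: dominated_eq (dominatedD ov h2) _ => b; rewrite fvrE.
Qed.

Let oX : dominated (fun b => fdpr b - (- fdtau b) *: fvr b) g.
Proof.
have h : dominated (fun b => (flam b * fdtau b) *: G b) g.
  exact: dominated_mulr1 (dominatedZ olamdtau oG).
apply: dominated_eq (dominatedD (dominatedB odx otdv) h) _ => b.
rewrite /fdpr fvrE -/(G b); apply/rowP => j; rewrite !mxE.
by move: (G b 0 j) (fv b 0 j) (fdx b 0 j) (fdv b 0 j) => x1 x2 x3 x4; ring.
Qed.

Let ohess (f : first_hit -> V) h : dominated f h ->
  dominated (fun b => gradv (dd (f b) xi) (fpr b)) h.
Proof.
move=> [C C0 hC]; exists (M * C); first exact: mulr_ge0.
by move=> b; rewrite (le_trans (hess_le db _ (fK b))) // -mulrA ler_wpM2l.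
Qed.

Lemma jac_energy_first_hit : exists2 C : R, 0 <= C & forall b,
  jac_energy xi (fpr b) (fvr b) (fdpr b) (fdvr b) (- fdtau b)
    <= C * (`|fdx b| / - dd (fv b) xi (fpr b) + `|fdv b|).
Proof.
have [C1 C10 h1] := oX.
have [C2 C20 h2] : dominated
    (fun b => jac_wedge xi (fpr b) (fvr b) (fdpr b) (fdvr b) (- fdtau b)) g.
  have w1 : dominated (fun b => wedge (fdv b) (G b)) g.
    exact: dominated_mulr1 (dominated_wedge odv oG).
  have w2 : dominated (fun b => wedge (fv b) (gradv (dd (fdpr b) xi) (fpr b))) g.
    by apply: dominated_eqr (dominated_wedge ov (ohess odpr)) _ => b; rewrite mul1r.
  have w3 : dominated (fun b => fdtau b *: wedge (fvr b) (gradv (dd (fvr b) xi) (fpr b))) g.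
    apply: dominated_eqr (dominatedZ odtau (dominated_wedge ovr (ohess ovr))) _ => b.
    by rewrite /one !mulr1.
  apply: dominated_eq (dominatedD (dominatedD w1 w2) w3) _ => b.
  have [<- _] := frefl b; rewrite /jac_wedge.
  have -> : fdpr b - (- fdtau b) *: fvr b = fdtau b *: fvr b + fdpr b.
    by rewrite scaleNr opprK addrC.
  by rewrite gradv_hess_linear // wedge_linr [X in _ + X = _]addrC addrA.
have [C3 C30 h3] : dominated
    (fun b => dd (fdvr b) xi (fpr b) + dd (fdpr b) (dd (fvr b) xi) (fpr b)) g.
  have w1 : dominated (fun b => dd (fdv b) xi (fpr b)) g.
    have [C C0 hC] := odv; exists (M * C) => [|b]; first exact: mulr_ge0.
    by rewrite (le_trans (db_1 db _ (fK b))) // -mulrA ler_wpM2l.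
  have w2 : dominated (fun b => dd (fdpr b) (dd (fv b) xi) (fpr b)) g.
    have [C C0 hC] := odpr; exists (M * C) => [|b]; first exact: mulr_ge0.
    rewrite (le_trans (db_2 db _ _ (fK b))) // -mulrA ler_wpM2l // (le_trans _ (hC b)) //.
    by rewrite ler_piMr // fv_le.
  apply: dominated_eq (dominatedN (dominatedD w1 w2)) _ => b.
  by have [_ ->] := frefl b.
have [C4 C40 h4] := oadtau.
exists (C1 + C2 + C3 + C4); first by rewrite !addr_ge0.
move=> b; rewrite -/(a b) -/(g b) /jac_energy !mulrDl !lerD //.
have -> : dd (fvr b) xi (fpr b) = a b.
  rewrite fvrE dd_gradv // dotDl dotZl flamE /a dd_gradv //; ring.
by rewrite normrN (le_trans _ (h4 b)) // normrM (gtr0_norm (fa_gt0 b)).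
Qed.

End FirstHit.

Section StateEstimates.
Variables (R : realType).
Local Notation V := 'rV[R]_3.
Variables (xi : V -> R) (K : set V) (M g0 : R).
Hypothesis smooth_xi : smooth xi.
Hypothesis db : derivative_bounds xi K M.
Let M0 : 0 <= M := db_ge0 db.
Hypothesis g00 : 0 < g0.

Lemma jac_velocity_le : exists2 C : R, 0 <= C & forall p v dp dv dt,
  K p -> `|v| <= 1 -> g0 <= dot (gradv xi p) (gradv xi p) -> 0 < dd v xi p ->
  `|dv| <= C * (jac_energy xi p v dp dv dt / dd v xi p).
Proof.
(* The outer [M] bounds the gradient. Inside, the two summands bound the scalar product and 3 times
   the exterior product of [dv] with the gradient, after replacing [E] by [M * (E / a)] and [|dt|]
   by [E / a]. *)
pose C := M * (((1 + M) * M + M) + 3 * ((1 + 2 * M) * M)).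
have C0 : 0 <= C by rewrite !(mulr_ge0, addr_ge0).
exists (C / g0); first by rewrite divr_ge0 // ltW.
move=> p v dp dv dt Kp v1 gp; set a := dd v xi p => a0.
set E := jac_energy _ _ _ _ _ _.
have aM : a <= M.
  by rewrite (le_trans (ler_norm _)) // (le_trans (db_1 db _ Kp)) // ler_piMr.
pose X := dp - dt *: v; pose DL := jac_wedge xi p v dp dv dt.
pose da := dd dv xi p + dd dp (dd v xi) p.
have EE : E = `|X| + `|DL| + `|da| + a * `|dt| by [].
have adt0 : 0 <= a * `|dt| by rewrite mulr_ge0 // ltW.
have [X0 DL0 da0] : [/\ 0 <= `|X|, 0 <= `|DL| & 0 <= `|da|] by [].
have XE : `|X| <= E by rewrite EE; lra.
have DLE : `|DL| <= E by rewrite EE; lra.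
have daE : `|da| <= E by rewrite EE; lra.
have dtE : `|dt| <= E / a by rewrite ler_pdivlMr // mulrC EE; lra.
have E0 : 0 <= E by exact: le_trans XE.
have EEa : E <= M * (E / a) by rewrite mulrA ler_pdivlMr // mulrC ler_wpM2r.
have w1 : `|wedge dv (gradv xi p)| <= (1 + 2 * M) * E.
  have -> : wedge dv (gradv xi p) = DL - wedge v (gradv (dd X xi) p) by rewrite addrK.
  rewrite (le_trans (ler_normB _ _)) // mulrDl mul1r lerD // (le_trans (wedge_le _ _)) //.
  rewrite -mulrA ler_wpM2l // (@le_trans _ _ (1 * (M * `|X|))) //.
    by rewrite ler_pM //; exact: (hess_le db _ Kp).
  by rewrite mul1r ler_wpM2l.
have d1 : `|dot dv (gradv xi p)| <= (1 + M) * E + M * `|dt|.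
  have -> : dot dv (gradv xi p) = da - dd dp (dd v xi) p.
    by rewrite /da dd_gradv //; ring.
  rewrite (le_trans (ler_normB _ _)) // mulrDl mul1r -addrA lerD //.
  rewrite (le_trans (db_2 db _ _ Kp)) // -mulrDr ler_wpM2l //.
  apply: (@le_trans _ _ `|dp|); first by rewrite ler_piMr.
  have -> : dp = X + dt *: v by rewrite subrK.
  by rewrite (le_trans (ler_normD _ _)) // lerD // normrZ ler_piMr.
rewrite mulrAC ler_pdivlMr // mulrC.
apply: (@le_trans _ _ (dot (gradv xi p) (gradv xi p) * `|dv|)); first by rewrite ler_wpM2r.
rewrite (le_trans (dot_wedge_le _ _)) // /C -mulrA ler_pM //.
- by apply: (grad_le db Kp).
rewrite [leRHS]mulrDl lerD //.
  rewrite (le_trans d1) // [leRHS]mulrDl lerD //; last by rewrite ler_wpM2l.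
  by rewrite -mulrA ler_wpM2l // addr_ge0.
rewrite -mulrA ler_wpM2l // (le_trans w1) // -mulrA ler_wpM2l //.
by rewrite addr_ge0 // mulr_ge0.
Qed.

End StateEstimates.

(** * Reduction to unit speed *)

Section Scaling.
Variables (R : realType).
Local Notation V := 'rV[R]_3.
Implicit Types (xi : V -> R) (x v : V).

Lemma wedgeZl (k : R) x v : wedge (k *: x) v = k *: wedge x v.
Proof. by apply/matrixP => i j; rewrite !mxE; ring. Qed.

Lemma refl_coefZ xi x (k : R) v : refl_coef xi x (k *: v) = k * refl_coef xi x v.
Proof. by rewrite /refl_coef dotZl; ring. Qed.

Lemma reflect_velZ xi x (k : R) v : reflect_vel xi x (k *: v) = k *: reflect_vel xi x v.
Proof. by rewrite !reflect_velE refl_coefZ scalerDr scalerA. Qed.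

Lemma reflection_variationZ xi (k : R) p v dp dv vr dvr : smooth xi ->
  reflection_variation xi p v dp dv vr dvr ->
  reflection_variation xi p (k *: v) dp (k *: dv) (k *: vr) (k *: dvr).
Proof.
move=> sxi [h1 h2]; split; first by rewrite !wedgeZl -!scalerDr h1.
move: h2; rewrite !(ddC dp _ sxi) !(ddZ _ _ _ (smooth_dd dp sxi)) !(ddZ _ _ _ sxi).
move: (dd _ _ _) (dd _ _ _) (dd _ _ _) (dd _ _ _) => x1 x2 x3 x4 h.
by rewrite -!mulrDr h mulrN.
Qed.

End Scaling.

Section Estimates.
Variable R : realType.
Local Notation V := 'rV[R]_3.
Variables (Omega : set V) (xi : V -> R) (C : R).
Implicit Types x v p : V.

(** A change of the unit of time by the speed of the base trajectory. This speed is a fixed number,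
    so [dv] is merely divided by it and the variation of the speed itself is kept. *)
Definition scaled_energy p v dp dv (dt : R) : R :=
  jac_energy xi p ((enorm v)^-1 *: v) dp ((enorm v)^-1 *: dv) (enorm v * dt).

Definition bounce_estimate := forall x v dp dv dvr (dt dtau : R),
  xi x = 0 -> v != 0 -> 0 < dd v xi x ->
  let t := tb Omega x v in let p1 := xb Omega x v in
  let dpr := dp - t *: dv - dtau *: v in
  dd dp xi x = 0 -> dd dpr xi p1 = 0 ->
  reflection_variation xi p1 v dpr dv (reflect_vel xi p1 v) dvr ->
  scaled_energy p1 (reflect_vel xi p1 v) dpr dvr (dt - dtau)
    <= (1 + C * (enorm v * t)) * scaled_energy x v dp dv dt.

Definition first_hit_estimate := forall x v dx dv dvr (dtau : R),
  closure Omega x -> v != 0 -> nongrazing xi x v ->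
  let t := tb Omega x v in let p1 := xb Omega x v in
  let dpr := dx - t *: dv - dtau *: v in
  dd dpr xi p1 = 0 ->
  reflection_variation xi p1 v dpr dv (reflect_vel xi p1 v) dvr ->
  scaled_energy p1 (reflect_vel xi p1 v) dpr dvr (- dtau)
    <= C * (enorm v * `|dx| / - dd v xi p1 + `|dv| / enorm v).

End Estimates.

Section Domain.
Variable R : realType.
Local Notation V := 'rV[R]_3.
Variables (Omega : set V) (xi : V -> R).
Hypothesis dom : strictly_convex_domain Omega xi.
Variables (M c g0 : R).
Hypothesis db : derivative_bounds xi (closure Omega) M.
Hypothesis c0 : 0 < c.
Hypothesis g00 : 0 < g0.
Hypothesis size_le : forall x, closure Omega x -> `|x| <= M / 6 /\ `|xi x| <= M.
Hypothesis convex_lb : forall x u, closure Omega x -> c * enorm u ^+ 2 <= dd u (dd u xi) x.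
Hypothesis grad_lb : forall x, xi x = 0 -> g0 <= dot (gradv xi x) (gradv xi x).

Let sxi := scd_smooth dom.
Let M0 : 0 <= M := db_ge0 db.
Implicit Types (x v u p : V).

Lemma alphaE x v : alpha xi x v = dd v xi x ^+ 2 - 2 * dd v (dd v xi) x * xi x.
Proof. by rewrite /alpha -gradv_grad -dd_gradv // bilin_hess. Qed.

Section UnitChord.
Variables (x v : V).
Hypothesis Kx : closure Omega x.
Hypothesis v0 : v != 0.
Let e := enorm v.
Let u := e^-1 *: v.
Let t := tb Omega x v.
Let tau := e * t.

Lemma speed_gt0 : 0 < e. Proof. exact: enorm_gt0. Qed.

Lemma enorm_unit : enorm u = 1.
Proof. by rewrite enormZ ?invr_ge0 ?ltW ?speed_gt0 // mulVf // gt_eqF // speed_gt0. Qed.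

Lemma norm_unit_le : `|u| <= 1.
Proof. by rewrite -enorm_unit; exact: norm_le_enorm. Qed.

Lemma scale_unit (s : R) w : (e * s) *: (e^-1 *: w) = s *: w :> V.
Proof. by rewrite scalerA mulrAC divff ?mul1r // gt_eqF // speed_gt0. Qed.

Lemma tau_ge0 : 0 <= tau.
Proof. by rewrite mulr_ge0 ?(ltW speed_gt0) // (tb_ge0 dom). Qed.

Lemma unit_chord (s : R) : 0 <= s <= tau -> closure Omega (x - s *: u).
Proof.
move=> /andP[s0 st]; have -> : s *: u = (s / e) *: v by rewrite /u scalerA.
apply: (chord_closure dom) => //.
by rewrite divr_ge0 ?(ltW speed_gt0) //= ler_pdivrMr ?speed_gt0 // mulrC.
Qed.

Lemma unit_curv (s : R) : 0 <= s <= tau -> c <= dd u (dd u xi) (x - s *: u).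
Proof.
by move=> hs; have := convex_lb u (unit_chord hs); rewrite enorm_unit expr1n mulr1.
Qed.

Lemma exit_closure : closure Omega (xb Omega x v).
Proof. by apply/(closure_xi dom); rewrite xi_exit. Qed.

(** A Euclidean unit vector has sup norm at least 1/3, and the two endpoints of the chord have sup
    norm at most [M / 6]. *)
Lemma tau_le : tau <= M.
Proof.
have u3 : 1 <= 3 * `|u|.
  have : enorm u <= (1 * 3)%:R * `|u|.
    by apply: enorm_le_entries => // i j; rewrite ord1 entry_le_norm.
  by rewrite enorm_unit mul1n.
have tu : tau * `|u| <= M / 3.
  have -> : tau * `|u| = `|x - xb Omega x v|.
    by rewrite /xb subKr -/t -(scale_unit t v) -/tau -/u [RHS]normrZ (ger0_norm tau_ge0).
  rewrite (le_trans (ler_normB _ _)) //.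
  have [h1 _] := size_le Kx; have [h2 _] := size_le exit_closure.
  by rewrite (le_trans (lerD h1 h2)) //; lra.
have := tau_ge0; move: (tau) tu => s su s0.
have : s <= s * (3 * `|u|) by rewrite ler_peMr.
lra.
Qed.

Lemma unit_exit : x - tau *: u = xb Omega x v.
Proof. by rewrite scale_unit. Qed.

Hypothesis ng : nongrazing xi x v.

Lemma unit_normal_gt0 : 0 < - dd u xi (xb Omega x v).
Proof.
rewrite /u ddZ // -mulrN mulr_gt0 ?invr_gt0 ?speed_gt0 // oppr_gt0.
exact: exit_transversal.
Qed.

Lemma unit_normal_lb : c / 2 * tau <= - dd u xi (xb Omega x v).
Proof.
have [_] := convex_tangent_le tau_ge0 (fun s => is_derive_chord x u s sxi)
  (fun s => is_derive_chord1 sxi x u s) unit_curv.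
rewrite /= scale0r subr0 unit_exit (xi_exit dom Kx v0) sub0r.
have x0 := (closure_xi dom x).1 Kx.
have := tau_ge0; rewrite le_eqVlt => /orP[/eqP <- _|tau_gt0 h].
  by rewrite mulr0 ltW // unit_normal_gt0.
rewrite -(ler_pM2l tau_gt0).
have -> : tau * (c / 2 * tau) = c / 2 * tau ^+ 2 by ring.
move: h; move: (tau * - _) (c / 2 * _) => p q; lra.
Qed.

(** [alpha] at unit speed along the flight. On differentiating, the products of first and second
    derivatives of [xi] cancel, leaving only a third derivative times [xi]. *)
Let alpha_along (s : R) := dd u xi (x - s *: u) ^+ 2
  - 2 * (dd u (dd u xi) (x - s *: u) * xi (x - s *: u)).

Let alpha_along_der (s : R) : is_derive s 1 alpha_along
  (2 * (dd u (dd u (dd u xi)) (x - s *: u) * xi (x - s *: u))).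
Proof.
have h0 := is_derive_chord x u s sxi.
have h1 := is_derive_chord x u s (smooth_dd u sxi).
have h2 := is_derive_chord x u s (smooth_dd u (smooth_dd u sxi)).
rewrite /alpha_along.
have gen (A B C : R -> R) (dA dB dC : R) : is_derive s 1 A dA -> is_derive s 1 B dB ->
    is_derive s 1 C dC -> is_derive s 1 (fun r => B r ^+ 2 - 2 * (C r * A r))
      (2 * B s * dB - 2 * (dC * A s + C s * dA)).
  move=> hA hB hC; apply: is_derive_eq; rewrite /GRing.scale /=; ring.
apply: is_derive_eq (gen _ _ _ _ _ _ h0 h1 h2) _.
move: (dd u xi _) (dd u (dd u xi) _) (dd u (dd u (dd u xi)) _) (xi _) => p q r w; ring.
Qed.

Lemma alpha_unit : alpha_along 0 = alpha xi x v / e ^+ 2.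
Proof.
rewrite /alpha_along scale0r subr0 alphaE /u (ddZ _ _ _ sxi) (ddZ _ _ _ (smooth_dd _ sxi)).
rewrite (ddC v _ sxi) (ddZ _ _ _ (smooth_dd _ sxi)).
have := speed_gt0; move: (e) (dd v xi x) (dd v (dd v xi) x) (xi x) => r p q w r0.
by field; rewrite gt_eqF.
Qed.

Lemma alpha_gt0 : 0 < alpha xi x v.
Proof.
rewrite alphaE; have := (closure_xi dom x).1 Kx; rewrite le_eqVlt => /orP[/eqP x0|x0].
  by rewrite x0 mulr0 subr0 lt_neqAle sqr_ge0 eq_sym sqrf_eq0 ng.
have h : 0 < dd v (dd v xi) x.
  apply: lt_le_trans (convex_lb v Kx); rewrite mulr_gt0 // exprn_gt0 //; exact: speed_gt0.
have : 0 < dd v (dd v xi) x * - xi x by rewrite mulr_gt0 // oppr_gt0.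
have := sqr_ge0 (dd v xi x); move: (dd v xi x ^+ 2) => p p0 h1; lra.
Qed.

(** Convexity gives [alpha >= 2 c (- xi)], so the derivative of [alpha] along the flight is at most
    [M / c] times [alpha]. Gronwall over a length at most [M] loses [expR (- (M / c * M))], halved
    by the square root; at the exit [xi = 0] and [alpha] is the square of the normal velocity. *)
Lemma unit_normal_alpha :
  Num.sqrt (alpha xi x v) / e * expR (- (M / c * M) / 2) <= - dd u xi (xb Omega x v).
Proof.
have bd (s : R) : 0 <= s <= tau ->
    `|2 * (dd u (dd u (dd u xi)) (x - s *: u) * xi (x - s *: u))| <= M / c * alpha_along s.
  move=> hs; have Ks := unit_chord hs.
  have xs : xi (x - s *: u) <= 0 by exact: (closure_xi dom _).1.
  have D3 : `|dd u (dd u (dd u xi)) (x - s *: u)| <= M.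
    have u1 := norm_unit_le; rewrite (le_trans (db_3 db _ _ _ Ks)) // ler_piMr //.
    by rewrite mulr_ile1 // ?mulr_ge0 // mulr_ile1.
  have ax : 2 * c * - xi (x - s *: u) <= alpha_along s.
    rewrite /alpha_along; have := unit_curv hs; have := sqr_ge0 (dd u xi (x - s *: u)).
    move: xs; move: (dd u xi _ ^+ 2) (dd u (dd u xi) _) (xi _) => p q w w0 p0 cq.
    have : c * - w <= q * - w by rewrite ler_wpM2r // oppr_ge0.
    lra.
  rewrite !normrM (ler0_norm xs) (ger0_norm (ler0n _ 2)).
  apply: (@le_trans _ _ (2 * (M * - xi (x - s *: u)))).
    by rewrite ler_wpM2l // ler_wpM2r // oppr_ge0.
  have -> : 2 * (M * - xi (x - s *: u)) = M / c * (2 * c * - xi (x - s *: u)).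
    by field; rewrite gt_eqF.
  by rewrite ler_wpM2l // divr_ge0 // ltW.
have /andP[+ _] := gronwall_exp tau_ge0 alpha_along_der bd.
have -> : alpha_along tau = (- dd u xi (xb Omega x v)) ^+ 2.
  by rewrite /alpha_along unit_exit (xi_exit dom Kx v0) !mulr0 subr0 sqrrN.
rewrite alpha_unit => h.
have n0 := ltW unit_normal_gt0.
rewrite -ler_sqr ?nnegrE //; last first.
  by rewrite !mulr_ge0 ?expR_ge0 ?sqrtr_ge0 // invr_ge0 ltW // speed_gt0.
apply: le_trans h; rewrite !exprMn sqr_sqrtr; last exact/ltW/alpha_gt0.
rewrite exprVn ler_wpM2l //.
  by rewrite divr_ge0 ?sqr_ge0 // ltW // alpha_gt0.
rewrite -expRM_natl -mulr_natl mulrCA divff // mulr1.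
by rewrite ler_expR lerN2 ler_wpM2l ?tau_le // divr_ge0 // ltW.
Qed.

Lemma alpha_le : alpha xi x v / e ^+ 2 <= 3 * M ^+ 2.
Proof.
rewrite -alpha_unit /alpha_along scale0r subr0.
have u1 := norm_unit_le.
have h1 : `|dd u xi x| <= M by rewrite (le_trans (db_1 db _ Kx)) // ler_piMr.
have h2 : `|dd u (dd u xi) x| <= M by rewrite (le_trans (db_2 db _ _ Kx)) // ler_piMr // mulr_ile1.
have [_ h3] := size_le Kx.
have s1 : dd u xi x ^+ 2 <= M ^+ 2 by rewrite -(real_normK (num_real _)) ler_sqr ?nnegrE.
have s2 : `|dd u (dd u xi) x * xi x| <= M ^+ 2 by rewrite normrM expr2 ler_pM.
move: s1 s2; rewrite ler_norml => s1 /andP[s2 _].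
by move: s1 s2; move: (_ ^+ 2) (M ^+ 2) (_ * _) => p q r; lra.
Qed.

End UnitChord.
Section BoundaryChord.
Variables (x v : V).
Hypothesis xi0 : xi x = 0.
Hypothesis v0 : v != 0.
Hypothesis a_gt0 : 0 < dd v xi x.
Let e := enorm v.
Let u := e^-1 *: v.
Let t := tb Omega x v.
Let tau := e * t.
Let p1 := xb Omega x v.

Let Kx : closure Omega x. Proof. by apply/(closure_xi dom); rewrite xi0. Qed.
Let ng : nongrazing xi x v. Proof. by move=> _; rewrite gt_eqF. Qed.

Lemma tau_gt0 : 0 < tau.
Proof.
rewrite mulr_gt0 ?speed_gt0 // lt_neqAle (tb_ge0 dom) // andbT; apply/eqP => t0.
have := exit_transversal dom Kx v0 ng; rewrite -/t -t0 scale0r subr0 => h.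
by have := lt_trans h a_gt0; rewrite ltxx.
Qed.

Let nu := norm_unit_le v0.
Let a0 := dd u xi x.
Let a1 := - dd u xi p1.

Lemma boundary_normal_ub : a0 <= M * tau.
Proof.
have /= := chord_length_ub sxi db (tau_ge0 x v0) nu (unit_chord Kx v0) xi0.
rewrite unit_exit // => /(_ (xi_exit dom Kx v0)).
have -> : M * (enorm v * tb Omega x v) ^+ 2 = (enorm v * tb Omega x v) * (M * tau).
  by rewrite /tau /e /t; ring.
by rewrite ler_pM2l // tau_gt0.
Qed.

Lemma boundary_normal_lb : c / 2 * tau <= a0.
Proof.
have /= := (chord_length_lb sxi (tau_ge0 x v0) xi0 _ (unit_curv Kx v0)).
rewrite unit_exit // => /(_ (xi_exit dom Kx v0)) [+ _].
have -> : c / 2 * (enorm v * tb Omega x v) ^+ 2 = (enorm v * tb Omega x v) * (c / 2 * tau).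
  by rewrite /tau /e /t; ring.
by rewrite ler_pM2l // tau_gt0.
Qed.

(** [a0 - a1 <= M * tau ^+ 2], and one factor [tau] is absorbed by [a1 >= c / 2 * tau], turning an
    additive error into a multiplicative one. *)
Lemma boundary_normal_ratio : a0 <= (1 + 2 * M / c * tau) * a1.
Proof.
have /= := chord_trapezoid sxi db (tau_ge0 x v0) nu (unit_chord Kx v0) xi0.
rewrite unit_exit // => /(_ (xi_exit dom Kx v0)).
have -> : M * (enorm v * tb Omega x v) ^+ 3 = (enorm v * tb Omega x v) * (M * tau ^+ 2).
  by rewrite /tau /e /t; ring.
rewrite normrM (gtr0_norm tau_gt0) ler_pM2l ?tau_gt0 // distrC -/a1 -/u -/a0.
move=> /(le_trans (ler_norm _)); have := unit_normal_lb Kx v0 ng.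
rewrite -/u -/p1 -/a1 -/tau => h1 h2.
have : 2 * M / c * tau * (c / 2 * tau) <= 2 * M / c * tau * a1.
  by rewrite ler_wpM2l // mulr_ge0 ?tau_ge0 // divr_ge0 ?mulr_ge0 // ltW.
have -> : 2 * M / c * tau * (c / 2 * tau) = M * tau ^+ 2 by field; rewrite gt_eqF.
by lra.
Qed.

End BoundaryChord.

Let refl_dot p v : xi p = 0 ->
  refl_coef xi p v * dot (gradv xi p) (gradv xi p) = 2 * - dd v xi p.
Proof. by move=> p0; rewrite refl_coefE ?dd_gradv // (gradv_neq0 dom). Qed.

Let scaled_displacement (e : R) dp (t dtau : R) dv v : e != 0 ->
  dp - (e * t) *: (e^-1 *: dv) - (e * dtau) *: (e^-1 *: v) = dp - t *: dv - dtau *: v.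
Proof. by move=> e0; rewrite !scalerA ![e * _ / e]mulrAC divff // !mul1r. Qed.

Lemma scaled_energy_bounce : exists2 C : R, 0 <= C & bounce_estimate Omega xi C.
Proof.
have [C C0 hC] := jac_energy_bounce sxi db c0 g00.
exists C => // x v dp dv dvr dt dtau x0 v0 a0 t p1 dpr tg tgr rv.
have Kx : closure Omega x by apply/(closure_xi dom); rewrite x0.
have ng : nongrazing xi x v by move=> _; rewrite gt_eqF.
have p10 : xi p1 = 0 by exact: (xi_exit dom Kx v0).
pose e := enorm v; have e0 : e != 0 by rewrite gt_eqF // speed_gt0.
have pE : x - (e * t) *: (e^-1 *: v) = p1 by exact: unit_exit.
have dpE := scaled_displacement dp t dtau dv v e0.
have rv' := reflection_variationZ e^-1 sxi rv.
pose b := @Bounce R 3 xi (closure Omega) M c g0 x (e^-1 *: v) dp (e^-1 *: dv)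
  (e^-1 *: reflect_vel xi p1 v) (e^-1 *: dvr) (e * t) (e * dtau) (e * dt)
  (refl_coef xi p1 (e^-1 *: v)).
have := hC (b (tau_gt0 x0 v0 a0) (tau_le Kx v0) (norm_unit_le v0) (unit_chord Kx v0)
  (unit_curv Kx v0) x0 _ (grad_lb x0) _ tg _ _ _ _ _).
rewrite /bdpr /bpr /= !pE !dpE -mulrBr /scaled_energy enorm_reflect; apply => //.
- exact: grad_lb.
- by rewrite -reflect_velZ reflect_velE.
- exact: refl_dot.
- by case: rv'.
- by case: rv'.
Qed.

Lemma scaled_energy_first_hit : exists2 C : R, 0 <= C & first_hit_estimate Omega xi C.
Proof.
have [C C0 hC] := jac_energy_first_hit sxi db c0 g00.
exists C => // x v dp dv dvr dtau Kx v0 ng t p1 dpr tgr rv.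
have p10 : xi p1 = 0 by exact: (xi_exit dom Kx v0).
pose e := enorm v; have e0 : e != 0 by rewrite gt_eqF // speed_gt0.
have pE : x - (e * t) *: (e^-1 *: v) = p1 by exact: unit_exit.
have dpE := scaled_displacement dp t dtau dv v e0.
have rv' := reflection_variationZ e^-1 sxi rv.
pose b := @FirstHit R xi (closure Omega) c g0 x (e^-1 *: v) dp (e^-1 *: dv)
  (e^-1 *: reflect_vel xi p1 v) (e^-1 *: dvr) (e * t) (e * dtau)
  (refl_coef xi p1 (e^-1 *: v)).
have := hC (b (tau_ge0 x v0) (norm_unit_le v0) _ _ _ _ _ _ _ _).
rewrite /fdpr /fpr /= !pE !dpE -mulrN /scaled_energy enorm_reflect.
have -> : enorm v * `|dp| / - dd v xi p1 + `|dv| / enorm v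
   = `|dp| / - dd (e^-1 *: v) xi p1 + `|e^-1 *: dv|.
  rewrite normrZ (gtr0_norm (x := e^-1)) ?invr_gt0 ?speed_gt0 // ddZ // -mulrN invfM invrK.
  by rewrite [e * _]mulrC; congr (_ + _); rewrite -/e; ring.
apply => //.
- exact: exit_closure.
- exact: unit_normal_lb.
- exact: unit_normal_gt0.
- exact: grad_lb.
- by rewrite -reflect_velZ reflect_velE.
- exact: refl_dot.
Qed.

Lemma scaled_velocity_le : exists2 C : R, 0 <= C & forall p v dp dv (dt : R),
  xi p = 0 -> v != 0 -> 0 < dd v xi p ->
  `|dv| <= C * (enorm v * (scaled_energy xi p v dp dv dt / dd ((enorm v)^-1 *: v) xi p)).
Proof.
have [C C0 hC] := jac_velocity_le sxi db g00.
exists C => // p v dp dv dt p0 v0 a0; have e0 := speed_gt0 v0.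
have Kp : closure Omega p by apply/(closure_xi dom); rewrite p0.
have a0' : 0 < dd ((enorm v)^-1 *: v) xi p by rewrite ddZ // mulr_gt0 ?invr_gt0.
have := hC p _ dp ((enorm v)^-1 *: dv) (enorm v * dt) Kp (norm_unit_le v0) (grad_lb p0) a0'.
by rewrite normrZ gtr0_norm ?invr_gt0 // ler_pdivrMl // mulrCA.
Qed.

End Domain.

(** * Specular cycles *)

Section Cycles.
Variable R : realType.
Local Notation V := 'rV[R]_3.
Variables (Omega : set V) (xi : V -> R).
Hypothesis dom : strictly_convex_domain Omega xi.
Implicit Types (x v : V) (s t : R).
Let sxi := scd_smooth dom.

Local Notation ct t x v l := (cycle_t Omega xi t x v l).
Local Notation cx t x v l := (cycle_x Omega xi t x v l).
Local Notation cv t x v l := (cycle_v Omega xi t x v l).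

Lemma cycle_tS t x v l : ct t x v l.+1 = ct t x v l - tb Omega (cx t x v l) (cv t x v l).
Proof. by rewrite /cycle_t /cycle_x /cycle_v /=; case: specular_cycle => [[t' x'] v']. Qed.

Lemma cycle_xS t x v l : cx t x v l.+1 = xb Omega (cx t x v l) (cv t x v l).
Proof. by rewrite /cycle_x /cycle_v /=; case: specular_cycle => [[t' x'] v']. Qed.

Lemma cycle_vS t x v l :
  cv t x v l.+1 = reflect_vel xi (xb Omega (cx t x v l) (cv t x v l)) (cv t x v l).
Proof. by rewrite /cycle_x /cycle_v /=; case: specular_cycle => [[t' x'] v']. Qed.

Lemma enorm_cycle_v t x v l : enorm (cv t x v l) = enorm v.
Proof. by elim: l => //= l IH; rewrite cycle_vS enorm_reflect. Qed.

Lemma cycle_v_neq0 t x v l : v != 0 -> cv t x v l != 0.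
Proof.
move=> v0; have := enorm_gt0 v0; rewrite -(enorm_cycle_v t x v l).
by apply: contraTneq => ->; rewrite -(scale0r (0 : V)) enormZ // mul0r ltxx.
Qed.

Lemma cycle_x_closure t x v l : closure Omega x -> v != 0 -> closure Omega (cx t x v l).
Proof.
move=> Kx v0; elim: l => //= l IH.
by apply/(closure_xi dom); rewrite cycle_xS xi_exit // cycle_v_neq0.
Qed.

Lemma cycle_t_leS t x v l : v != 0 -> ct t x v l.+1 <= ct t x v l.
Proof. by move=> v0; rewrite cycle_tS gerBl (tb_ge0 dom) // cycle_v_neq0. Qed.

Lemma cycle_t_le t x v l m : v != 0 -> (l <= m)%N -> ct t x v m <= ct t x v l.
Proof.
move=> v0 /subnKC <-; elim: (m - l)%N => [|k IH]; first by rewrite addn0.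
by rewrite addnS (le_trans _ IH) // cycle_t_leS.
Qed.

(** Transversality at each exit makes the reflected velocity nongrazing, so the property propagates
    along the cycles; the sign says that the next backward flight enters the domain. *)
Lemma cycle_transversal t x v l : closure Omega x -> v != 0 -> nongrazing xi x v ->
  xi (cx t x v l.+1) = 0 /\ 0 < dd (cv t x v l.+1) xi (cx t x v l.+1).
Proof.
move=> Kx v0 ng; suff H : nongrazing xi (cx t x v l) (cv t x v l).
  have vl0 := cycle_v_neq0 t x l v0; have Kl : closure Omega (cx t x v l) by exact: cycle_x_closure.
  have x1 : xi (cx t x v l.+1) = 0 by rewrite cycle_xS; exact: xi_exit.
  split=> //; rewrite cycle_vS -cycle_xS dd_reflect ?(gradv_neq0 dom) //.
  by rewrite oppr_gt0 cycle_xS; exact: exit_transversal.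
elim: l => // l IH _.
have vl0 := cycle_v_neq0 t x l v0; have Kl : closure Omega (cx t x v l) by exact: cycle_x_closure.
have x1 : xi (cx t x v l.+1) = 0 by rewrite cycle_xS; exact: xi_exit.
rewrite cycle_vS -cycle_xS dd_reflect ?(gradv_neq0 dom) // oppr_eq0 cycle_xS.
by rewrite lt_eqF //; exact: exit_transversal.
Qed.

Section Trajectory.
Variables (s t : R) (x v : V) (l : nat).
Hypothesis v0 : v != 0.

Lemma cycle_indicE m :
  cycle_indic Omega xi s t x v m = ((ct t x v m.+1 <= s < ct t x v m)%R : bool)%:R.
Proof.
rewrite /cycle_indic indicE; congr (nat_of_bool _)%:R.
by apply/idP/idP => [/set_mem|h]; [|apply/mem_set]; rewrite /= in_itv.
Qed.

Lemma cycle_indic_lstar m : is_lstar Omega xi s t x v l ->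
  cycle_indic Omega xi s t x v m = (m == l)%:R.
Proof.
move=> /andP[h1 h2]; rewrite cycle_indicE; have [->|] := eqVneq m l; first by rewrite h1 h2.
rewrite neq_ltn => /orP[lm|lm]; last first.
  by rewrite ltNge (le_trans (cycle_t_le t x v0 lm) h1) andbF.
by rewrite leNgt (lt_le_trans h2 (cycle_t_le t x v0 lm)).
Qed.

Lemma lim_series_single (f : nat -> V) : (forall m, m != l -> f m = 0) ->
  lim (series f @ \oo) = f l.
Proof.
move=> f0; apply: cvg_lim => //; apply: cvg_near_cst; exists l.+1 => // k /= lk.
by rewrite /series /= (bigD1_seq l) ?mem_index_iota ?iota_uniq //= big1 ?addr0.
Qed.

Lemma Xcl_lstar : is_lstar Omega xi s t x v l ->
  Xcl Omega xi s t x v = cx t x v l - (ct t x v l - s) *: cv t x v l.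
Proof.
move=> hl; rewrite /Xcl lim_series_single => [|m ml].
  by rewrite cycle_indic_lstar // eqxx scale1r.
by rewrite cycle_indic_lstar // (negPf ml) scale0r.
Qed.

Lemma Vcl_lstar : is_lstar Omega xi s t x v l -> Vcl Omega xi s t x v = cv t x v l.
Proof.
move=> hl; rewrite /Vcl lim_series_single => [|m ml].
  by rewrite cycle_indic_lstar // eqxx scale1r.
by rewrite cycle_indic_lstar // (negPf ml) scale0r.
Qed.

End Trajectory.

(** No interval of the cycles contains [t], so at [s = t] both series are zero for all initial data
    with [v != 0]. *)
Lemma cl_initial t x v : v != 0 -> Xcl Omega xi t t x v = 0 /\ Vcl Omega xi t t x v = 0.
Proof.
move=> v0; have i0 l : cycle_indic Omega xi t t x v l = 0.
  rewrite cycle_indicE ltNge; have -> : ct t x v l <= t by exact: (cycle_t_le t x v0 (leq0n l)).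
  by rewrite andbF.
by split; rewrite /Xcl /Vcl (@lim_series_single 0%N) => [|m _]; rewrite i0 scale0r.
Qed.

End Cycles.

(** * All estimates under a single constant *)

Section Uniform.
Variable R : realType.
Local Notation V := 'rV[R]_3.
Implicit Types (Omega : set V) (xi : V -> R).

Record uniform_estimates Omega xi (C : R) : Prop := UniformEstimates {
  ue_gt0 : 0 < C;
  ue_bounce : bounce_estimate Omega xi C;
  ue_first_hit : first_hit_estimate Omega xi C;
  ue_velocity : forall p v dp dv (dt : R), xi p = 0 -> v != 0 -> 0 < dd v xi p ->
    dd v xi p * `|dv| <= C * enorm v ^+ 2 * scaled_energy xi p v dp dv dt;
  ue_ratio : forall x v, xi x = 0 -> v != 0 -> 0 < dd v xi x ->
    dd v xi x <= (1 + C * (enorm v * tb Omega x v)) * - dd v xi (xb Omega x v);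
  ue_normal_ub : forall x v, xi x = 0 -> v != 0 -> 0 < dd v xi x ->
    dd v xi x <= C * enorm v ^+ 2 * tb Omega x v;
  ue_normal_lb : forall x v, xi x = 0 -> v != 0 -> 0 < dd v xi x ->
    enorm v ^+ 2 * tb Omega x v <= C * dd v xi x;
  ue_alpha : forall x v, closure Omega x -> v != 0 -> nongrazing xi x v ->
    Num.sqrt (alpha xi x v) <= C * - dd v xi (xb Omega x v);
  ue_alpha_le : forall x v, closure Omega x -> v != 0 ->
    Num.sqrt (alpha xi x v) <= C * enorm v;
  ue_alpha_gt0 : forall x v, closure Omega x -> v != 0 -> nongrazing xi x v ->
    0 < alpha xi x v
}.

Lemma scaled_energy_ge0 xi p v dp dv (dt : R) : smooth xi -> 0 <= dd v xi p ->
  0 <= scaled_energy xi p v dp dv dt.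
Proof.
move=> sxi a0; rewrite /scaled_energy /jac_energy !addr_ge0 // mulr_ge0 //.
by rewrite ddZ // mulr_ge0 // invr_ge0 sqrtr_ge0.
Qed.

Lemma uniform_estimates_ex Omega xi : strictly_convex_domain Omega xi ->
  exists C : R, uniform_estimates Omega xi C.
Proof.
move=> dom; have sxi := scd_smooth dom.
have [M [c [g0 [[db c0 g00] [size_le convex grad_lb]]]]] := domain_constants dom.
have M0 := db_ge0 db.
have [C1 C10 h1] := scaled_energy_bounce dom db c0 g00 size_le convex grad_lb.
have [C2 C20 h2] := scaled_energy_first_hit dom db c0 g00 convex grad_lb.
have [C3 C30 h3] := scaled_velocity_le dom db g00 grad_lb.
pose C4 := 2 * M / c; have C40 : 0 <= C4 by rewrite divr_ge0 ?mulr_ge0 // ltW.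
pose C5 := 2 / c; have C50 : 0 <= C5 by rewrite divr_ge0 // ltW.
pose k := expR (- (M / c * M) / 2); pose C6 := k^-1.
have k0 : 0 < k := expR_gt0 _; have C60 : 0 <= C6 by rewrite invr_ge0 ltW.
pose C7 := 2 * M; have C70 : 0 <= C7 by rewrite mulr_ge0.
pose C := C1 + C2 + C3 + M + C4 + C5 + C6 + C7 + 1.
have up (D x y : R) : 0 <= y -> D <= C -> x <= D * y -> x <= C * y.
  by move=> y0 DC h; rewrite (le_trans h) // ler_wpM2r.
have C_gt0 : 0 < C by rewrite ltr_wpDl // !addr_ge0.
have [[l1 l2 l3 l4] [l5 l6 l7 l8]] :
    [/\ C1 <= C, C2 <= C, C3 <= C & M <= C] /\ [/\ C4 <= C, C5 <= C, C6 <= C & C7 <= C].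
  rewrite /C; clear h1 h2 h3 up C_gt0 C; clearbody C4 C5 C6 C7.
  by split; split; lra.
move: (C) C_gt0 up l1 l2 l3 l4 l5 l6 l7 l8 => D D0 up l1 l2 l3 l4 l5 l6 l7 l8.
exists D; split => //.
- move=> x v dp dv dvr dt dtau x0 v0 a0 t p1 dpr tg tgr rv.
  apply: le_trans (h1 _ _ _ _ _ _ _ x0 v0 a0 tg tgr rv) _.
  rewrite ler_wpM2r ?scaled_energy_ge0 ?(ltW a0) // lerD2l ler_wpM2r //.
  by rewrite mulr_ge0 ?sqrtr_ge0 // (tb_ge0 dom).
- move=> x v dx dv dvr dtau Kx v0 ng t p1 dpr tgr rv.
  apply: up l2 (h2 _ _ _ _ _ _ Kx v0 ng tgr rv).
  have tr := exit_transversal dom Kx v0 ng.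
  by rewrite addr_ge0 // divr_ge0 ?mulr_ge0 ?sqrtr_ge0 // oppr_ge0 ltW.
- move=> p v dp dv dt p0 v0 a0; rewrite -mulrA; have e0 := enorm_gt0 v0.
  apply: up l3 _; first by rewrite mulr_ge0 ?sqr_ge0 // scaled_energy_ge0 // ltW.
  have := h3 p v dp dv dt p0 v0 a0; rewrite ddZ // -(ler_pM2l a0) => /le_trans; apply.
  apply: ler_eq.
  move: a0 e0; move: (dd v xi p) (scaled_energy _ _ _ _ _ _) (enorm v) => a E e a0 e0.
  by field; rewrite !gt_eqF.
- move=> x v x0 v0 a0; have e0 := enorm_gt0 v0.
  have Kx : closure Omega x by apply/(closure_xi dom); rewrite x0.
  have ng : nongrazing xi x v by move=> _; rewrite gt_eqF.
  have tr := exit_transversal dom Kx v0 ng.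
  have := boundary_normal_ratio dom db c0 convex x0 v0 a0.
  rewrite !ddZ // -mulrN mulrCA ler_pM2l ?invr_gt0 // => /le_trans; apply.
  rewrite ler_wpM2r ?oppr_ge0 ?(ltW tr) // lerD2l ler_wpM2r //.
  by rewrite mulr_ge0 ?sqrtr_ge0 // (tb_ge0 dom).
- move=> x v x0 v0 a0; have e0 := enorm_gt0 v0; rewrite -mulrA.
  apply: up l4 _; first by rewrite mulr_ge0 ?sqr_ge0 // (tb_ge0 dom).
  have := boundary_normal_ub dom db x0 v0 a0; rewrite ddZ // ler_pdivrMl // => /le_trans.
  by apply; apply: ler_eq; ring.
- move=> x v x0 v0 a0; have e0 := enorm_gt0 v0.
  apply: (up C5 _ _ (ltW a0)) => //.
  have := boundary_normal_lb dom convex x0 v0 a0; rewrite ddZ // ler_pdivlMl // => h.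
  have : C5 * (enorm v * (c / 2 * (enorm v * tb Omega x v))) <= C5 * dd v xi x.
    by rewrite ler_wpM2l.
  apply: le_trans; apply: ler_eq.
  by rewrite /C5; field; rewrite gt_eqF.
- move=> x v Kx v0 ng; have e0 := enorm_gt0 v0.
  have tr := exit_transversal dom Kx v0 ng.
  apply: (up C6); rewrite ?oppr_ge0 ?(ltW tr) //.
  have := unit_normal_alpha dom db c0 size_le convex Kx v0 ng.
  rewrite ddZ // -[X in _ <= X]mulrN [X in _ <= X]mulrC mulrAC ler_pM2r ?invr_gt0 //.
  by rewrite /C6 ler_pdivlMl // mulrC.
- move=> x v Kx v0; have e0 := enorm_gt0 v0; apply: (up C7) => //; first exact: ltW.
  have := alpha_le dom db size_le Kx v0; rewrite ler_pdivrMr ?exprn_gt0 // => h.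
  rewrite -[C7 * _]ger0_norm ?mulr_ge0 ?(ltW e0) // -sqrtr_sqr ler_wsqrtr // (le_trans h) //.
  rewrite /C7 !exprMn; move: (sqr_ge0 M) (sqr_ge0 (enorm v)).
  by move: (M ^+ 2) (_ ^+ 2) => p q p0 q0; have := mulr_ge0 p0 q0; lra.
- move=> x v Kx v0 ng; exact: (alpha_gt0 dom c0 convex Kx v0 ng).
Qed.

End Uniform.

(** * Variation of the specular flow over many bounces *)

Section Variation.
Variable R : realType.
Local Notation V := 'rV[R]_3.
Variables (Omega : set V) (xi : V -> R) (C : R).
Hypothesis dom : strictly_convex_domain Omega xi.
Hypothesis ue : uniform_estimates Omega xi C.
Implicit Types (x v : V) (s t : R).
Let sxi := scd_smooth dom.

Local Notation ct t x v l := (cycle_t Omega xi t x v l).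
Local Notation cx t x v l := (cycle_x Omega xi t x v l).
Local Notation cv t x v l := (cycle_v Omega xi t x v l).
Local Notation growth t x v l := (expR (C * (enorm v * (ct t x v 1 - ct t x v l)))).

Let C0 : 0 < C := ue_gt0 ue.

(** [1 + r <= expR r], and the durations telescope. The exponent starts at the first bounce because
    the first flight has its own estimate. *)
Lemma growthS t x v l : (1 + C * (enorm v * tb Omega (cx t x v l) (cv t x v l))) * growth t x v l
  <= growth t x v l.+1.
Proof.
rewrite (cycle_tS Omega xi t x v l); move: (tb _ _ _) (ct t x v l) (ct t x v 1) => r p q.
have -> : C * (enorm v * (q - (p - r))) = C * (enorm v * r) + C * (enorm v * (q - p)) by ring.
by rewrite expRD ler_wpM2r ?expR_ge0 // expR_ge1Dx.
Qed.

Lemma cycle_normal_ratio t x v l : closure Omega x -> v != 0 -> nongrazing xi x v ->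
  - dd v xi (xb Omega x v) <= growth t x v l.+1 * dd (cv t x v l.+1) xi (cx t x v l.+1).
Proof.
move=> Kx v0 ng; elim: l => [|l IH].
  rewrite subrr !mulr0 expR0 mul1r cycle_vS -cycle_xS dd_reflect ?(gradv_neq0 dom) //.
  by rewrite cycle_xS xi_exit.
have [x0 a0] := cycle_transversal dom t l Kx v0 ng.
have v10 := cycle_v_neq0 Omega xi t x l.+1 v0.
have := ue_ratio ue x0 v10 a0; rewrite enorm_cycle_v -cycle_xS => h.
have [x2 a2] := cycle_transversal dom t l.+1 Kx v0 ng.
have -> : dd (cv t x v l.+2) xi (cx t x v l.+2) = - dd (cv t x v l.+1) xi (cx t x v l.+2).
  by rewrite cycle_vS -cycle_xS dd_reflect ?(gradv_neq0 dom).
apply: (le_trans IH); apply: (@le_trans _ _ (growth t x v l.+1 *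
  ((1 + C * (enorm v * tb Omega (cx t x v l.+1) (cv t x v l.+1)))
   * - dd (cv t x v l.+1) xi (cx t x v l.+2)))).
  by rewrite ler_wpM2l ?expR_ge0.
rewrite mulrA [growth _ _ _ _ * _]mulrC ler_wpM2r ?growthS //.
rewrite -dd_reflect ?(gradv_neq0 dom) //.
have : cv t x v l.+2 = reflect_vel xi (cx t x v l.+2) (cv t x v l.+1).
  by rewrite cycle_vS -cycle_xS.
by move=> <-; exact: ltW.
Qed.

Lemma growth_le s t x v l : v != 0 -> s <= ct t x v l ->
  growth t x v l <= expR (C * (enorm v * (t - s))).
Proof.
move=> v0 sl; rewrite ler_expR ler_wpM2l ?(ltW C0) // ler_wpM2l ?sqrtr_ge0 //.
by rewrite lerB // (cycle_t_le dom t x v0 (leq0n 1)).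
Qed.

(* If no cycle reached the time [s], the normal velocities, hence the durations
   of the flights, would stay bounded from below. *)
Lemma lstar_ex s t x v : closure Omega x -> v != 0 -> nongrazing xi x v -> s < t ->
  exists l, is_lstar Omega xi s t x v l.
Proof.
move=> Kx v0 ng st; have e0 := enorm_gt0 v0.
suff [l hl] : exists l, ct t x v l.+1 <= s.
  have ex : exists l, ct t x v l.+1 <= s by exists l.
  have := find_ex_minn ex => -[m hm hmin]; exists m; rewrite /is_lstar hm /=.
  case: m hm hmin => [|m] _ hmin //; rewrite ltNge; apply/negP => /hmin.
  by rewrite ltnn.
apply: contrapT => H; have sl l : s < ct t x v l.
  by case: l => [|l] //; rewrite ltNge; apply/negP => h; apply: H; exists l.
pose a := - dd v xi (xb Omega x v).
have a0 : 0 < a by rewrite oppr_gt0; exact: exit_transversal.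
pose k := expR (C * (enorm v * (t - s))) * (C * enorm v ^+ 2).
have k0 : 0 < k by rewrite !mulr_gt0 ?expR_gt0 // exprn_gt0.
have step l : ct t x v l.+2 <= ct t x v l.+1 - a / k.
  have [x0 al] := cycle_transversal dom t l Kx v0 ng.
  rewrite [leLHS]cycle_tS lerB // ler_pdivrMr //.
  apply: le_trans (cycle_normal_ratio t l Kx v0 ng) _.
  rewrite [leRHS]mulrC /k -mulrA ler_pM ?expR_ge0 ?(ltW al) ?growth_le ?(ltW (sl _)) //.
  by have := ue_normal_ub ue x0 (cycle_v_neq0 _ _ _ _ _ v0) al; rewrite enorm_cycle_v.
have all l : ct t x v l.+1 <= t - l%:R * (a / k).
  elim: l => [|l IH]; first by rewrite mul0r subr0; exact: (cycle_t_le dom t x v0 (leq0n 1)).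
  rewrite (le_trans (step l)) // -natr1 mulrDl mul1r opprD addrA lerD2r //.
have ak0 : 0 < a / k by rewrite divr_gt0.
have [m hm] : exists m : nat, (t - s) / (a / k) < m%:R.
  by exists (Num.trunc ((t - s) / (a / k))).+1; rewrite truncnS_gt.
have : ct t x v m.+1 < s.
  apply: le_lt_trans (all m) _; move: hm; rewrite ltr_pdivrMr // => h.
  by rewrite ltrBlDr addrC -ltrBlDr.
by rewrite ltNge (ltW (sl _)).
Qed.

Section Family.
Variables (n : nat) (F : set_system 'rV[R]_n) (y : 'rV[R]_n).
Context {FF : Filter F}.
Hypothesis Fy : forall d : R, 0 < d -> \forall z \near F, `|z - y| < d.
Local Notation U := 'rV[R]_n.
Variables (P Q LP LQ : U -> V) (s t : R).
Hypothesis hP : hasd F y P LP.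
Hypothesis hQ : hasd F y Q LQ.
Hypothesis Ky : closure Omega (P y).
Hypothesis Q0 : Q y != 0.
Hypothesis ng : nongrazing xi (P y) (Q y).
Hypothesis near_ok : \forall z \near F, closure Omega (P z) /\ Q z != 0.

Let X l z := cx t (P z) (Q z) l.
Let W l z := cv t (P z) (Q z) l.
Let T l z := ct t (P z) (Q z) l.
Let e := enorm (Q y).
Let A := Num.sqrt (alpha xi (P y) (Q y)).
(** Large enough for all the inequalities of [K_ge]. It serves both as prefactor and as rate in the
    exponential. *)
Let K := 2 * (1 + C) ^+ 4.
(** The size of the initial variation. Varying [x] alone gives [e / A] times [|h|], varying [v]
    alone gives [1 / e] times [|h|]; with the extra factor [e ^+ 2 / A] for velocities these are the
    four bounds of the theorem. *)
Let D h := e * `|LP h| / A + `|LQ h| / e.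
Let a1 := - dd (Q y) xi (xb Omega (P y) (Q y)).

Let near_cycle l : \forall z \near F, closure Omega (X l z) /\ W l z != 0.
Proof.
apply: filterS near_ok => z [Kz Qz].
by split; [exact: cycle_x_closure|exact: cycle_v_neq0].
Qed.

(** The induction starts at the first bounce, since the energy is estimated at boundary points.
    Tangency of the position variation is carried along because the estimate of the next bounce
    assumes it. *)
Lemma cycle_variation l : exists (LX LV : U -> V) (LT : U -> R),
  [/\ hasd F y (X l.+1) LX, hasd F y (W l.+1) LV & hasd F y (T l.+1) LT] /\
  forall h, dd (LX h) xi (X l.+1 y) = 0 /\
    scaled_energy xi (X l.+1 y) (W l.+1 y) (LX h) (LV h) (LT h)
      <= growth t (P y) (Q y) l.+1 * (C * (e * `|LP h| / a1 + `|LQ h| / e)).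
Proof.
elim: l => [|l [LX [LV [LT [[hX hW hT] hE]]]]].
  have hT : hasd F y (fun=> t) (fun=> 0) by exact: hasd_cst.
  have [LX [LV [Lt [[h1 h2 h3] h4]]]] := hasd_bounce Fy dom hP hQ hT Ky Q0 ng near_ok.
  exists LX, LV, (fun h => - Lt h); split.
    by split => //; apply: hasd_eqL h3 _ => h; rewrite sub0r.
  move=> h; have [LXE tg rv] := h4 h; split => //.
  rewrite subrr !mulr0 expR0 mul1r.
  move: rv tg; rewrite LXE => rv tg.
  exact: (ue_first_hit ue Ky Q0 ng tg rv).
have Kl : closure Omega (X l.+1 y) by exact: cycle_x_closure.
have Wl0 : W l.+1 y != 0 by exact: cycle_v_neq0.
have [xl al] := cycle_transversal dom t l Ky Q0 ng.
have ngl : nongrazing xi (X l.+1 y) (W l.+1 y) by move=> _; rewrite gt_eqF.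
have [LX1 [LV1 [Lt [[h1 h2 h3] h4]]]] := hasd_bounce Fy dom hX hW hT Kl Wl0 ngl (near_cycle l.+1).
have XE : (fun z => xb Omega (X l.+1 z) (W l.+1 z)) = X l.+2.
  by apply/funext => z; exact/esym/cycle_xS.
have WE : (fun z => reflect_vel xi (xb Omega (X l.+1 z) (W l.+1 z)) (W l.+1 z)) = W l.+2.
  by apply/funext => z; exact/esym/cycle_vS.
have TE : (fun z => T l.+1 z - tb Omega (X l.+1 z) (W l.+1 z)) = T l.+2.
  by apply/funext => z; exact/esym/cycle_tS.
rewrite XE WE TE in h1 h2 h3.
exists LX1, LV1, (fun h => LT h - Lt h); split => // h.
have [LXE tg rv] := h4 h; have [tgl El] := hE h.
have XE1 : X l.+2 y = xb Omega (X l.+1 y) (W l.+1 y) by rewrite -XE.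
have WE1 : W l.+2 y = reflect_vel xi (xb Omega (X l.+1 y) (W l.+1 y)) (W l.+1 y) by rewrite -WE.
split; first by rewrite XE1.
rewrite XE1 WE1; move: rv tg; rewrite LXE => rv tg.
apply: le_trans (ue_bounce ue _ xl Wl0 al tgl tg rv) _.
apply: (@le_trans _ _ ((1 + C * (e * tb Omega (X l.+1 y) (W l.+1 y)))
  * (growth t (P y) (Q y) l.+1 * (C * (e * `|LP h| / a1 + `|LQ h| / e))))).
  rewrite /W enorm_cycle_v ler_wpM2l // addr_ge0 // mulr_ge0 ?(ltW C0) //.
  by rewrite mulr_ge0 ?sqrtr_ge0 // (tb_ge0 dom).
have a10 : 0 < a1 by rewrite oppr_gt0; exact: exit_transversal.
rewrite mulrA ler_wpM2r ?growthS //.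
by rewrite mulr_ge0 ?(ltW C0) // addr_ge0 // divr_ge0 ?mulr_ge0 ?sqrtr_ge0 // ltW.
Qed.

Let e0 : 0 < e. Proof. exact: enorm_gt0. Qed.
Let A0 : 0 < A. Proof. by rewrite sqrtr_gt0 (ue_alpha_gt0 ue). Qed.
Let D0 h : 0 <= D h.
Proof. by rewrite addr_ge0 // divr_ge0 ?mulr_ge0 // ltW. Qed.

Let hasd_cycle m : exists (LX LV : U -> V) (LT : U -> R),
  [/\ hasd F y (X m) LX, hasd F y (W m) LV & hasd F y (T m) LT].
Proof.
case: m => [|m]; last first.
  have [LX [LV [LT [h _]]]] := cycle_variation m.
  by exists LX, LV, LT.
by exists LP, LQ, (fun=> 0); split => //; exact: hasd_cst.
Qed.

Let K_ge : [/\ 1 <= K, C <= K, C * (C + 1) * (1 + C ^+ 2) <= K, C ^+ 3 * (C + 1) <= K & 2 * C <= K].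
Proof.
rewrite /K; have := C0; move: (C) => c c0.
have c2 := exprn_gt0 2 c0; have c3 := exprn_gt0 3 c0; have c4 := exprn_gt0 4 c0.
have -> : 2 * (1 + c) ^+ 4 = 2 + 8 * c + 12 * c ^+ 2 + 8 * c ^+ 3 + 2 * c ^+ 4 by ring.
have -> : c * (c + 1) * (1 + c ^+ 2) = c + c ^+ 2 + c ^+ 3 + c ^+ 4 by ring.
have -> : c ^+ 3 * (c + 1) = c ^+ 3 + c ^+ 4 by ring.
by split; lra.
Qed.

Section LastCycle.
Variable l : nat.
Hypothesis lstar_lt : ct t (P y) (Q y) l.+1 < s < ct t (P y) (Q y) l.

(** Both inequalities in [lstar_lt] are strict and the bounce times are continuous along [F], so the
    index of the current flight is locally constant and the flow is given by one formula near
    [y]. *)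
Let lstar_near : \forall z \near F, is_lstar Omega xi s t (P z) (Q z) l.
Proof.
have [_ [_ [LT0 [_ _ hT0]]]] := hasd_cycle l.
have [_ [_ [LT1 [_ _ hT1]]]] := hasd_cycle l.+1.
move: lstar_lt; rewrite -/(T l y) -/(T l.+1 y) => /andP[h1 h2].
have d1 : 0 < (s - T l.+1 y) / 2 by rewrite divr_gt0 // subr_gt0.
have d0 : 0 < (T l y - s) / 2 by rewrite divr_gt0 // subr_gt0.
apply: filterS2 (hasd_small Fy hT0 d0) (hasd_small Fy hT1 d1) => z.
rewrite /is_lstar -/(T l z) -/(T l.+1 z) !ler_norml => /andP[p1 _] /andP[_ p2].
apply/andP; split; lra.
Qed.

Let flow_eq z : is_lstar Omega xi s t (P z) (Q z) l -> Q z != 0 ->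
  Xcl Omega xi s t (P z) (Q z) = X l z - (T l z - s) *: W l z /\
  Vcl Omega xi s t (P z) (Q z) = W l z.
Proof. by move=> hl Qz; split; [exact: Xcl_lstar|exact: Vcl_lstar]. Qed.

Let hasd_flow LX LV LT : hasd F y (X l) LX -> hasd F y (W l) LV -> hasd F y (T l) LT ->
  hasd F y (fun z => Xcl Omega xi s t (P z) (Q z))
    (fun h => LX h - LT h *: W l y - (T l y - s) *: LV h) /\
  hasd F y (fun z => Vcl Omega xi s t (P z) (Q z)) LV.
Proof.
move=> hX hW hT.
have hy : is_lstar Omega xi s t (P y) (Q y) l.
  by move: lstar_lt => /andP[h1 h2]; rewrite /is_lstar ltW.
have [yX yV] := flow_eq hy Q0.
have nr : \forall z \near F,
    Xcl Omega xi s t (P z) (Q z) = X l z - (T l z - s) *: W l z /\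
    Vcl Omega xi s t (P z) (Q z) = W l z.
  by apply: filterS2 lstar_near near_ok => z h1 [_ h2]; exact: flow_eq.
split; last first.
  by apply: hasd_near hW yV _; apply: filterS nr => z [].
have hs : hasd F y (fun=> s) (fun=> 0) by exact: hasd_cst.
have hTs := @hasdB _ _ _ _ FF _ _ _ _ _ hT hs.
have h := @hasdB _ _ _ _ FF _ _ _ _ _ hX (@hasdZ _ _ _ _ FF Fy _ _ _ _ _ hTs hW).
have h' := @hasd_near _ _ _ _ FF _ _ (fun z => Xcl Omega xi s t (P z) (Q z)) _ h yX.
apply: (hasd_eqL (h' _)) => [|u]; first by apply: filterS nr => z [].
by rewrite subr0 opprD addrA.
Qed.

Let st : s <= t.
Proof.
move: lstar_lt => /andP[_ /ltW h]; apply: le_trans h _.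
exact: (cycle_t_le dom t (P y) Q0 (leq0n l)).
Qed.

Let es : 0 <= e * (t - s). Proof. by rewrite mulr_ge0 ?subr_ge0 // ltW. Qed.

Lemma flow_variation : exists LX LV : U -> V,
  [/\ hasd F y (fun z => Xcl Omega xi s t (P z) (Q z)) LX,
      hasd F y (fun z => Vcl Omega xi s t (P z) (Q z)) LV,
      forall h, `|LX h| <= K * expR (K * (e * (t - s))) * D h &
      forall h, `|LV h| <= K * expR (K * (e * (t - s))) * (e ^+ 2 / A) * D h].
Proof.
have [K1 KC K2 K3 KC2] := K_ge; have K0 : 0 <= K by exact: le_trans K1.
have ex_ge (k : R) : k <= K -> expR (k * (e * (t - s))) <= expR (K * (e * (t - s))).
  by move=> h; rewrite ler_expR ler_wpM2r.
have AC : A <= C * e by apply: (ue_alpha_le ue).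
have ex0 : 0 < expR (K * (e * (t - s))) by exact: expR_gt0.
have ex1 : 1 <= expR (K * (e * (t - s))) by rewrite -expR0 ler_expR mulr_ge0.
have exs : e * (t - s) <= expR (K * (e * (t - s))).
  by rewrite (le_trans _ (expR_ge1Dx _)) // ler_wpDl // ler_peMl.
move: (expR _) ex_ge ex0 ex1 exs => G ex_ge G0 G1 Gs.
have p0 h : 0 <= e * `|LP h| / A by rewrite divr_ge0 ?mulr_ge0 // ltW.
have q0 h : 0 <= `|LQ h| / e by rewrite divr_ge0 // ltW.
move: lstar_lt hasd_flow; case: l => [_ hf|m /andP[h1 h2] hf].
  have hT : hasd F y (T 0) (fun=> 0) by exact: hasd_cst.
  have [h1 h2] := hf _ _ _ hP hQ hT; exists (fun h => LP h - (t - s) *: LQ h), LQ.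
  split => //; first by apply: hasd_eqL h1 _ => h; rewrite scale0r subr0.
  - move=> h; rewrite (le_trans (ler_normB _ _)) // mulrDr lerD //.
      apply: (@le_trans _ _ (C * (e * `|LP h| / A))).
        by rewrite !mulrA ler_pdivlMr // mulrC ler_wpM2r.
      by rewrite ler_wpM2r // (le_trans KC) // ler_peMr.
    rewrite normrZ ger0_norm ?subr_ge0 //.
    have -> : (t - s) * `|LQ h| = e * (t - s) * (`|LQ h| / e).
      by move: (`|LQ h|) => r; field; rewrite gt_eqF.
    by rewrite ler_wpM2r // (le_trans Gs) // ler_peMl // ltW.
  - move=> h; apply: (@le_trans _ _ (e * (`|LQ h| / e))).
      by rewrite mulrCA divff ?mulr1 // gt_eqF.
    apply: (@le_trans _ _ (e * D h)); first by rewrite ler_wpM2l ?(ltW e0) // lerDr.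
    rewrite ler_wpM2r // mulrA ler_pdivlMr //.
    apply: (@le_trans _ _ (C * e ^+ 2)); first by rewrite expr2 mulrA mulrC ler_wpM2r // ltW.
    by rewrite ler_wpM2r ?sqr_ge0 // (le_trans KC) // ler_peMr.
have [LX [LV [LT [[hX hW hT] hE]]]] := cycle_variation m.
have [g1 g2] := hf _ _ _ hX hW hT.
exists (fun h => LX h - LT h *: W m.+1 y - (T m.+1 y - s) *: LV h), LV.
have [xm am] := cycle_transversal dom t m Ky Q0 ng.
have Wm0 : W m.+1 y != 0 by exact: cycle_v_neq0.
have We : enorm (W m.+1 y) = e by exact: enorm_cycle_v.
have a10 : 0 < a1 by rewrite oppr_gt0; exact: exit_transversal.
have Aa : A <= C * a1 by apply: (ue_alpha ue).
pose g := expR (C * (e * (t - s))).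
have g0 : 0 < g by exact: expR_gt0.
have gE : expR (C * (enorm (Q y) * (ct t (P y) (Q y) 1 - ct t (P y) (Q y) m.+1))) <= g.
  by apply: growth_le => //; exact: ltW.
have EE h : scaled_energy xi (X m.+1 y) (W m.+1 y) (LX h) (LV h) (LT h)
    <= g * (C * ((C + 1) * D h)).
  have [_ /le_trans] := hE h; apply.
  have a1A : e * `|LP h| / a1 <= C * (e * `|LP h| / A).
    have : 0 <= e * `|LP h| by rewrite mulr_ge0 // ltW.
    move: (e * _) => r r0; rewrite ler_pdivrMr //.
    have -> : C * (r / A) * a1 = r * (C * a1) / A by ring.
    by rewrite ler_pdivlMr // ler_wpM2l.
  rewrite ler_pM ?expR_ge0 ?mulr_ge0 ?addr_ge0 ?(ltW C0) //.
    by rewrite divr_ge0 ?mulr_ge0 // ltW.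
  rewrite ler_wpM2l ?(ltW C0) // /D mulrDl mul1r mulrDr.
  have := mulr_ge0 (ltW C0) (q0 h); have := p0 h; have := q0 h; move: a1A.
  rewrite -/e -/a1; move: (e * _ / a1) (e * _ / A) (`|LQ h| / e) => r1 r2 r3 h3 h4 h5 h6.
  lra.
have Ege h : 0 <= scaled_energy xi (X m.+1 y) (W m.+1 y) (LX h) (LV h) (LT h).
  by apply: scaled_energy_ge0; rewrite ?(ltW am).
split => // h.
  have e1 : `|LX h - LT h *: W m.+1 y|
      <= scaled_energy xi (X m.+1 y) (W m.+1 y) (LX h) (LV h) (LT h).
    rewrite /scaled_energy /jac_energy scale_unit // -!addrA lerDl !addr_ge0 // mulr_ge0 //.
    by rewrite ddZ // mulr_ge0 ?invr_ge0 ?sqrtr_ge0 // ltW.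
  have e2 : (T m.+1 y - s) * `|LV h|
      <= C ^+ 2 * scaled_energy xi (X m.+1 y) (W m.+1 y) (LX h) (LV h) (LT h).
    have := ue_velocity ue (LX h) (LV h) (LT h) xm Wm0 am.
    have := ue_normal_lb ue xm Wm0 am.
    have : T m.+1 y - s <= tb Omega (X m.+1 y) (W m.+1 y).
      move: h1; rewrite (cycle_tS Omega xi t _ _ m.+1) -/(T m.+1 y) -/(X m.+1 y) -/(W m.+1 y).
      by move: (T _ _) (tb _ _ _) => p q pq; lra.
    rewrite We -/(X m.+1 y) -/(W m.+1 y); move: am.
    rewrite -/(X m.+1 y) -/(W m.+1 y); move: (dd _ xi _) (tb _ _ _) (scaled_energy _ _ _ _ _ _).
    move=> a tau E a0 ts ta av; apply: (@le_trans _ _ (tau * `|LV h|)); first by rewrite ler_wpM2r.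
    have ee0 := exprn_gt0 2 e0; rewrite -(ler_pM2l ee0) mulrA.
    apply: (@le_trans _ _ (C * a * `|LV h|)); first by rewrite ler_wpM2r.
    have -> : e ^+ 2 * (C ^+ 2 * E) = C * (C * e ^+ 2 * E) by ring.
    by rewrite -mulrA ler_wpM2l // ltW.
  rewrite (le_trans (ler_normB _ _)) // normrZ ger0_norm ?subr_ge0 ?(ltW h2) //.
  apply: le_trans (lerD e1 e2) _; rewrite -[X in X + _]mul1r -mulrDl.
  apply: (@le_trans _ _ ((1 + C ^+ 2) * (g * (C * ((C + 1) * D h))))).
    by rewrite ler_wpM2l // addr_ge0 // sqr_ge0.
  have -> : (1 + C ^+ 2) * (g * (C * ((C + 1) * D h)))
    = C * (C + 1) * (1 + C ^+ 2) * g * D h by ring.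
  rewrite ler_wpM2r // ler_pM ?(ltW g0) ?ex_ge //.
  by rewrite !mulr_ge0 ?addr_ge0 ?sqr_ge0 // ltW.
have := ue_velocity ue (LX h) (LV h) (LT h) xm Wm0 am.
have := cycle_normal_ratio t m Ky Q0 ng; rewrite We -/(X m.+1 y) -/(W m.+1 y) -/a1.
move: (EE h) (Ege h) am gE; rewrite -/(X m.+1 y) -/(W m.+1 y).
move: (dd (W m.+1 y) xi _) (scaled_energy _ _ _ _ _ _) (expR _) => a E g' Eg E0' a0 gg a1g av.
have Ag : A <= C * g * a.
  by rewrite (le_trans Aa) // -mulrA ler_wpM2l ?(ltW C0) // (le_trans a1g) // ler_wpM2r // ltW.
rewrite -(ler_pM2l A0).
apply: (@le_trans _ _ (C * g * a * `|LV h|)); first by rewrite ler_wpM2r.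
apply: (@le_trans _ _ (C * g * (C * e ^+ 2 * (g * (C * ((C + 1) * D h)))))).
  rewrite -mulrA ler_wpM2l ?mulr_ge0 ?(ltW C0) ?(ltW g0) // (le_trans av) // ler_wpM2l //.
  by rewrite mulr_ge0 ?sqr_ge0 // ltW.
have -> : A * (K * G * (e ^+ 2 / A) * D h) = e ^+ 2 * (K * G * D h).
  by move: A0 => ?; field; rewrite gt_eqF.
have -> : C * g * (C * e ^+ 2 * (g * (C * ((C + 1) * D h)))) =
  e ^+ 2 * (C ^+ 3 * (C + 1) * (g * g) * D h) by ring.
rewrite ler_wpM2l ?sqr_ge0 // ler_wpM2r //.
rewrite ler_pM ?mulr_ge0 ?exprn_ge0 ?addr_ge0 ?(ltW C0) ?(ltW g0) //.
by rewrite /g -expRD -mulrDl -mulr2n -mulr_natl; exact: ex_ge.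
Qed.

End LastCycle.

Hypothesis st : s <= t.
Hypothesis no_bounce : forall lstar : nat, is_lstar Omega xi s t (P y) (Q y) lstar ->
  forall l : nat, (1 <= l <= lstar.+1)%N -> s <> cycle_t Omega xi t (P y) (Q y) l.

Lemma flow_derivative : exists LX LV : U -> V,
  [/\ hasd F y (fun z => Xcl Omega xi s t (P z) (Q z)) LX,
      hasd F y (fun z => Vcl Omega xi s t (P z) (Q z)) LV,
      forall h, `|LX h| <= K * expR (K * (e * (t - s))) * D h &
      forall h, `|LV h| <= K * expR (K * (e * (t - s))) * (e ^+ 2 / A) * D h].
Proof.
move: st; rewrite le_eqVlt => /orP[/eqP sE|slt]; last first.
  have [l hl] := lstar_ex Ky Q0 ng slt.
  apply: (@flow_variation l).
  move: (hl) => /andP[h1 ->]; rewrite andbT lt_neqAle h1 andbT eq_sym; apply/eqP.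
  (* The instance [l = lstar + 1] makes the lower inequality of [is_lstar] strict. *)
  by apply: (no_bounce hl); rewrite leqnn.
have K0 : 0 <= K * expR (K * (e * (t - s))).
  by rewrite mulr_ge0 ?expR_ge0 // mulr_ge0 // exprn_ge0 // addr_ge0 // ltW.
exists (fun=> 0), (fun=> 0); split => [||h|h].
- apply: (@hasd_near _ _ _ _ FF _ (fun=> 0)); first exact: hasd_cst.
    by rewrite sE; have [] := cl_initial dom t (P y) Q0.
  by apply: filterS near_ok => z [_ Qz]; rewrite sE; have [] := cl_initial dom t (P z) Qz.
- apply: (@hasd_near _ _ _ _ FF _ (fun=> 0)); first exact: hasd_cst.
    by rewrite sE; have [] := cl_initial dom t (P y) Q0.
  by apply: filterS near_ok => z [_ Qz]; rewrite sE; have [] := cl_initial dom t (P z) Qz.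
- by rewrite normr0 mulr_ge0.
- by rewrite normr0 mulr_ge0 // mulr_ge0 // divr_ge0 ?sqr_ge0 ?sqrtr_ge0.
Qed.

End Family.
End Variation.

(** * Jacobian matrices *)

Section Jacobian.
Variables (R : realType) (n m : nat).
Local Notation U := 'rV[R]_n.
Local Notation W := 'rV[R]_m.

(* the filter sees enough directions at [y] for a relative derivative to be unique *)
Definition spanning (F : set_system U) (y : U) := forall B : U -> W, linear B ->
  (forall e : R, 0 < e -> \forall z \near F, `|B (z - y)| <= e * `|z - y|) ->
  forall h, B h = 0.

(** On a ray [y + r u] the factor [r] cancels by homogeneity, leaving [|B u| <= e] for every
    [e > 0]. *)
Lemma linear_lito_eq0 (F : set_system U) (y u : U) (B : U -> W) : linear B ->
  (forall e : R, 0 < e -> \forall z \near F, `|B (z - y)| <= e * `|z - y|) ->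
  (forall S : set U, F S -> exists2 r : R, 0 < r & S (y + r *: u)) -> B u = 0.
Proof.
move=> lB hB hu; apply/eqP; rewrite -normr_le0; apply/ler_addgt0Pr => e e0; rewrite add0r.
have e1 : 0 < e / (`|u| + 1) by rewrite divr_gt0 // ltr_wpDl.
have [r r0] := hu _ (hB _ e1); rewrite /= addrAC subrr add0r.
have B0 : B 0 = 0 by have := lB (-1) 0 0; rewrite scaler0 addr0 scaleN1r => ->; rewrite addNr.
have -> : B (r *: u) = r *: B u by have := lB r u 0; rewrite !addr0 B0 addr0.
rewrite !normrZ (gtr0_norm r0) mulrCA ler_pM2l // => /le_trans; apply.
by rewrite mulrAC ler_pdivrMr ?ltr_wpDl // ler_wpM2l ?(ltW e0) // lerDl.
Qed.

Lemma spanning_nbhs (y : U) : spanning (nbhs y) y.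
Proof.
move=> B lB hB u; apply: (linear_lito_eq0 lB hB) => S /nearP_norm[d d0 hd].
have [r r0 rd] := short_ray u d0; exists r => //.
by apply: hd; rewrite addrAC subrr add0r.
Qed.

(** The differential ['d f F] is a chosen map with the littleo property; [spanning] identifies it
    with [L]. The factor [n * m] counts the entries of the matrix. *)
Lemma hasd_jacobian (F : filter_on U) (y : U) (f L : U -> W) (b : R) : lim F = y ->
  spanning F y -> hasd F y f L -> 0 <= b -> (forall h, `|L h| <= b * `|h|) ->
  differentiable f F /\ enorm (lin1_mx ('d f F)) <= (n * m)%:R * b.
Proof.
move=> Fy sp [lL _ hL] b0 Lb.
pose LL : {linear U -> W} := HB.pack L (GRing.isLinear.Build R U W *:%R L lL).
have df : differentiable f F.
  apply: (@differentiable_filterW _ _ _ _ _ LL); last by rewrite Fy.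
  exact: (@linear_le_continuous R n W LL b Lb).
split => //; apply: enorm_le_entries => // i j; rewrite mxE.
have -> : 'd f F (delta_mx 0 i) = L (delta_mx 0 i).
  apply/eqP; rewrite -subr_eq0; apply/eqP.
  apply: (sp (fun h => 'd f F h - L h)) => [a u w|e e0].
    by rewrite linearP lL scalerBr opprD addrACA.
  have e2 : 0 < e / 2 by rewrite divr_gt0.
  have := differentiable_filter_le df e2; rewrite Fy => h1.
  apply: filterS2 h1 (hL _ e2) => z; move: ('d f F (z - y)) (L (z - y)) (f z - f y) => p q r h1 h2.
  have -> : p - q = (r - q) - (r - p) by rewrite opprB [RHS]addrC addrA subrK.
  by rewrite (le_trans (ler_normB _ _)) // (le_trans (lerD h2 h1)) // -mulrDl -splitr.
rewrite (le_trans (entry_le_norm _ _)) // (le_trans (Lb _)) // ler_piMr //.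
exact: norm_delta_le.
Qed.

End Jacobian.

Section WithinDomain.
Variables (R : realType) (n m : nat).
Local Notation V := 'rV[R]_3.
Variables (Omega : set V) (xi : V -> R).
Hypothesis dom : strictly_convex_domain Omega xi.
Implicit Types x u : V.

Lemma lim_within x : closure Omega x -> lim (within (closure Omega) (nbhs x)) = x.
Proof.
move=> Kx; have PF : ProperFilter (within (closure Omega) (nbhs x)).
  by apply: within_nbhs_proper; apply: subset_closure.
apply: (@cvg_lim _ (@norm_hausdorff _ _) _ _ PF id).
exact: cvg_within.
Qed.

Lemma inward_ray x u : xi x <= 0 -> (xi x = 0 -> dd u xi x < 0) ->
  forall S : set V, within (closure Omega) (nbhs x) S -> exists2 r : R, 0 < r & S (x + r *: u).
Proof.
move=> x0 xu S /nearP_norm[d d0 hd]; have sxi := scd_smooth dom.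
have [d' d'0 hd'] : exists2 d' : R, 0 < d' &
    forall r : R, 0 < r -> `|r *: u| < d' -> xi (x + r *: u) <= 0.
  move: x0; rewrite le_eqVlt => /orP[/eqP xe|xlt].
    have e0 : 0 < - dd u xi x / (`|u| + 1).
      by rewrite divr_gt0 ?oppr_gt0 ?xu // ltr_wpDl.
    have [d1 d10 h1] := smooth_littleo x sxi e0.
    exists d1 => // r r0 ru; have := h1 (x + r *: u); rewrite addrAC subrr add0r => /(_ ru).
    rewrite xe subr0 ddZ // normrZ (gtr0_norm r0) => /(le_trans (ler_norm _)).
    rewrite lerBlDr => /le_trans; apply.
    rewrite mulrCA -mulrDr pmulr_rle0 // -[leRHS](addNr (dd u xi x)) lerD2r.
    rewrite mulrAC ler_pdivrMr ?ltr_wpDl // ler_wpM2l ?lerDl //.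
    by rewrite oppr_ge0 ltW // xu.
  have /nearP_norm[d1 d10 h1] : \forall z \near x, xi z < 0.
    by have /cvgr_lt/(_ _ xlt) := @smooth_continuous _ _ _ sxi x.
  by exists d1 => // r r0 ru; apply/ltW/h1; rewrite addrAC subrr add0r.
have [b [b0 bd bd']] := gt0_common d0 d'0.
have [r r0 ru] := short_ray u b0.
exists r => //; apply: hd; first by rewrite addrAC subrr add0r (lt_trans ru).
by apply/(closure_xi dom)/hd' => //; exact: lt_trans bd'.
Qed.

(** At a boundary point only the directions with [dd u xi x < 0] are tested; they form an open
    half-space, which spans. *)
Lemma spanning_within x : closure Omega x ->
  @spanning R 3 m (within (closure Omega) (nbhs x)) x.
Proof.
move=> /(closure_xi dom) x0 B lB hB u; have sxi := scd_smooth dom.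
have zero w : (xi x = 0 -> dd w xi x < 0) -> B w = 0.
  by move=> hw; apply: (linear_lito_eq0 lB hB); exact: inward_ray.
have [xe|xne] := eqVneq (xi x) 0; last by apply: zero => h; rewrite h eqxx in xne.
pose G := gradv xi x.
have G0 : 0 < dot G G by rewrite lt_neqAle dot_ge0 eq_sym dot_eq0 andbT (gradv_neq0 dom).
(* With this [k], the scalar product of [u - k G] with [G] is at most [-1]; thus [u] is a
   combination of the two inward directions [- G] and [u - k G]. *)
pose k := (`|dot u G| + 1) / dot G G.
have BN : B (- G) = 0 by apply: zero => _; rewrite ddN // dd_gradv // oppr_lt0.
have -> : u = (- k) *: (- G) + (u - k *: G) by rewrite scaleNr scalerN opprK addrC subrK.
rewrite lB BN scaler0 add0r; apply: zero => _.
rewrite ddB // ddZ // !dd_gradv // -/G /k divfK ?gt_eqF //.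
by have := ler_norm (dot u G); lra.
Qed.

Lemma not_gamma0_nongrazing (x v : V) : ~ gamma0 Omega xi (x, v) -> nongrazing xi x v.
Proof.
move=> ng x0; apply/eqP => h; apply: ng; split.
  by have := scd_boundary dom; rewrite /= => ->.
by rewrite /= /normal dotZl dotC -gradv_grad -(dd_gradv _ _ (scd_smooth dom)) h mulr0.
Qed.

End WithinDomain.

Theorem theorem4 (R : realType) (Omega : set 'rV[R]_3) (xi : 'rV[R]_3 -> R)
    (Omega_xi : strictly_convex_domain Omega xi) :
  exists C : R, 0 < C /\ exists K : R, 0 < K /\
  forall (s t : R) (x v : 'rV[R]_3),
    closure Omega x -> v != 0 -> s <= t -> ~ gamma0 Omega xi (x, v) ->
    (forall lstar : nat, is_lstar Omega xi s t x v lstar ->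
      forall l : nat, (1 <= l <= lstar.+1)%N ->
        s <> cycle_t Omega xi t x v l) ->
    [/\ differentiable_in (closure Omega) (fun y => Xcl Omega xi s t y v) x /\
        enorm (jacobian_in (closure Omega) (fun y => Xcl Omega xi s t y v) x)
          <= K * (expR (C * enorm v * (t - s))
                  * (enorm v / Num.sqrt (alpha xi x v))),
        differentiable (fun w => Xcl Omega xi s t x w) v /\
        enorm (jacobian (fun w => Xcl Omega xi s t x w) v)
          <= K * (expR (C * enorm v * (t - s)) * (1 / enorm v)),
        differentiable_in (closure Omega) (fun y => Vcl Omega xi s t y v) x /\
        enorm (jacobian_in (closure Omega) (fun y => Vcl Omega xi s t y v) x)
          <= K * (expR (C * enorm v * (t - s))
                  * (enorm v ^+ 3 / alpha xi x v)) &
        differentiable (fun w => Vcl Omega xi s t x w) v /\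
        enorm (jacobian (fun w => Vcl Omega xi s t x w) v)
          <= K * (expR (C * enorm v * (t - s))
                  * (enorm v / Num.sqrt (alpha xi x v)))].
Proof.
have [C ue] := uniform_estimates_ex Omega_xi; have C0 := ue_gt0 ue.
pose K := 2 * (1 + C) ^+ 4.
have K0 : 0 < K by rewrite mulr_gt0 // exprn_gt0 // addr_gt0.
(* The rate is [K]; in the prefactor, [9 = 3 * 3] is the number of entries of a Jacobian matrix. *)
exists K; split => //; exists (9 * K); split; first by rewrite mulr_gt0.
move=> s t x v Kx v0 st /(not_gamma0_nongrazing Omega_xi) ng nb.
have e0 := enorm_gt0 v0; have a0 := ue_alpha_gt0 ue Kx v0 ng.
have A0 : 0 < Num.sqrt (alpha xi x v) by rewrite sqrtr_gt0.
have A2 : alpha xi x v = Num.sqrt (alpha xi x v) ^+ 2 by rewrite sqr_sqrtr // ltW.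
have G0 := expR_gt0 (K * enorm v * (t - s)).
pose F := within (closure Omega) (nbhs x).
have Fx (d : R) : 0 < d -> \forall z \near F, `|z - x| < d.
  move=> d0; have : \forall z \near x, `|z - x| < d by apply/nearP_norm; exists d.
  by apply: filterS => z.
have Fv (d : R) : 0 < d -> \forall z \near nbhs v, `|z - v| < d.
  by move=> d0; have : \forall z \near v, `|z - v| < d by apply/nearP_norm; exists d.
have okx : \forall z \near F, closure Omega z /\ v != 0.
  by apply: filterS (withinT _ _) => z Kz.
have okv : \forall w \near nbhs v, closure Omega x /\ w != 0.
  have : \forall w \near v, w != 0.
    apply/nearP_norm; exists `|v|; first by rewrite normr_gt0.
    by move=> w; apply: contraTneq => ->; rewrite sub0r normrN ltxx.
  by apply: filterS => w.
(* The two families of initial data: [(z, v)] for [z] near [x] in the closed domain, and [(x, z)]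
   for [z] near [v]. In each, one of the two initial variations is zero, which leaves a single term
   in the bound. *)
have ix : hasd F x (fun z => z) (fun h => h) by exact: hasd_id.
have cv : hasd F x (fun=> v) (fun=> 0) by exact: hasd_cst.
have iv : hasd (nbhs v) v (fun z => z) (fun h => h) by exact: hasd_id.
have cx : hasd (nbhs v) v (fun=> x) (fun=> 0) by exact: hasd_cst.
have [LX [LV [hX hV bX bV]]] := flow_derivative Omega_xi ue Fx ix cv Kx v0 ng okx st nb.
have [MX [MV [kX kV cX cV]]] := flow_derivative Omega_xi ue Fv cx iv Kx v0 ng okv st nb.
have lx := lim_within Kx.
have lv : lim (nbhs v) = v by exact/lim_id/norm_hausdorff.
move: bX bV cX cV G0 A2; have -> : K * enorm v * (t - s) = K * (enorm v * (t - s)) by ring.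
rewrite -/K; clearbody K; move: A0 e0 {a0}; move: (Num.sqrt _) => A.
move: (enorm v) (expR _) (alpha xi x v) => e G a A0 e0 bX bV cX cV G0 ->.
(* The common end of the four bounds: [B] is the bound delivered by [flow_derivative], rewritten as
   a multiple of [|h|] with the factor [b] prescribed by the statement. *)
have fin (F' : filter_on 'rV[R]_3) y (f L : 'rV[R]_3 -> 'rV[R]_3) (b : R) (B : 'rV[R]_3 -> R) :
    lim F' = y -> spanning 3 F' y -> hasd F' y f L -> 0 < b ->
    (forall h, `|L h| <= B h) -> (forall h, B h = K * G * b * `|h|) ->
    differentiable f F' /\ enorm (lin1_mx ('d f F')) <= 9 * K * (G * b).
  move=> h1 h2 h3 b0 h4 h5; have -> : 9 * K * (G * b) = (3 * 3)%:R * (K * G * b).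
    by rewrite -[(3 * 3)%:R]/(9 : R); ring.
  by apply: (hasd_jacobian h1 h2 h3) => [|h]; [rewrite !mulr_ge0 // ltW|rewrite -h5].
have sx := @spanning_within _ 3 _ _ Omega_xi _ Kx; have sv := @spanning_nbhs _ _ 3 v.
split.
- apply: (fin _ _ _ _ _ _ lx sx hX _ bX) => [|h]; first exact: divr_gt0.
  by rewrite normr0; field; rewrite !gt_eqF.
- apply: (fin _ _ _ _ _ _ lv sv kX _ cX) => [|h]; first exact: divr_gt0.
  by rewrite normr0; field; rewrite !gt_eqF.
- apply: (fin _ _ _ _ _ _ lx sx hV _ bV) => [|h]; first by rewrite divr_gt0 ?exprn_gt0.
  by rewrite normr0; field; rewrite !gt_eqF.
- apply: (fin _ _ _ _ _ _ lv sv kV _ cV) => [|h]; first exact: divr_gt0.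
  by rewrite normr0; field; rewrite !gt_eqF.
Qed.
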